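(* Let $f,g:\mathbb{R}^{d_x}\times\mathbb{R}^{d_y}\to\mathbb{R}$ satisfy the standing assumption (a)–(e) in the context, with constants $\mu,C_f,L_f,L_g,\rho_f,\rho_g,\overline\sigma,\ell,\kappa$, and suppose the stochastic gradient assumption in the context holds with constants $M_f,M_g$. Let $\varphi(x)=\min_{y\in Y^*(x)}f(x,y)$, $\epsilon>0$, $x_0\in\mathbb{R}^{d_x}$, $y_0\in\mathbb{R}^{d_y}$. Define $\Delta=\varphi(x_0)-\inf_{x\in\mathbb{R}^{d_x}}\varphi(x)$ and $R=\mathrm{dist}^2(y_0,Y^*(x_0))$, and suppose both $\Delta$ and $R$ are bounded. Set the parameters of the algorithm F${}^2$BSA (see context) as $$\eta\asymp\ell^{-1}\kappa^{-3},\quad \sigma\asymp\min\Big\{\frac R\kappa,\frac{\epsilon}{\ell\kappa^3},\frac{L_g}{L_f},\frac{\rho_g}{\rho_f},\overline\sigma\Big\},\quad \tau=\frac1{\sigma L_f+L_g},$$ $$B\asymp\frac{L_g^2(\sigma^2M_f^2+M_g^2)}{\mu^2\sigma^2\epsilon^2},\qquad K_t\asymp\frac{L_g}{\mu}\log\Big(\frac{L_g^3\delta_t}{\mu\sigma^2\epsilon^2}\Big),$$ where $\delta_t$ is computed via the recursion $$\delta_{t+1}=\frac12\delta_t+\frac{8L_g^2}{\mu^2}\|x_{t+1}-x_t\|^2+O\Big(\frac{\sigma^2\epsilon^2}{L_g^2}\Big),\qquad\delta_0\asymp R.$$ Then (for suitable choices of the hidden constants) F${}^2$BSA finds an $\epsilon$-first-order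 stationary point of $\varphi$ in expectation (i.e. $\mathbb{E}\|\nabla\varphi(x_t)\|\le\epsilon$ for some $t<T$) within $T=O(\ell\kappa^3\epsilon^{-2})$ iterations. The total number of stochastic first-order oracle calls is bounded by $\tilde O(\kappa TB)$, namely by - $O(\ell\kappa^4\epsilon^{-2}\log(\rho_f\ell\kappa/\epsilon))$ if $M_f=0$, $M_g=0$; - $O(\ell\kappa^6\epsilon^{-4}\log(\rho_f\ell\kappa/\epsilon))$ if $M_f>0$, $M_g=0$; - $O(\ell^3\kappa^{12}\epsilon^{-6}\log(\rho_f\ell\kappa/\epsilon))$ if $M_f>0$, $M_g>0$.
   Context: A function $h:\mathbb{R}^d\to\mathbb{R}$ is $\mu$-PL ($\mu>0$) if it has a non-empty set of minimizers and $\|\nabla h(x)\|^2\ge2\mu(h(x)-\min h)$ for all $x$. For $\sigma\ge0$ let $h_\sigma=\sigma f+g$, $Y^*_\sigma(x)=\arg\min_{y\in\mathbb{R}^{d_y}}h_\sigma(x,y)$, and $Y^*(x)=Y^*_0(x)=\arg\min_yg(x,y)$. $\mathrm{dist}(v,S)=\inf_{s\in S}\|v-s\|$. Standing assumption. There are $\overline\sigma>0$ and positive constants such that: (a) $h_\sigma(x,y)$ is $\mu$-PL in $y$ (for every $x$) for every $0\le\sigma\le\overline\sigma$; (b) $f$ is $C_f$-Lipschitz in $y$ and has $L_f$-Lipschitz gradients; (c) $g$ has $L_g$-Lipschitz gradients; (d) $\nabla^2_{xy}f$ and $\nabla^2_{yy}f$ exist and are $\rho_f$-Lipschitz; (e)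 $g$ is twice differentiable with $\rho_g$-Lipschitz Hessian. Put $\ell=\max\{C_f,L_f,L_g,\rho_g\}$ and $\kappa=\ell/\mu$. Under this assumption $\varphi$ is differentiable. Stochastic gradient assumption. $f(x,y)=\mathbb{E}_\xi[F(x,y;\xi)]$, $g(x,y)=\mathbb{E}_\zeta[G(x,y;\zeta)]$ for random vectors $\xi,\zeta$; $\mathbb{E}_\xi[\nabla F(x,y;\xi)]=\nabla f(x,y)$, $\mathbb{E}_\zeta[\nabla G(x,y;\zeta)]=\nabla g(x,y)$; and $\mathbb{E}_\xi\|\nabla F(x,y;\xi)-\nabla f(x,y)\|^2\le M_f^2$, $\mathbb{E}_\zeta\|\nabla G(x,y;\zeta)-\nabla g(x,y)\|^2\le M_g^2$, with $M_f,M_g\ge0$. For an integer batch size $B\ge1$, $\nabla f(x,y;B)=\frac1B\sum_{i=1}^B\nabla F(x,y;\xi_i)$ and $\nabla g(x,y;B)=\frac1B\sum_{i=1}^B\nabla G(x,y;\zeta_i)$ with fresh i.i.d. samples $\xi_i$, $\zeta_i$ (subscripts $x,y$ denote the corresponding blocks). Each evaluation of $\nabla F$ or $\nabla G$ at one sample is one stochastic first-order oracle call. Algorithm F${}^2$BSA$(x_0,y_0,\delta_0,\eta,\tau,\sigma,T,B)$: set $z_0=y_0$. For $t=0,\dots,T-1$: set $y_t^0=y_t$, $z_t^0=z_t$, and choose $K_t$ from $\delta_t$ by the stated formula; for $k=0,\dots,K_t-1$ set $$z_t^{k+1}=z_t^k-\tau\nabla_yg(x_t,z_t^k;B),\qquad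 y_t^{k+1}=y_t^k-\tau\big(\sigma\nabla_yf(x_t,y_t^k;B)+\nabla_yg(x_t,y_t^k;B)\big);$$ then set $\hat\nabla\varphi(x_t)=\nabla_xf(x_t,y_t^{K_t};B)+\big(\nabla_xg(x_t,y_t^{K_t};B)-\nabla_xg(x_t,z_t^{K_t};B)\big)/\sigma$, $x_{t+1}=x_t-\eta\hat\nabla\varphi(x_t)$, $y_{t+1}=y_t^{K_t}$, $z_{t+1}=z_t^{K_t}$, and compute $\delta_{t+1}$ from $\delta_t,x_{t+1},x_t$ by the stated recursion. Asymptotic notation: $\asymp$ and $O(\cdot)$ hide numerical constants, and $\tilde O(\cdot)$ additionally hides logarithmic factors; $\Delta,R,M_f,M_g$ are treated as bounded quantities and may enter the hidden constants. When the formula for $B$ is below $1$, $B=1$ is used. The bounds are understood in the usual regime of small $\epsilon$ and $\kappa\ge1$. *)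

(* Defs.v *)
From HB Require Import structures.
From mathcomp Require Import all_boot all_order all_algebra.
From mathcomp Require Import all_classical all_reals all_analysis.
Import Order.TTheory GRing.Theory Num.Theory.
Import numFieldNormedType.Exports.

Set Implicit Arguments.
Unset Strict Implicit.
Unset Printing Implicit Defensive.

Local Open Scope classical_set_scope.
Local Open Scope ring_scope.

(* The norm of the library on 'rV[R]_n is the sup norm, hence [enorm]. *)
Definition enorm (R : realType) (n : nat) (v : 'rV[R]_n) : R :=
  Num.sqrt (\sum_(i < n) v 0 i ^+ 2).

Definition dist (R : realType) (n : nat) (v : 'rV[R]_n) (S : set 'rV[R]_n) : R :=
  inf [set enorm (v - s) | s in S].

Definition grad (R : realType) (n : nat) (h : 'rV[R]_n -> R) (p : 'rV[R]_n) :
    'rV[R]_n :=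
  \row_i 'D_(delta_mx 0 i) h p.

(* Entry (i, j) is the i-th partial derivative of the j-th partial derivative. *)
Definition hessian (R : realType) (n : nat) (h : 'rV[R]_n -> R) (p : 'rV[R]_n) :
    'M[R]_n :=
  'J (grad h) p.

(* A function of (x, y) is a function on 'rV_(dx + dy), evaluated at
   [row_mx x y]; x-blocks and y-blocks are [lsubmx] and [rsubmx]. *)
Definition grad_y (R : realType) (dx dy : nat) (h : 'rV[R]_(dx + dy) -> R)
    (x : 'rV[R]_dx) (y : 'rV[R]_dy) : 'rV[R]_dy :=
  rsubmx (grad h (row_mx x y)).

Definition hess_xy (R : realType) (dx dy : nat) (h : 'rV[R]_(dx + dy) -> R)
    (x : 'rV[R]_dx) (y : 'rV[R]_dy) : 'M[R]_(dx, dy) :=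
  'J (fun u => grad_y h u y) x.

Definition hess_yy (R : realType) (dx dy : nat) (h : 'rV[R]_(dx + dy) -> R)
    (x : 'rV[R]_dx) (y : 'rV[R]_dy) : 'M[R]_dy :=
  'J (grad_y h x) y.

(* The spectral norm of A is at most c. *)
Definition opnorm_le (R : realType) (m n : nat) (A : 'M[R]_(m, n)) (c : R) : Prop :=
  forall v : 'rV[R]_m, enorm (v *m A) <= c * enorm v.

Definition argmin (R : realType) (n : nat) (h : 'rV[R]_n -> R) : set 'rV[R]_n :=
  [set y | forall y', h y <= h y'].

Definition PL (R : realType) (n : nat) (mu : R) (h : 'rV[R]_n -> R) : Prop :=
  argmin h !=set0 /\
  forall y, 2 * mu * (h y - inf (range h)) <= enorm (grad h y) ^+ 2.

Definition lipschitz_gradient (R : realType) (n : nat) (L : R)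
    (h : 'rV[R]_n -> R) : Prop :=
  (forall p, differentiable h p) /\
  forall p q, enorm (grad h p - grad h q) <= L * enorm (p - q).

Record bilevel_assumption (R : realType) (dx dy : nat)
    (mu Cf Lf Lg rhof rhog sbar : R) (f g : 'rV[R]_(dx + dy) -> R) : Prop := {
  ba_PL : forall sigma x, 0 <= sigma <= sbar ->
    PL mu (fun y : 'rV[R]_dy => sigma * f (row_mx x y) + g (row_mx x y));
  ba_f_lip : forall (x : 'rV[R]_dx) (y y' : 'rV[R]_dy),
    `|f (row_mx x y) - f (row_mx x y')| <= Cf * enorm (y - y');
  ba_f_smooth : lipschitz_gradient Lf f;
  ba_g_smooth : lipschitz_gradient Lg g;
  ba_f_xy : forall (x : 'rV[R]_dx) (y : 'rV[R]_dy),
    differentiable (fun u => grad_y f u y) x;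
  ba_f_yy : forall (x : 'rV[R]_dx) (y : 'rV[R]_dy),
    differentiable (grad_y f x) y;
  ba_f_xy_lip : forall (x x' : 'rV[R]_dx) (y y' : 'rV[R]_dy),
    opnorm_le (hess_xy f x y - hess_xy f x' y')
      (rhof * enorm (row_mx x y - row_mx x' y'));
  ba_f_yy_lip : forall (x x' : 'rV[R]_dx) (y y' : 'rV[R]_dy),
    opnorm_le (hess_yy f x y - hess_yy f x' y')
      (rhof * enorm (row_mx x y - row_mx x' y'));
  ba_g_twice : forall p, differentiable (grad g) p;
  ba_g_hess_lip : forall p q,
    opnorm_le (hessian g p - hessian g q) (rhog * enorm (p - q))
}.

Definition Ystar (R : realType) (dx dy : nat) (g : 'rV[R]_(dx + dy) -> R)
    (x : 'rV[R]_dx) : set 'rV[R]_dy :=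
  argmin (fun y => g (row_mx x y)).

(* The minimum over Ystar g x, written as an infimum so as to be total. *)
Definition phi (R : realType) (dx dy : nat) (f g : 'rV[R]_(dx + dy) -> R)
    (x : 'rV[R]_dx) : R :=
  inf [set f (row_mx x y) | y in Ystar g x].

(* F(.; s) with s of law D is an unbiased oracle for h and its gradient, with
   gradient variance at most M^2. *)
Record stochastic_oracle (R : realType) (n : nat) (d : measure_display)
    (S : measurableType d) (D : probability S R) (M : R)
    (h : 'rV[R]_n -> R) (F : 'rV[R]_n -> S -> R) : Prop := {
  so_integrable : forall p, D.-integrable setT (EFin \o F p);
  so_mean : forall p, ('E_D[F p] = (h p)%:E)%E;
  so_differentiable : forall s p, differentiable (F^~ s) p;
  so_grad_integrable : forall p i,
    D.-integrable setT (EFin \o (fun s => grad (F^~ s) p 0 i));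
  so_grad_mean : forall p i,
    ('E_D[fun s => (grad (F^~ s) p 0 i)%R] = (grad h p 0 i)%:E)%E;
  so_grad_var : forall p,
    ('E_D[fun s => (enorm (grad (F^~ s) p - grad h p) ^+ 2)%R] <= (M ^+ 2)%:E)%E
}.

(* The random elements xi_i (law DX) and zeta_j (law DZ) are all mutually
   independent: product rule over every finite subfamily. *)
Record fresh_samples (R : realType) (I J : choiceType)
    (dO dX dZ : measure_display) (Om : measurableType dO)
    (X : measurableType dX) (Z : measurableType dZ)
    (P : probability Om R) (DX : probability X R) (DZ : probability Z R)
    (xi : I -> Om -> X) (zeta : J -> Om -> Z) : Prop := {
  fs_xi_meas : forall i, measurable_fun setT (xi i);
  fs_zeta_meas : forall j, measurable_fun setT (zeta j);
  fs_xi_law : forall i (A : set X), measurable A -> P (xi i @^-1` A) = DX A;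
  fs_zeta_law : forall j (A : set Z), measurable A -> P (zeta j @^-1` A) = DZ A;
  fs_indep : forall (s : seq I) (u : seq J) (A : I -> set X) (C : J -> set Z),
    uniq s -> uniq u ->
    (forall i, measurable (A i)) -> (forall j, measurable (C j)) ->
    fine (P ((\bigcap_(i in [set` s]) (xi i @^-1` A i)) `&`
             (\bigcap_(j in [set` u]) (zeta j @^-1` C j)))) =
    (\prod_(i <- s) fine (P (xi i @^-1` A i))) *
    (\prod_(j <- u) fine (P (zeta j @^-1` C j)))
}.

(* Labels of the samples used by the algorithm.  (t, Some k, i) is the i-th
   sample of the batch used at inner step k of outer step t, (t, None, i) that of
   the batch used for the hypergradient estimate of outer step t.  In [gidx] the
   boolean separates the batches at the y-iterates (true) from those at the
   z-iterates (false), so that every evaluation uses its own samples. *)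
Definition fidx : choiceType := (nat * option nat * nat)%type.
Definition gidx : choiceType := (bool * nat * option nat * nat)%type.

Definition minibatch (R : realType) (n : nat) (S : Type) (F : 'rV[R]_n -> S -> R)
    (B : nat) (s : nat -> S) (p : 'rV[R]_n) : 'rV[R]_n :=
  B%:R^-1 *: \sum_(i < B) grad (F^~ (s i)) p.

Section Algorithm.
Context (R : realType) (dx dy : nat) (X Z : Type).
Context (F : 'rV[R]_(dx + dy) -> X -> R) (G : 'rV[R]_(dx + dy) -> Z -> R).
(* [K delta] is the number of inner steps; [next delta r] is the new value of
   delta when the last outer step has length r. *)
Context (eta tau sigma : R) (B : nat) (K : R -> nat) (next : R -> R -> R).
Context (xi : fidx -> X) (zeta : gidx -> Z).

Fixpoint z_inner (t : nat) (x : 'rV[R]_dx) (z : 'rV[R]_dy) (k : nat) : 'rV[R]_dy :=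
  if k is k'.+1 then
    let u := z_inner t x z k' in
    u - tau *: rsubmx
      (minibatch G B (fun i => zeta (false, t, Some k', i)) (row_mx x u))
  else z.

Fixpoint y_inner (t : nat) (x : 'rV[R]_dx) (y : 'rV[R]_dy) (k : nat) : 'rV[R]_dy :=
  if k is k'.+1 then
    let u := y_inner t x y k' in
    u - tau *:
      (sigma *: rsubmx
         (minibatch F B (fun i => xi (t, Some k', i)) (row_mx x u)) +
       rsubmx
         (minibatch G B (fun i => zeta (true, t, Some k', i)) (row_mx x u)))
  else y.

Definition hypergrad (t : nat) (x : 'rV[R]_dx) (y z : 'rV[R]_dy) : 'rV[R]_dx :=
  lsubmx (minibatch F B (fun i => xi (t, None, i)) (row_mx x y)) +
  sigma^-1 *:
    (lsubmx (minibatch G B (fun i => zeta (true, t, None, i)) (row_mx x y)) -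
     lsubmx (minibatch G B (fun i => zeta (false, t, None, i)) (row_mx x z))).

Record state := State {
  st_x : 'rV[R]_dx; st_y : 'rV[R]_dy; st_z : 'rV[R]_dy; st_delta : R
}.

Definition F2BSA_step (t : nat) (s : state) : state :=
  let k := K (st_delta s) in
  let y := y_inner t (st_x s) (st_y s) k in
  let z := z_inner t (st_x s) (st_z s) k in
  let x := st_x s - eta *: hypergrad t (st_x s) y z in
  State x y z (next (st_delta s) (enorm (x - st_x s))).

Fixpoint F2BSA (x0 : 'rV[R]_dx) (y0 : 'rV[R]_dy) (delta0 : R) (t : nat) : state :=
  if t is t'.+1 then F2BSA_step t' (F2BSA x0 y0 delta0 t')
  else State x0 y0 y0 delta0.

(* An inner step evaluates one batch of F and two batches of G; so does the
   hypergradient estimate. *)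
Definition F2BSA_calls (x0 : 'rV[R]_dx) (y0 : 'rV[R]_dy) (delta0 : R) (T : nat) :
    nat :=
  (\sum_(t < T) (3 * B * (K (st_delta (F2BSA x0 y0 delta0 t))).+1))%N.

End Algorithm.

(* Least natural number >= r. *)
Definition ceiln (R : realType) (r : R) : nat := `|Num.ceil (Num.max (0 : R) r)%R|%N.

(* Main.v *)
(* For small sigma the penalty problem min_y (sigma f + g)(x, y) / sigma approximates phi.
   The PL inequality gives quadratic growth and an error bound for every sigma f + g,
   so the solution sets move Lipschitz-continuously in x and in sigma, and the linearised
   optimality conditions are solvable although the Hessian of g in y may be singular.
   This yields, for y* in Y*(x) and p with p . Hess_yy g(x, y* ) = - grad_y f(x, y* ), a formula for
   grad phi(x), a quadratic expansion of phi with constant O(ell kappa^3), and an O(ell kappa^3 sigma)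
   bias for the penalty hypergradient.

   Along the algorithm, let gap_t be the optimality gap of the warm start of the inner loop at step t.
   The key invariant is E[gap_t / (L delta_t)] <= 3: the inner loop contracts gap_t by a factor of order
   N / (L delta_t), where N = mu sigma^2 eps^2 / Lg^2, because K_t is chosen from delta_t; so the expected
   gap after the inner loop is O(N) although delta_t is random, and the recursion for delta_t dominates
   the growth of the gap when x moves.  Hence the hypergradient estimate has mean square error at most
   eps^2 / 2, descent for phi gives stationarity, and the same descent bounds the expected sum of squared
   steps, so that E[delta_t] is bounded and the expected number of inner steps is logarithmic. *)
From HB Require Import structures.
Require Import Defs.
From mathcomp Require Import all_boot all_order all_algebra.
From mathcomp Require Import all_classical all_reals all_analysis.
From mathcomp Require Import measurable_realfun.
From mathcomp Require Import ring lra.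
Import Order.TTheory GRing.Theory Num.Theory.
Import numFieldNormedType.Exports.

Set Implicit Arguments.
Unset Strict Implicit.
Unset Printing Implicit Defensive.

Local Open Scope classical_set_scope.
Local Open Scope ring_scope.

(** * Euclidean norm *)

(** The lower problem is PL, not strongly convex: minimizers y and adjoints p are not unique, so
    there is no solution map to differentiate and no inverse Hessian. The linear equations are
    solved by compactness, from bounded difference quotients that satisfy them up to O(s), and p
    enters the result only through products that do not see the kernel of [Hyy]. On the random side
    the noise is bounded only in mean square, so the gap cannot be kept below 3 L delta surely, and
    a bound on E[gap] alone does not combine with a contraction factor that depends on the random
    delta. Dividing by delta path by path separates the two. Conditional expectations are replaced
    by nonnegative weights: the inner count is known before its loop starts, so the loop is analysed
    on each event that the count equals j, weighted by its indicator. A sample is fresh relative to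
    all other samples instead of along a filtration. Expectations are taken of nonnegative functions
    in the extended reals, so that finiteness comes out of the bounds. *)

Definition dot (R : realType) (n : nat) (u v : 'rV[R]_n) : R :=
  \sum_(i < n) u 0 i * v 0 i.

Section Dot.
Context (R : realType) (n : nat).
Implicit Types (u v w : 'rV[R]_n) (a : R).

Lemma dotC u v : dot u v = dot v u.
Proof. by apply: eq_bigr => i _; rewrite mulrC. Qed.

Lemma dotDl u v w : dot (u + v) w = dot u w + dot v w.
Proof. by rewrite -big_split; apply: eq_bigr => i _; rewrite mxE mulrDl. Qed.

Lemma dotZl a u w : dot (a *: u) w = a * dot u w.
Proof. by rewrite mulr_sumr; apply: eq_bigr => i _; rewrite mxE mulrA. Qed.

Lemma dotDr u v w : dot w (u + v) = dot w u + dot w v.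
Proof. by rewrite dotC dotDl !(dotC w). Qed.

Lemma dotZr a u w : dot w (a *: u) = a * dot w u.
Proof. by rewrite dotC dotZl (dotC w). Qed.

Lemma dotNl u w : dot (- u) w = - dot u w.
Proof. by rewrite -scaleN1r dotZl mulN1r. Qed.

Lemma dotNr u w : dot w (- u) = - dot w u.
Proof. by rewrite dotC dotNl dotC. Qed.

Lemma dotBl u v w : dot (u - v) w = dot u w - dot v w.
Proof. by rewrite dotDl dotNl. Qed.

Lemma dot0l w : dot 0 w = 0.
Proof. by rewrite -(scale0r 0) dotZl mul0r. Qed.

Lemma dot0r w : dot w 0 = 0.
Proof. by rewrite dotC dot0l. Qed.

Definition dotE := (dotDl, dotDr, dotNl, dotNr, dotZl, dotZr, dot0l, dot0r).

Lemma dot_sqr u : dot u u = enorm u ^+ 2.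
Proof.
rewrite sqr_sqrtr; first by apply: eq_bigr => i _; rewrite expr2.
by apply: sumr_ge0 => i _; exact: sqr_ge0.
Qed.

Lemma enorm_ge0 u : 0 <= enorm u.
Proof. exact: sqrtr_ge0. Qed.

Lemma enorm_sqrD u v : enorm (u + v) ^+ 2 = enorm u ^+ 2 + 2 * dot u v + enorm v ^+ 2.
Proof. by rewrite -!dot_sqr !dotE (dotC v u); ring. Qed.

Lemma enorm_sqrB u v : enorm (u - v) ^+ 2 = enorm u ^+ 2 - 2 * dot u v + enorm v ^+ 2.
Proof. by rewrite -!dot_sqr !dotE (dotC v u); ring. Qed.

Lemma enormZ a u : enorm (a *: u) = `|a| * enorm u.
Proof.
apply/eqP; rewrite -(@eqrXn2 _ 2) ?mulr_ge0 ?enorm_ge0 //.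
by rewrite exprMn real_normK ?num_real// -!dot_sqr !dotE; apply/eqP; ring.
Qed.

Lemma enorm0 : enorm (0 : 'rV[R]_n) = 0.
Proof. by rewrite -(scale0r 0) enormZ normr0 mul0r. Qed.

Lemma enormN u : enorm (- u) = enorm u.
Proof. by rewrite -scaleN1r enormZ normrN1 mul1r. Qed.

Lemma enormBC u v : enorm (u - v) = enorm (v - u).
Proof. by rewrite -enormN opprB. Qed.

Lemma enorm_coord u i : `|u 0 i| <= enorm u.
Proof.
rewrite -ler_sqr ?nnegrE ?enorm_ge0// -dot_sqr.
rewrite /dot (bigD1 i)//= real_normK ?num_real// expr2 lerDl.
by apply: sumr_ge0 => k _; rewrite -expr2 sqr_ge0.
Qed.

Lemma normr_le_enorm u : `|u| <= enorm u.
Proof.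
rewrite [leLHS]mx_normrE bigmax_le ?enorm_ge0// => -[i j] _ /=.
by rewrite (ord1 i) enorm_coord.
Qed.

Lemma enorm_eq0 u : enorm u = 0 -> u = 0.
Proof.
move=> u0; apply/eqP; rewrite -normr_eq0 eq_le normr_ge0 andbT.
by rewrite (le_trans (normr_le_enorm u)) ?u0.
Qed.

Lemma cauchy_schwarz u v : `|dot u v| <= enorm u * enorm v.
Proof.
have [v0|v0] := eqVneq (enorm v) 0.
  by rewrite v0 (enorm_eq0 v0) dot0r normr0 mulr0.
have v20 : 0 < enorm v ^+ 2 by rewrite exprn_gt0// lt_neqAle eq_sym v0 enorm_ge0.
rewrite -ler_sqr ?nnegrE ?mulr_ge0 ?enorm_ge0//.
rewrite exprMn real_normK ?num_real// -subr_ge0 -(pmulr_rge0 _ v20).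
have := sqr_ge0 (enorm (enorm v ^+ 2 *: u - dot u v *: v)).
by rewrite enorm_sqrB !enormZ !dotE !exprMn !real_normK ?num_real//; nra.
Qed.

Lemma dot_le u v : dot u v <= enorm u * enorm v.
Proof. exact: le_trans (ler_norm _) (cauchy_schwarz u v). Qed.

Lemma enormD u v : enorm (u + v) <= enorm u + enorm v.
Proof.
rewrite -ler_sqr ?nnegrE ?addr_ge0 ?enorm_ge0//.
by rewrite enorm_sqrD sqrrD -mulr_natl; have := dot_le u v; nra.
Qed.

Lemma enormB u v : enorm (u - v) <= enorm u + enorm v.
Proof. by rewrite -(enormN v) enormD. Qed.

Lemma enorm_tri w u v : enorm (u - v) <= enorm (u - w) + enorm (w - v).
Proof. by apply: le_trans (enormD _ _); rewrite addrA subrK. Qed.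

(* Bounding a vector through its inner products avoids differentiating norms. *)
Lemma enorm_le_dot u c : 0 <= c -> (forall w, dot u w <= c * enorm w) -> enorm u <= c.
Proof.
move=> c0 /(_ u); rewrite dot_sqr expr2.
have [->//|u0] := eqVneq (enorm u) 0.
by rewrite ler_pM2r// lt_neqAle eq_sym u0 enorm_ge0.
Qed.

Lemma dot_delta u i : dot u (delta_mx 0 i) = u 0 i.
Proof.
rewrite /dot (bigD1 i)//= mxE !eqxx mulr1 big1 ?addr0// => j /negbTE ji.
by rewrite mxE ji andbF mulr0.
Qed.

Lemma enorm_le_normr u : enorm u <= n%:R * `|u|.
Proof.
rewrite -ler_sqr ?nnegrE ?mulr_ge0 ?enorm_ge0// -dot_sqr exprMn.
have h i : `|u 0 i| <= `|u| by rewrite [leRHS]mx_normrE (le_bigmax _ _ (ord0, i)).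
apply: (@le_trans _ _ (\sum_(i < n) `|u| ^+ 2)).
  by apply: ler_sum => i _; rewrite -expr2 -real_normK ?num_real// ler_sqr ?nnegrE.
rewrite sumr_const card_ord -[leLHS]mulr_natl ler_wpM2r ?sqr_ge0//.
by rewrite -natrX ler_nat; case: (n) => // m; rewrite leq_pmulr.
Qed.

Lemma enorm_sum2 u v : enorm (u + v) ^+ 2 <= 2 * enorm u ^+ 2 + 2 * enorm v ^+ 2.
Proof. by rewrite enorm_sqrD; have := sqr_ge0 (enorm (u - v)); rewrite enorm_sqrB; lra. Qed.

End Dot.

Section Blocks.
Context (R : realType) (m n : nat).

Lemma dot_row_mx (x x' : 'rV[R]_m) (y y' : 'rV[R]_n) :
  dot (row_mx x y) (row_mx x' y') = dot x x' + dot y y'.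
Proof.
rewrite /dot big_split_ord; congr (_ + _); apply: eq_bigr => i _.
  by rewrite !row_mxEl.
by rewrite !row_mxEr.
Qed.

Lemma enorm_row_mx (x : 'rV[R]_m) (y : 'rV[R]_n) :
  enorm (row_mx x y) ^+ 2 = enorm x ^+ 2 + enorm y ^+ 2.
Proof. by rewrite -!dot_sqr dot_row_mx. Qed.

Lemma enorm_row_mx0 (x : 'rV[R]_m) : enorm (row_mx x (0 : 'rV[R]_n)) = enorm x.
Proof.
apply/eqP; rewrite -(@eqrXn2 _ 2) ?enorm_ge0//.
by rewrite enorm_row_mx enorm0 expr0n addr0.
Qed.

Lemma enorm_row_0mx (y : 'rV[R]_n) : enorm (row_mx (0 : 'rV[R]_m) y) = enorm y.
Proof.
apply/eqP; rewrite -(@eqrXn2 _ 2) ?enorm_ge0//.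
by rewrite enorm_row_mx enorm0 expr0n add0r.
Qed.

Lemma enorm_lsubmx (p : 'rV[R]_(m + n)) : enorm (lsubmx p) <= enorm p.
Proof.
rewrite -ler_sqr ?nnegrE ?enorm_ge0// -[in leRHS](hsubmxK p).
by rewrite enorm_row_mx lerDl sqr_ge0.
Qed.

Lemma enorm_rsubmx (p : 'rV[R]_(m + n)) : enorm (rsubmx p) <= enorm p.
Proof.
rewrite -ler_sqr ?nnegrE ?enorm_ge0// -[in leRHS](hsubmxK p).
by rewrite enorm_row_mx lerDr sqr_ge0.
Qed.

Lemma sub_row_mx (x x' : 'rV[R]_m) (y y' : 'rV[R]_n) :
  row_mx x y - row_mx x' y' = row_mx (x - x') (y - y').
Proof. by rewrite opp_row_mx add_row_mx. Qed.

End Blocks.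

(** * Taylor expansions *)

Section Lines.
Context (R : realType).

Lemma is_derive_line (V W : normedModType R) (h : V -> W) (p v : V) (t : R) :
  derivable h (p + t *: v) v ->
  is_derive t 1 (fun s : R => h (p + s *: v)) ('D_v h (p + t *: v)).
Proof.
have e : (fun k : R => k^-1 *: (((fun s : R => h (p + s *: v)) \o shift t) (k *: (1 : R))
            - h (p + t *: v))) =
    (fun k : R => k^-1 *: ((h \o shift (p + t *: v)) (k *: v) - h (p + t *: v))).
  apply/funext => k /=; congr (_ *: (h _ - _)).
  have -> : k *: (1 : R) = k by rewrite /GRing.scale/= mulr1.
  by rewrite scalerDl addrCA.
by move=> d; split; rewrite /derivable /derive e.
Qed.

Lemma is_derive_sub_linear (f : R -> R) (df c s t : R) :
  is_derive t (1 : R) f df ->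
  is_derive t (1 : R) (fun t => s * (f t - c * t)) (s * (df - c)).
Proof.
move=> fP.
have := is_deriveZ s (is_deriveB fP (is_deriveZ c (is_derive_id t (1 : R)))).
by rewrite /GRing.scale /= mulr1.
Qed.

(** Subtracting c/2 t^2 leaves a nonincreasing function on [0, 1]. This yields the factor 1/2 of
    Taylor remainders without integrating the derivative. *)
Lemma le_quadratic_of_derive (psi dpsi : R -> R) (c : R) :
  (forall t : R, is_derive t (1 : R) psi (dpsi t)) ->
  (forall t, 0 <= t <= 1 -> dpsi t <= c * t) -> psi 1 - psi 0 <= c / 2.
Proof.
move=> dP le.
pose k t := psi t - (c / 2) * t ^+ 2.
have dk (t : R) : is_derive t (1 : R) k (dpsi t - c * t).
  have := is_deriveB (dP t) (is_deriveZ (c / 2) (is_deriveX 2 (is_derive_id t (1 : R)))).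
  rewrite (_ : psi - _ = k); last first.
    by apply/funext.
  move=> h; apply: is_derive_eq h _; rewrite /GRing.scale /= expr1; lra.
have /(_ 0 1) : forall x y, 0 <= x -> x <= y -> y <= 1 -> k y <= k x.
  apply: ler0_derive1_nincr => [x _|x|]; first by case: (dk x).
    rewrite in_itv /= => /andP[x0 x1]; rewrite derive1E; case: (dk x) => _ ->.
    by rewrite subr_le0 le// !ltW.
  apply: derivable_within_continuous => x _; by case: (dk x).
by rewrite /k => /(_ (lexx _) ler01 (lexx _)); lra.
Qed.

End Lines.

Section Taylor.
Context (R : realType) (n : nat).
Implicit Types (h : 'rV[R]_n -> R) (p q v w a b : 'rV[R]_n).

Lemma le_of_derive (psi dpsi : R -> R) (c : R) :
  (forall t : R, is_derive t (1 : R) psi (dpsi t)) ->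
  (forall t, 0 <= t <= 1 -> dpsi t <= c) -> psi 1 - psi 0 <= c.
Proof.
move=> dP le.
have [|t] := MVT (ltr01 : (0 : R) < 1) (fun t _ => dP t).
  by apply: derivable_within_continuous => x _; case: (dP x).
by rewrite in_itv/= => /andP[t0 t1] ->; rewrite subr0 mulr1 le// !ltW.
Qed.

Lemma derive_dot_grad h p v : differentiable h p -> 'D_v h p = dot (grad h p) v.
Proof.
move=> dh; rewrite deriveE// [in LHS](row_sum_delta v) linear_sum.
by apply: eq_bigr => i _; rewrite linearZ/= -deriveE// mxE mulrC.
Qed.

Lemma is_derive_line_dot h p v t : differentiable h (p + t *: v) ->
  is_derive t (1 : R) (fun s : R => h (p + s *: v)) (dot (grad h (p + t *: v)) v).
Proof.
move=> dh; rewrite -derive_dot_grad//.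
by apply: is_derive_line; exact: diff_derivable.
Qed.

Lemma smooth_taylor L h p v : lipschitz_gradient L h ->
  `|h (p + v) - h p - dot (grad h p) v| <= L / 2 * enorm v ^+ 2.
Proof.
move=> [dh Lh].
have bnd t : 0 <= t <= 1 ->
    `|dot (grad h (p + t *: v)) v - dot (grad h p) v| <= L * enorm v ^+ 2 * t.
  move=> /andP[t0 t1]; rewrite -dotBl (le_trans (cauchy_schwarz _ _))//.
  have := Lh (p + t *: v) p; rewrite (addrC p) addrK enormZ ger0_norm// => h1.
  by rewrite (le_trans (ler_wpM2r (enorm_ge0 v) h1))// expr2; lra.
have D (t : R) (s : R) : is_derive t (1 : R)
    (fun t => s * (h (p + t *: v) - dot (grad h p) v * t))
    (s * (dot (grad h (p + t *: v)) v - dot (grad h p) v)).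
  by apply: is_derive_sub_linear; exact: is_derive_line_dot.
(* The one-sided estimate carries a multiplier s; s = 1 and s = -1 then give the two sides of the
   absolute value. *)
have key s : `|s| <= 1 -> s * (h (p + v) - h p - dot (grad h p) v) <= L / 2 * enorm v ^+ 2.
  move=> s1; have := le_quadratic_of_derive (fun t => D t s) (c := L * enorm v ^+ 2).
  rewrite !mulr1 mulr0 subr0 scale0r addr0 scale1r.
  set A := h (p + v); set B := h p; set C := dot _ _ => H.
  suff : s * (A - C) - s * B <= L * enorm v ^+ 2 / 2 by lra.
  apply: H => t /[dup] t01 /bnd => h1.
  apply: le_trans h1; rewrite (le_trans (ler_norm _))// normrM.
  by rewrite ler_piMl.
rewrite ler_norml; apply/andP; split.
  by have := key (-1); rewrite normrN1 lexx => /(_ isT); lra.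
by have := key 1; rewrite normr1 lexx => /(_ isT); lra.
Qed.

Lemma is_derive_line_vec m (g : 'rV[R]_n -> 'rV[R]_m) p v (w : 'rV[R]_m) t :
  differentiable g (p + t *: v) ->
  is_derive t (1 : R) (fun s : R => dot (g (p + s *: v)) w)
    (dot (v *m 'J g (p + t *: v)) w).
Proof.
move=> dg.
have e : (fun s : R => dot (g (p + s *: v)) w) =
    \sum_(i < m) (w 0 i \*: (fun s : R => g (p + s *: v) 0 i)).
  apply/funext => s; rewrite fct_sumE; apply: eq_bigr => i _.
  by rewrite /GRing.scale /= mulrC.
rewrite e (_ : dot _ _ = \sum_(i < m) w 0 i *: (v *m 'J g (p + t *: v)) 0 i); last first.
  by apply: eq_bigr => i _; rewrite /GRing.scale /= mulrC.
apply: is_derive_sum => i; apply: is_deriveZ.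
have dg' : derivable g (p + t *: v) v by exact: diff_derivable.
have := (derivable_mxP g _ _).1 dg' 0 i => /is_derive_line.
by rewrite -deriveEjacobian// derive_mx// mxE.
Qed.

Lemma hessian_taylor rho h p v : 0 <= rho ->
  (forall q, differentiable (grad h) q) ->
  (forall q q', opnorm_le (hessian h q - hessian h q') (rho * enorm (q - q'))) ->
  enorm (grad h (p + v) - grad h p - v *m hessian h p) <= rho / 2 * enorm v ^+ 2.
Proof.
move=> rho0 dh Lh; apply: enorm_le_dot => [|w].
  by rewrite mulr_ge0 ?divr_ge0 ?sqr_ge0.
have D (t : R) : is_derive t (1 : R)
    (fun s => 1 * (dot (grad h (p + s *: v)) w - dot (v *m hessian h p) w * s))
    (1 * (dot (v *m hessian h (p + t *: v)) w - dot (v *m hessian h p) w)).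
  by apply: is_derive_sub_linear; exact: is_derive_line_vec.
have := le_quadratic_of_derive D (c := rho * enorm v ^+ 2 * enorm w).
rewrite !mulr1 !mul1r mulr0 subr0 scale0r addr0 scale1r.
rewrite !dotBl => H.
suff : dot (grad h (p + v)) w - dot (v *m hessian h p) w - dot (grad h p) w <=
  rho * enorm v ^+ 2 * enorm w / 2 by lra.
apply: H => t /andP[t0 t1]; rewrite mul1r -dotBl -mulmxBr.
apply: le_trans (dot_le _ _) _; rewrite mulrAC ler_wpM2r ?enorm_ge0//.
apply: le_trans (Lh _ _ _) _.
by rewrite (addrC p) addrK enormZ ger0_norm// expr2; lra.
Qed.

(* Both sides are the limit of the second difference of h along a and b. *)
Lemma hessian_sym rho h p a b : 0 <= rho -> (forall q, differentiable h q) ->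
  (forall q, differentiable (grad h) q) ->
  (forall q q', opnorm_le (hessian h q - hessian h q') (rho * enorm (q - q'))) ->
  dot (a *m hessian h p) b = dot (b *m hessian h p) a.
Proof.
move=> rho0 dh ddh Lh.
pose S a b := h (p + a + b) - h (p + a) - h (p + b) + h p.
have SC a' b' : S a' b' = S b' a' by rewrite /S -!addrA (addrC a'); ring.
(* The second difference S approximates the Hessian form with a cubic error. S is symmetric in its
   arguments, so the same estimate applies with a and b exchanged. *)
have half a' b' : `|S a' b' - dot (b' *m hessian h p) a'| <=
    rho * (enorm a' + enorm b') ^+ 3.
  pose K := rho * (enorm a' + enorm b') ^+ 2.
  have bnd t : 0 <= t <= 1 -> `|dot (grad h (p + b' + t *: a') - grad h (p + t *: a')
      - b' *m hessian h p) a'| <= K * enorm a'.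
    move=> /andP[t0 t1]; apply: le_trans (cauchy_schwarz _ _) _.
    rewrite ler_wpM2r ?enorm_ge0//.
    (* Both gradients are expanded at p: the contributions of t a' cancel, which leaves b' times the
       Hessian and two Taylor remainders. *)
    have := hessian_taylor p (t *: a') rho0 ddh Lh.
    have := hessian_taylor p (b' + t *: a') rho0 ddh Lh.
    rewrite addrA mulmxDl enormZ ger0_norm// => h1 h2.
    move: h1 h2; set A := grad h _; set B := grad h p; set C := grad h _.
    set D := _ *m _; set E := _ *m _ => h1 h2.
    have -> : A - C - D = (A - B - (D + E)) - (C - B - E).
      by apply/rowP => i; rewrite !mxE; lra.
    apply: le_trans (enormB _ _) _; apply: le_trans (lerD h1 h2) _.
    have : enorm (b' + t *: a') <= enorm a' + enorm b'.
      rewrite (le_trans (enormD _ _))// enormZ ger0_norm// addrC lerD2r.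
      by rewrite ler_piMl ?enorm_ge0.
    have : t * enorm a' <= enorm a' + enorm b'.
      by rewrite (le_trans (ler_piMl _ t1)) ?enorm_ge0// lerDl enorm_ge0.
    rewrite /K -![_ <= enorm a' + _](@ler_sqr R) ?nnegrE ?addr_ge0 ?mulr_ge0 ?enorm_ge0//.
    move=> h3 h4; have := ler_wpM2l rho0 h3; have := ler_wpM2l rho0 h4; lra.
  have D (t s : R) : is_derive t (1 : R)
      (fun t => s * (h (p + b' + t *: a') - h (p + t *: a') -
         dot (b' *m hessian h p) a' * t))
      (s * (dot (grad h (p + b' + t *: a')) a' - dot (grad h (p + t *: a')) a'
         - dot (b' *m hessian h p) a')).
    apply: is_derive_sub_linear.
    by apply: is_deriveB; exact: is_derive_line_dot.
  have key s : `|s| <= 1 -> s * (S a' b' - dot (b' *m hessian h p) a') <= K * enorm a'.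
    move=> s1; have := le_of_derive (fun t => D t s) (c := K * enorm a').
    rewrite !mulr1 mulr0 subr0 scale0r !addr0 scale1r.
    rewrite /S (addrAC p a'); set Q := dot _ _; set A := h _; set B := h _.
    set C := h _; set E := h _ => H.
    suff : s * (A - B - Q) - s * (C - E) <= K * enorm a' by lra.
    apply: H => t /[dup] t01 /bnd; rewrite !dotBl -/Q => h1.
    apply: le_trans h1; rewrite (le_trans (ler_norm _))// normrM.
    by rewrite ler_piMl.
  have le3 : K * enorm a' <= rho * (enorm a' + enorm b') ^+ 3.
    rewrite /K (exprSr _ 2) [leRHS]mulrA ler_wpM2l ?mulr_ge0 ?exprn_ge0 ?addr_ge0 ?enorm_ge0//.
    by rewrite lerDl enorm_ge0.
  apply: le_trans le3; rewrite ler_norml; apply/andP; split.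
    by have := key (-1); rewrite normrN1 lexx => /(_ isT); lra.
  by have := key 1; rewrite normr1 lexx => /(_ isT); lra.
set x := dot (a *m _) b; set y := dot (b *m _) a.
pose M := 2 * rho * (enorm a + enorm b) ^+ 3.
have M0 : 0 <= M by rewrite !mulr_ge0 ?exprn_ge0 ?addr_ge0 ?enorm_ge0.
(* Scaling a and b by s scales the forms by s^2 and the error by s^3, so after division the error
   vanishes with s. *)
have sc s : 0 < s -> `|x - y| <= s * M.
  move=> s0; have := half (s *: a) (s *: b); have := half (s *: b) (s *: a).
  rewrite SC -!scalemxAl !dotE -/x -/y !enormZ (gtr0_norm s0) -!mulrDr !exprMn.
  rewrite (addrC (enorm b)) => h1 h2.
  have s2 : 0 < s * s by rewrite mulr_gt0.
  rewrite -(ler_pM2l s2) -[X in X * `|_|](gtr0_norm s2) -normrM.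
  have -> : s * s * (x - y) = (S (s *: a) (s *: b) - s * (s * y)) -
      (S (s *: a) (s *: b) - s * (s * x)) by ring.
  apply: le_trans (ler_normB _ _) _; apply: le_trans (lerD h2 h1) _.
  by rewrite /M; lra.
apply/eqP; rewrite -subr_eq0 -normr_le0; apply/ler_addgt0Pr => e e0; rewrite add0r.
have M1 : 0 < M + 1 by rewrite ltr_wpDl.
apply: le_trans (sc (e / (M + 1)) _) _; first by rewrite divr_gt0.
by rewrite mulrAC ler_pdivrMr// ler_wpM2l ?(ltW e0)// lerDl.
Qed.

End Taylor.

(** * Continuity from expansions, compact Euclidean balls, solvability of linear systems *)

Section Continuity.
Context (R : realType) (n : nat).

(** The topology comes from the sup norm while the modulus is Euclidean; the conversion costs a
    power of n, absorbed in C. The coefficients A and B may depend on the point. *)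
Lemma continuous_of_modulus (h : 'rV[R]_n -> R) :
  (forall p, exists A B : R, forall v, `|h (p + v) - h p| <= A * enorm v + B * enorm v ^+ 2) ->
  continuous h.
Proof.
move=> H p; have [A [B hAB]] := H p.
apply/(@cvgrPdist_le R R^o _ (nbhs p) (nbhs_filter p) h (h p)) => e e0.
pose C := (`|A| + `|B|) * n%:R ^+ 2 + 1.
have C0 : 0 < C by rewrite ltr_wpDl// mulr_ge0 ?addr_ge0 ?exprn_ge0.
apply: (iffRL (@nbhs_normP R 'rV[R]_n p _)); exists (Num.min 1 (e / C)).
  by rewrite /= lt_min ltr01 divr_gt0.
move=> q /= /ltW; rewrite distrC le_min ler_pdivlMr// => /andP[pq1 pqe].
rewrite distrC (_ : h q = h (p + (q - p))); last by rewrite addrC subrK.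
apply: le_trans (hAB _) _.
set d := q - p in pq1 pqe *.
apply: le_trans pqe.
have h1 : enorm d <= n%:R * `|d| := enorm_le_normr d.
have h2 : enorm d ^+ 2 <= (n%:R * `|d|) ^+ 2.
  by rewrite ler_sqr ?nnegrE ?mulr_ge0 ?enorm_ge0.
have n1 : n%:R <= n%:R ^+ 2 :> R by rewrite -natrX ler_nat; case: (n) => // m; rewrite leq_pmulr.
have h3 : A * enorm d <= `|A| * (n%:R ^+ 2 * `|d|).
  apply: le_trans (ler_wpM2r (enorm_ge0 d) (ler_norm A)) _.
  by rewrite ler_wpM2l// (le_trans h1)// ler_wpM2r.
have h4 : B * enorm d ^+ 2 <= `|B| * (n%:R ^+ 2 * `|d|).
  apply: le_trans (ler_wpM2r (sqr_ge0 (enorm d)) (ler_norm B)) _.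
  rewrite ler_wpM2l// (le_trans h2)// exprMn ler_wpM2l ?sqr_ge0//.
  by rewrite expr2 ler_piMl.
by apply: le_trans (lerD h3 h4) _; rewrite /C; have := normr_ge0 d; lra.
Qed.

Lemma continuous_of_expansion (h : 'rV[R]_n -> R) :
  (forall p, exists (D : 'rV[R]_n) (C : R), forall v,
     `|h (p + v) - h p - dot D v| <= C * enorm v ^+ 2) -> continuous h.
Proof.
move=> H; apply: continuous_of_modulus => p; have [D [C hC]] := H p.
exists (enorm D), C => v; have := hC v; have := cauchy_schwarz D v.
by rewrite !ler_norml => /andP[? ?] /andP[? ?]; apply/andP; split; lra.
Qed.

Lemma enormB_continuous (c : 'rV[R]_n) : continuous (fun p : 'rV[R]_n => enorm (p - c)).
Proof.
apply: continuous_of_modulus => p; exists 1, 0 => v; rewrite mul1r mul0r addr0 addrAC.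
rewrite ler_norml; apply/andP; split; last by rewrite lerBlDl enormD.
by rewrite lerBrDl -{1}(addrK v (p - c)) lerBlDr enormB.
Qed.

Lemma compact_eball (c : 'rV[R]_n) (r : R) : compact [set v | enorm (v - c) <= r].
Proof.
apply: bounded_closed_compact.
  exists (`|c| + r); split; first exact: num_real.
  move=> M ltM v /= vr; apply: le_trans (ltW ltM).
  rewrite -(subrK c v) (le_trans (ler_normD _ _))// addrC lerD2l.
  exact: le_trans (normr_le_enorm _) vr.
apply: (@closed_comp _ _ (fun v : 'rV[R]_n => enorm (v - c)) [set x | x <= r]); last exact: (@closed_le R r).
by move=> v _; exact: enormB_continuous.
Qed.

End Continuity.

(** The residual attains its minimum on the compact ball of radius c, and this minimum is below
    every e > 0. Bounded approximate solutions thus give an exact one with the same bound, also for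
    singular A. *)
Lemma preimage_of_approx (R : realType) (m n : nat) (A : 'M[R]_(m, n)) (q : 'rV[R]_n) (c : R) :
  0 <= c -> (forall e, 0 < e -> exists2 p, enorm p <= c & enorm (q - p *m A) <= e) ->
  exists2 p, enorm p <= c & p *m A = q.
Proof.
move=> c0 approx.
have [||| p pc minp] := @EVT_min_rV R m (fun p => enorm (q - p *m A))
    [set v | enorm (v - 0) <= c].
- by exists 0; rewrite /= subr0 enorm0.
- exact: compact_eball.
- apply: continuous_subspaceT; apply: continuous_of_modulus => p.
  exists (\sum_i enorm (row i A)), 0 => v; rewrite mul0r addr0.
  apply: (@le_trans _ _ (enorm (v *m A))).
    rewrite ler_norml mulmxDl opprD addrA; apply/andP; split; last first.
      by rewrite lerBlDl enormB.
    by rewrite lerBrDl -{1}(subrK (v *m A) (q - p *m A)) lerBlDr enormD.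
  rewrite mulmx_sum_row mulr_suml.
  apply: (big_ind2 (fun x y => enorm x <= y)) => [|x c1 y c2 h1 h2|i _].
  - by rewrite enorm0.
  - exact: le_trans (enormD _ _) (lerD h1 h2).
  - by rewrite enormZ mulrC ler_wpM2l ?enorm_ge0// enorm_coord.
- exists p; first by move: pc; rewrite inE /= subr0.
  apply/eqP; rewrite eq_sym -subr_eq0; apply/eqP/enorm_eq0/eqP.
  rewrite eq_le enorm_ge0 andbT; apply/ler_addgt0Pr => e /approx[p' p'c p'e].
  by rewrite add0r; apply: le_trans p'e; apply: minp; rewrite inE /= subr0.
Qed.

(** * PL functions *)

Section PL.
Context (R : realType) (n : nat) (mu L : R) (h : 'rV[R]_n -> R) (D : 'rV[R]_n -> 'rV[R]_n).
Hypotheses (mu0 : 0 < mu) (L0 : 0 < L).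
Hypothesis smooth : forall y v, `|h (y + v) - h y - dot (D y) v| <= L / 2 * enorm v ^+ 2.

Lemma smooth_continuous : continuous h.
Proof.
by apply: continuous_of_expansion => p; exists (D p), (L / 2).
Qed.

(** With step length 1/L the cross terms between D y and e cancel exactly, so the bound holds for an
    arbitrary error e; the stochastic noise takes the place of e later. *)
Lemma inexact_step_le y e :
  h (y - L^-1 *: (D y + e)) <= h y - (enorm (D y) ^+ 2 - enorm e ^+ 2) / (2 * L).
Proof.
have := smooth y (- (L^-1 *: (D y + e))).
have Li : 0 < L^-1 by rewrite invr_gt0.
rewrite enormN enormZ (gtr0_norm Li) exprMn enorm_sqrD !dotE !dot_sqr.
rewrite ler_norml => /andP[_]; set a := enorm (D y) ^+ 2; set b := enorm e ^+ 2.
set c := dot _ _; set A := h _; set B := h y => H.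
have -> : (a - b) / (2 * L) = L^-1 * (a - b) / 2 by field; rewrite gt_eqF.
have E : L / 2 * (L^-1 ^+ 2 * (a + 2 * c + b)) = L^-1 * (a + 2 * c + b) / 2.
  by field; rewrite gt_eqF.
by move: H; rewrite E; lra.
Qed.

Lemma minimizer_grad0 y : argmin h y -> D y = 0.
Proof.
move=> miny; apply/enorm_eq0/eqP; rewrite -sqrf_eq0 eq_le sqr_ge0 andbT.
have := inexact_step_le y 0; have := miny (y - L^-1 *: (D y + 0)).
rewrite enorm0 expr0n subr0 => h1 h2.
have : enorm (D y) ^+ 2 / (2 * L) <= 0 by lra.
by rewrite pmulr_lle0// invr_gt0 mulr_gt0.
Qed.

Lemma gap_le_sqr y y' : argmin h y' -> h y - h y' <= L / 2 * enorm (y - y') ^+ 2.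
Proof.
move=> miny'; have := smooth y' (y - y').
by rewrite minimizer_grad0// dot0l subr0 (addrC y') subrK ler_norml => /andP[].
Qed.

Variable m : 'rV[R]_n.
Hypothesis min_m : argmin h m.
Hypothesis plD : forall y, 2 * mu * (h y - h m) <= enorm (D y) ^+ 2.

Lemma inexact_contraction y e :
  h (y - L^-1 *: (D y + e)) - h m <=
  (1 - mu / L) * (h y - h m) + enorm e ^+ 2 / (2 * L).
Proof.
apply: le_trans (lerB (inexact_step_le y e) (lexx _)) _.
have L20 : 0 < 2 * L by rewrite mulr_gt0.
have : 2 * mu * (h y - h m) / (2 * L) <= enorm (D y) ^+ 2 / (2 * L).
  by rewrite ler_pM2r ?invr_gt0.
have -> : 2 * mu * (h y - h m) / (2 * L) = mu / L * (h y - h m) by field; rewrite gt_eqF.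
by rewrite mulrBl (mulrBl _ 1) mul1r; lra.
Qed.

(** Exact gradient descent, an auxiliary path for quadratic growth and unrelated to the inner loop
    of the algorithm. *)
Fixpoint descent (y : 'rV[R]_n) (k : nat) : 'rV[R]_n :=
  if k is k'.+1 then descent y k' - L^-1 *: D (descent y k') else y.

Lemma descent_gap_le y k :
  h (descent y k.+1) - h m <=
  h (descent y k) - h m - enorm (D (descent y k)) ^+ 2 / (2 * L).
Proof.
have := inexact_step_le (descent y k) 0; rewrite addr0 enorm0 expr0n subr0 /=.
by set A := _ / _ => H; rewrite [leRHS]addrAC lerD2r.
Qed.

Let r := Num.sqrt (8 / mu).

(* The drop of the square root of the gap controls the length of a step, so the
   gradient descent path has finite length. *)
Lemma descent_length y k :
  enorm (descent y k.+1 - descent y k) <=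
  r * (Num.sqrt (h (descent y k) - h m) - Num.sqrt (h (descent y k.+1) - h m)).
Proof.
rewrite /= addrC addKr enormN enormZ gtr0_norm ?invr_gt0//.
set u := descent y k; set u' := u - _; set a := h u - h m; set a' := h u' - h m.
have gap : a' <= a - enorm (D u) ^+ 2 / (2 * L) := descent_gap_le y k.
have a'0 : 0 <= a' by rewrite subr_ge0 min_m.
have a0 : 0 <= a by rewrite subr_ge0 min_m.
have r0 : 0 <= r by exact: sqrtr_ge0.
have r2 : r ^+ 2 = 8 / mu by rewrite sqr_sqrtr// divr_ge0// ltW.
have D0 := enorm_ge0 (D u); set d := enorm (D u) in D0 gap *.
have s0 := sqrtr_ge0 a; have s0' := sqrtr_ge0 a'.
have sa : Num.sqrt a ^+ 2 = a by rewrite sqr_sqrtr.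
have sa' : Num.sqrt a' ^+ 2 = a' by rewrite sqr_sqrtr.
set s := Num.sqrt a in s0 sa *; set s' := Num.sqrt a' in s0' sa' *.
have dsL : d ^+ 2 <= 2 * L * (s ^+ 2 - s' ^+ 2).
  rewrite -ler_pdivrMl ?mulr_gt0//; move: gap; rewrite -sa -sa' mulrC; lra.
have ss' : s' <= s.
  rewrite -ler_sqr ?nnegrE//; have := le_trans (sqr_ge0 d) dsL.
  by rewrite pmulr_rge0 ?mulr_gt0// subr_ge0.
(* The PL inequality in square-root form. As s' <= s it bounds s + s' by r d / 2; factoring s^2 -
   s'^2 then lets one factor d cancel. This dictates r = sqrt(8/mu). *)
have sd : s <= r * d / 4.
  rewrite -ler_sqr ?nnegrE ?divr_ge0 ?mulr_ge0// !exprMn r2 sa.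
  have := plD u; rewrite -/a -/d => h1.
  have -> : 8 / mu * d ^+ 2 * 4^-1 ^+ 2 = d ^+ 2 / (2 * mu) by field; rewrite gt_eqF.
  by rewrite ler_pdivlMr ?mulr_gt0// mulrC.
have [d00|dn0] := eqVneq d 0.
  by rewrite d00 mulr0 mulr_ge0// subr_ge0.
have d_gt0 : 0 < d by rewrite lt_neqAle eq_sym dn0.
rewrite ler_pdivrMl// -(ler_pM2r d_gt0) -expr2 (le_trans dsL)//.
have : s ^+ 2 - s' ^+ 2 <= (s - s') * (r * d / 2).
  rewrite subr_sqr ler_wpM2l ?subr_ge0//; lra.
by move=> h1; have := ler_wpM2l (ltW L0) h1; lra.
Qed.

Lemma descent_path y k : enorm (descent y k - y) <= r * Num.sqrt (h y - h m).
Proof.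
have r0 : 0 <= r by exact: sqrtr_ge0.
suff : enorm (descent y k - y) <=
    r * (Num.sqrt (h y - h m) - Num.sqrt (h (descent y k) - h m)).
  by move/le_trans; apply; rewrite ler_wpM2l// gerBl sqrtr_ge0.
elim: k => [|k IH]; first by rewrite /= subrr enorm0 subrr mulr0.
apply: le_trans (enorm_tri (descent y k) _ _) _.
by apply: le_trans (lerD (descent_length y k) IH) _; lra.
Qed.

(** In place of the limit of the descent path, y' is a minimizer of h on the compact ball that
    contains the whole path. It lies below every iterate, and the gaps of the iterates cannot stay
    bounded away from zero. *)
Theorem PL_quadratic_growth y :
  exists2 y', argmin h y' & enorm (y - y') ^+ 2 <= 8 / mu * (h y - h y').
Proof.
have gap0 z : 0 <= h z - h m by rewrite subr_ge0 min_m.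
have r2 : r ^+ 2 = 8 / mu by rewrite sqr_sqrtr// divr_ge0// ltW.
have r0 : 0 <= r by exact: sqrtr_ge0.
have [|| |y'] := @EVT_min_rV R n h [set v | enorm (v - y) <= r * Num.sqrt (h y - h m)].
- by exists y; rewrite /= subrr enorm0 mulr_ge0// sqrtr_ge0.
- exact: compact_eball.
- exact/continuous_subspaceT/smooth_continuous.
rewrite inE /= => y'in miny'.
have hy' k : h y' <= h (descent y k) by apply: miny'; rewrite inE; exact: descent_path.
suff y'm : h y' <= h m.
  have hm : h y' = h m by apply/eqP; rewrite eq_le y'm min_m.
  exists y'; first by move=> z; rewrite hm; exact: min_m.
  rewrite enormBC hm -(sqr_sqrtr (gap0 y)) -r2 -exprMn.
  by rewrite ler_sqr ?nnegrE ?enorm_ge0// mulr_ge0// sqrtr_ge0.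
rewrite leNgt; apply/negP => ltm.
(* If h y' exceeded the minimum, PL would force a decrease of at least c at every step, and the gap
   would become negative. *)
pose c := mu / L * (h y' - h m).
have c0 : 0 < c by rewrite mulr_gt0 ?divr_gt0// subr_gt0.
have dec k : h (descent y k) - h m <= h y - h m - k%:R * c.
  elim: k => [|k IH]; first by rewrite mul0r subr0.
  have := inexact_contraction (descent y k) 0; rewrite addr0 enorm0 expr0n mul0r addr0 => h1.
  have : c <= mu / L * (h (descent y k) - h m).
    by rewrite ler_wpM2l ?(ltW (divr_gt0 mu0 L0))// lerB.
  by rewrite -natr1; lra.
have [N hN] : exists N : nat, (h y - h m) / c < N%:R.
  by exists (Num.truncn ((h y - h m) / c)).+1; rewrite truncnS_gt.
by have := dec N; rewrite leNgt => /negP; apply; rewrite ltr_pdivrMr// in hN;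
  apply: lt_le_trans (gap0 _); rewrite subr_lt0.
Qed.

Theorem PL_error_bound y :
  exists2 y', argmin h y' & enorm (y - y') <= 2 / mu * enorm (D y).
Proof.
have [y' miny' le] := PL_quadratic_growth y; exists y' => //.
have mu20 : 0 <= 2 / mu by rewrite divr_ge0// ltW.
rewrite -ler_sqr ?nnegrE ?enorm_ge0 ?(mulr_ge0 mu20 (enorm_ge0 _))//.
apply: (le_trans le); rewrite exprMn.
have -> : h y' = h m by apply/eqP; rewrite eq_le miny' min_m.
have := plD y => h1.
have -> : (2 / mu) ^+ 2 * enorm (D y) ^+ 2 = 4 / mu / mu * enorm (D y) ^+ 2 by field; rewrite gt_eqF.
have -> : 8 / mu * (h y - h m) = 4 / mu / mu * (2 * mu * (h y - h m)) by field; rewrite gt_eqF.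
by rewrite ler_wpM2l// !divr_ge0// ltW.
Qed.

End PL.

Lemma inf_range_argmin (R : realType) (n : nat) (h : 'rV[R]_n -> R) y :
  argmin h y -> inf (range h) = h y.
Proof.
move=> miny; apply/eqP; rewrite eq_le; apply/andP; split.
  apply: ge_inf; last by exists y.
  by exists (h y) => _ [z _ <-]; exact: miny.
by apply: lb_le_inf; [exists (h y), y | move=> _ [z _ <-]; exact: miny].
Qed.

(** * The penalty problem *)

Section Penalty.
Context (R : realType) (dx dy : nat).
Context (mu Cf Lf Lg rhof rhog sbar ell : R) (f g : 'rV[R]_(dx + dy) -> R).
Hypotheses (mu0 : 0 < mu) (Cf0 : 0 < Cf) (Lf0 : 0 < Lf) (Lg0 : 0 < Lg).
Hypotheses (rhog0 : 0 < rhog) (sbar0 : 0 < sbar).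
Hypothesis BA : bilevel_assumption mu Cf Lf Lg rhof rhog sbar f g.
Implicit Types (p q v : 'rV[R]_(dx + dy)) (x u : 'rV[R]_dx) (y z w : 'rV[R]_dy) (s : R).

Definition pen s p : R := s * f p + g p.
Definition pen_grad s p : 'rV[R]_(dx + dy) := s *: grad f p + grad g p.
Definition pen_gx s x y : 'rV[R]_dx := lsubmx (pen_grad s (row_mx x y)).
Definition pen_gy s x y : 'rV[R]_dy := rsubmx (pen_grad s (row_mx x y)).
Definition pen_sol s x : set 'rV[R]_dy := argmin (fun y => pen s (row_mx x y)).
Definition pen_min s x : R := inf (range (fun y => pen s (row_mx x y))).
Definition Lpen s : R := s * Lf + Lg.

Lemma Lpen_gt0 s : 0 <= s -> 0 < Lpen s.
Proof. by move=> s0; rewrite ltr_wpDl// mulr_ge0// ltW. Qed.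

Lemma pen_sol0 x : pen_sol 0 x = Ystar g x.
Proof. by congr argmin; apply/funext => y; rewrite /pen mul0r add0r. Qed.

Lemma pen_grad_row s x y : pen_grad s (row_mx x y) = row_mx (pen_gx s x y) (pen_gy s x y).
Proof. by rewrite hsubmxK. Qed.

Lemma pen_grad_lip s p q : 0 <= s ->
  enorm (pen_grad s p - pen_grad s q) <= Lpen s * enorm (p - q).
Proof.
move=> s0; have [_ fL] := ba_f_smooth BA; have [_ gL] := ba_g_smooth BA.
have -> : pen_grad s p - pen_grad s q =
    s *: (grad f p - grad f q) + (grad g p - grad g q).
  by apply/rowP => i; rewrite !mxE; lra.
apply: le_trans (enormD _ _) _; rewrite enormZ ger0_norm//.
by rewrite /Lpen mulrDl lerD// -mulrA ler_wpM2l.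
Qed.

Lemma pen_taylor s p v : 0 <= s ->
  `|pen s (p + v) - pen s p - dot (pen_grad s p) v| <= Lpen s / 2 * enorm v ^+ 2.
Proof.
move=> s0; have := smooth_taylor p v (ba_f_smooth BA).
have := smooth_taylor p v (ba_g_smooth BA).
have -> : pen s (p + v) - pen s p - dot (pen_grad s p) v =
    s * (f (p + v) - f p - dot (grad f p) v) + (g (p + v) - g p - dot (grad g p) v).
  by rewrite /pen /pen_grad !dotE; ring.
move=> hg hf; apply: le_trans (ler_normD _ _) _; rewrite normrM (ger0_norm s0).
have -> : Lpen s / 2 * enorm v ^+ 2 = s * (Lf / 2 * enorm v ^+ 2) + Lg / 2 * enorm v ^+ 2.
  by rewrite /Lpen; ring.
exact: lerD (ler_wpM2l s0 hf) hg.
Qed.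

Lemma pen_taylor_y s x y w : 0 <= s ->
  `|pen s (row_mx x (y + w)) - pen s (row_mx x y) - dot (pen_gy s x y) w| <=
  Lpen s / 2 * enorm w ^+ 2.
Proof.
move=> s0; have := pen_taylor (row_mx x y) (row_mx 0 w) s0.
by rewrite add_row_mx addr0 pen_grad_row dot_row_mx dot0r add0r enorm_row_0mx.
Qed.

Lemma grad_pen_y s x y : grad (fun y => pen s (row_mx x y)) y = pen_gy s x y.
Proof.
have [df _] := ba_f_smooth BA; have [dg _] := ba_g_smooth BA.
apply/rowP => i; rewrite !mxE.
have e : (fun h : R => h^-1 *: (((fun y => pen s (row_mx x y)) \o shift y)
            (h *: delta_mx 0 i) - pen s (row_mx x y))) =
  (fun h : R => h^-1 *: ((pen s \o shift (row_mx x y))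
            (h *: delta_mx 0 (rshift dx i)) - pen s (row_mx x y))).
  apply/funext => h /=; congr (_ *: (pen s _ - _)).
  have -> : delta_mx 0 (rshift dx i) = row_mx 0 (delta_mx 0 i) :> 'rV[R]_(dx + dy).
    apply/rowP => j; case: (split_ordP j) => k ->.
      by rewrite row_mxEl !mxE eq_lrshift andbF.
    by rewrite row_mxEr !mxE eq_rshift.
  by rewrite scale_row_mx scaler0 add_row_mx add0r.
rewrite /derive e -/('D_(delta_mx 0 (rshift dx i)) (pen s) (row_mx x y)).
have fe : derivable f (row_mx x y) (delta_mx 0 (rshift dx i)) by exact: diff_derivable.
have ge : derivable g (row_mx x y) (delta_mx 0 (rshift dx i)) by exact: diff_derivable.
have := is_deriveD (is_deriveZ s (DeriveDef fe erefl)) (DeriveDef ge erefl).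
by move=> /@derive_val.
Qed.

Lemma pen_PL s x : 0 <= s <= sbar -> exists2 m, pen_sol s x m &
  forall y, 2 * mu * (pen s (row_mx x y) - pen s (row_mx x m)) <= enorm (pen_gy s x y) ^+ 2.
Proof.
move=> sb; have [[m mm] PLi] := ba_PL BA x sb; exists m => // y.
by have := PLi y; rewrite (inf_range_argmin mm) grad_pen_y.
Qed.

Lemma pen_minE s x y : pen_sol s x y -> pen_min s x = pen s (row_mx x y).
Proof. by move=> /inf_range_argmin. Qed.

Lemma pen_sol_exists s x : 0 <= s <= sbar -> exists y, pen_sol s x y.
Proof. by move=> /(pen_PL x)[m]; exists m. Qed.

Lemma pen_min_le s x y : 0 <= s <= sbar -> pen_min s x <= pen s (row_mx x y).
Proof. by move=> /(pen_sol_exists x)[m mm]; rewrite (pen_minE mm); exact: mm. Qed.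

Lemma pen_growth s x y : 0 <= s <= sbar -> exists2 y', pen_sol s x y' &
  enorm (y - y') ^+ 2 <= 8 / mu * (pen s (row_mx x y) - pen_min s x).
Proof.
move=> sb; have [m mm PLi] := pen_PL x sb; have /andP[s0 _] := sb.
have [y' y'm le] := PL_quadratic_growth mu0 (Lpen_gt0 s0)
   (fun y w => pen_taylor_y x y w s0) mm PLi y.
by exists y' => //; rewrite (pen_minE y'm).
Qed.

Lemma pen_error_bound s x y : 0 <= s <= sbar -> exists2 y', pen_sol s x y' &
  enorm (y - y') <= 2 / mu * enorm (pen_gy s x y).
Proof.
move=> sb; have [m mm PLi] := pen_PL x sb; have /andP[s0 _] := sb.
exact: (PL_error_bound mu0 (Lpen_gt0 s0) (fun y w => pen_taylor_y x y w s0) mm PLi).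
Qed.

Lemma pen_gap_le s x y y' : 0 <= s <= sbar -> pen_sol s x y' ->
  pen s (row_mx x y) - pen_min s x <= Lpen s / 2 * enorm (y - y') ^+ 2.
Proof.
move=> /andP[s0 _] my'; rewrite (pen_minE my').
exact: (gap_le_sqr (Lpen_gt0 s0) (fun y w => pen_taylor_y x y w s0) y my').
Qed.

Lemma pen_gy_sol s x y : 0 <= s -> pen_sol s x y -> pen_gy s x y = 0.
Proof.
move=> s0 my.
exact: (minimizer_grad0 (Lpen_gt0 s0) (fun y w => pen_taylor_y x y w s0) my).
Qed.

Lemma pen_inexact_step s L x y e : 0 <= s <= sbar -> Lpen s <= L ->
  pen s (row_mx x (y - L^-1 *: (pen_gy s x y + e))) - pen_min s x <=
  (1 - mu / L) * (pen s (row_mx x y) - pen_min s x) + enorm e ^+ 2 / (2 * L).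
Proof.
move=> sb sL; have [m mm PLi] := pen_PL x sb; have /andP[s0 _] := sb.
have L0 : 0 < L by exact: lt_le_trans (Lpen_gt0 s0) sL.
have smooth y' w : `|pen s (row_mx x (y' + w)) - pen s (row_mx x y') - dot (pen_gy s x y') w| <=
    L / 2 * enorm w ^+ 2.
  apply: le_trans (pen_taylor_y x y' w s0) _.
  by rewrite ler_wpM2r ?sqr_ge0// ler_wpM2r// invr_ge0.
by rewrite (pen_minE mm); exact: (inexact_contraction L0 smooth PLi).
Qed.

Lemma pen_continuous s : 0 <= s -> continuous (pen s).
Proof.
move=> s0; apply: continuous_of_expansion => p.
by exists (pen_grad s p), (Lpen s / 2) => v; exact: pen_taylor.
Qed.

(** The y-gradient at a solution for x is zero, hence at most Lpen |x' - x| at x'; the error bound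
    then finds a solution for x' nearby. This replaces Lipschitz continuity of a single-valued
    solution map. *)
Lemma pen_sol_lip s x x' y : 0 <= s <= sbar -> pen_sol s x y ->
  exists2 y', pen_sol s x' y' & enorm (y' - y) <= 2 * Lpen s / mu * enorm (x' - x).
Proof.
move=> sb my; have /andP[s0 _] := sb.
have [y' my' le] := pen_error_bound x' y sb; exists y' => //.
rewrite enormBC (le_trans le)// [X in _ <= X]mulrAC -[X in _ <= X * _]mulrA.
rewrite -[leRHS]mulrA [X in _ <= 2 * X]mulrC mulrA ler_wpM2l ?divr_ge0 ?(ltW mu0)//.
rewrite -[pen_gy _ _ _]subr0 -(pen_gy_sol s0 my) /pen_gy -linearB.
apply: le_trans (enorm_rsubmx _) _; apply: le_trans (pen_grad_lip _ _ s0) _.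
by rewrite sub_row_mx subrr enorm_row_mx0.
Qed.

Lemma grad_f_y_le x y : enorm (rsubmx (grad f (row_mx x y))) <= Cf.
Proof.
set D := rsubmx _; have [->|D0] := eqVneq (enorm D) 0; first exact: ltW.
have Dp : 0 < enorm D by rewrite lt_neqAle eq_sym D0 enorm_ge0.
apply/ler_addgt0Pr => e e0.
(* This t makes the quadratic remainder along t D equal to e times the length of t D. *)
pose t := 2 * e / (Lf * enorm D).
have t0 : 0 < t by rewrite !(mulr_gt0, divr_gt0, invr_gt0).
have := smooth_taylor (row_mx x y) (row_mx 0 (t *: D)) (ba_f_smooth BA).
have := ba_f_lip BA x (y + t *: D) y.
rewrite add_row_mx addr0 -[grad f _]hsubmxK -/D dot_row_mx dot0r add0r enorm_row_0mx.
rewrite (addrC y) addrK !ler_norml dotZr dot_sqr enormZ (gtr0_norm t0) addrC.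
move=> /andP[_ h1] /andP[h2 _].
have : t * enorm D * enorm D <= t * enorm D * (Cf + e).
  have E : Lf / 2 * (t * enorm D) ^+ 2 = t * enorm D * e.
    by rewrite /t; field; rewrite ?gt_eqF.
  by move: h1 h2; rewrite E; lra.
by rewrite ler_pM2l// mulr_gt0.
Qed.

(** At a minimizer of g the y-gradient of [pen s] is s times that of f, so it has norm at most s Cf;
    the error bound turns this into a distance. *)
Lemma pen_sol_shift s x y : 0 <= s <= sbar -> Ystar g x y ->
  exists2 y', pen_sol s x y' & enorm (y' - y) <= 2 * Cf / mu * s.
Proof.
move=> sb my; have /andP[s0 _] := sb.
have [y' my' le] := pen_error_bound x y sb; exists y' => //.
rewrite enormBC (le_trans le)//.
have -> : pen_gy s x y = s *: rsubmx (grad f (row_mx x y)).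
  have : pen_gy 0 x y = 0 by rewrite pen_gy_sol// pen_sol0.
  rewrite /pen_gy /pen_grad scale0r add0r => g0.
  by rewrite linearD linearZ /= g0 addr0.
rewrite enormZ ger0_norm//.
have -> : 2 * Cf / mu * s = 2 / mu * (s * Cf) by ring.
by rewrite ler_wpM2l ?divr_ge0 ?(ltW mu0)// ler_wpM2l// grad_f_y_le.
Qed.

End Penalty.

Lemma derive_of_quadratic (R : realType) (n : nat) (h : 'rV[R]_n -> R) (p d v : 'rV[R]_n) (C : R) :
  (forall u, `|h (p + u) - h p - dot d u| <= C * enorm u ^+ 2) ->
  is_derive p v h (dot d v).
Proof.
move=> H.
have cv : (fun t : R => t^-1 *: ((h \o shift p) (t *: v) - h p)) @ 0^' --> (dot d v : R).
  apply/cvgrPdist_le => e e0.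
  pose K := `|C| * enorm v ^+ 2 + 1.
  have K0 : 0 < K by rewrite ltr_wpDl// mulr_ge0// sqr_ge0.
  near=> t.
  have tn : t != 0 by near: t; exact: nbhs_dnbhs_neq.
  have te : `|t| <= e / K by near: t; apply: dnbhs0_le; rewrite divr_gt0.
  have := H (t *: v); rewrite dotE enormZ exprMn real_normK ?num_real// /= (addrC p) => h1.
  set A := h _ - h p in h1 *; rewrite distrC.
  have -> : t^-1 *: A - dot d v = t^-1 * (A - t * dot d v).
    by rewrite [RHS]mulrBr [t^-1 * (t * _)]mulrA mulVf// mul1r.
  rewrite normrM normfV ler_pdivrMl ?normr_gt0//.
  apply: le_trans h1 _.
  have -> : C * (t ^+ 2 * enorm v ^+ 2) = (C * enorm v ^+ 2) * `|t| * `|t|.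
    by rewrite -mulrA -expr2 real_normK ?num_real//; ring.
  rewrite mulrC ler_wpM2l//.
  rewrite ler_pdivlMr// in te; apply: le_trans te; rewrite mulrC ler_wpM2l//.
  by rewrite /K (le_trans (ler_wpM2r (sqr_ge0 _) (ler_norm C))) ?lerDl.
split; first by apply/cvg_ex; exists (dot d v).
exact: cvg_lim.
Unshelve. all: by end_near. Qed.

Lemma grad_of_quadratic (R : realType) (n : nat) (h : 'rV[R]_n -> R) (p d : 'rV[R]_n) (C : R) :
  (forall u, `|h (p + u) - h p - dot d u| <= C * enorm u ^+ 2) -> grad h p = d.
Proof.
move=> H; apply/rowP => i; rewrite mxE.
by have [_ ->] := derive_of_quadratic (delta_mx 0 i) H; rewrite dot_delta.
Qed.

(** * The hypergradient *)

Section Hypergradient.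
Context (R : realType) (dx dy : nat).
Context (mu Cf Lf Lg rhof rhog sbar ell : R) (f g : 'rV[R]_(dx + dy) -> R).
Hypotheses (mu0 : 0 < mu) (Cf0 : 0 < Cf) (Lf0 : 0 < Lf) (Lg0 : 0 < Lg).
Hypotheses (rhog0 : 0 < rhog) (sbar0 : 0 < sbar).
Hypothesis BA : bilevel_assumption mu Cf Lf Lg rhof rhog sbar f g.
Hypotheses (Cfl : Cf <= ell) (Lfl : Lf <= ell) (Lgl : Lg <= ell) (rhogl : rhog <= ell).
Hypothesis muLg : mu <= Lg.
Implicit Types (x u : 'rV[R]_dx) (y z v w : 'rV[R]_dy) (s : R).

Local Notation kappa := (ell / mu).

Lemma ell_gt0 : 0 < ell. Proof. exact: lt_le_trans Lgl. Qed.

Lemma kappa_ge1 : 1 <= kappa.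
Proof. by rewrite ler_pdivlMr// mul1r (le_trans muLg). Qed.

(** An envelope formula with non-unique minimizers. The upper bound keeps y fixed; the lower bound
    uses a solution at x + u close to y, and the linear term in its displacement vanishes because
    the y-gradient at y is zero. *)
Lemma pen_min_expand s x u y : 0 <= s <= sbar -> pen_sol f g s x y ->
  `|pen_min f g s (x + u) - pen_min f g s x - dot (pen_gx f g s x y) u| <=
  Lpen Lf Lg s / 2 * (1 + (2 * Lpen Lf Lg s / mu) ^+ 2) * enorm u ^+ 2.
Proof.
move=> sb my; have /andP[s0 _] := sb; have L0 := Lpen_gt0 Lf0 Lg0 s0.
have tay w := pen_taylor BA (row_mx x y) (row_mx u w) s0.
have {}tay w : `|pen f g s (row_mx (x + u) (y + w)) - pen f g s (row_mx x y) -
    dot (pen_gx f g s x y) u| <= Lpen Lf Lg s / 2 * (enorm u ^+ 2 + enorm w ^+ 2).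
  have := tay w; rewrite add_row_mx pen_grad_row dot_row_mx enorm_row_mx.
  by rewrite (pen_gy_sol Lf0 Lg0 BA s0 my) dot0l addr0.
have [y2 my2 le] := pen_sol_lip mu0 Lf0 Lg0 BA (x + u) sb my.
rewrite (addrC x) addrK in le.
have le2 : enorm (y2 - y) ^+ 2 <= (2 * Lpen Lf Lg s / mu) ^+ 2 * enorm u ^+ 2.
  by rewrite -exprMn ler_sqr ?nnegrE ?enorm_ge0// (le_trans _ le)// enorm_ge0.
have L20 : 0 <= Lpen Lf Lg s / 2 by rewrite divr_ge0// ltW.
have u0 := sqr_ge0 (enorm u).
rewrite (pen_minE my) ler_norml; apply/andP; split.
  have := tay (y2 - y); rewrite (addrC y) subrK ler_norml => /andP[h _].
  rewrite (pen_minE my2).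
  have := ler_wpM2l L20 le2; move: h; set a := pen f g _ _; set b := pen f g _ _; lra.
have := tay 0; rewrite addr0 enorm0 expr0n addr0 ler_norml => /andP[_ h].
have := pen_min_le BA (x + u) y sb.
have : 0 <= Lpen Lf Lg s / 2 * ((2 * Lpen Lf Lg s / mu) ^+ 2 * enorm u ^+ 2).
  by rewrite mulr_ge0// mulr_ge0 ?sqr_ge0.
move: h; set a := pen f g _ _; set b := pen f g _ _; set c := pen_min _ _ _ _; lra.
Qed.

Lemma pen_min_continuous s : 0 <= s <= sbar -> continuous (pen_min f g s).
Proof.
move=> sb; apply: continuous_of_expansion => x; have [y my] := pen_sol_exists BA x sb.
by exists (pen_gx f g s x y), (Lpen Lf Lg s / 2 * (1 + (2 * Lpen Lf Lg s / mu) ^+ 2)) => u;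
  exact: pen_min_expand.
Qed.

Lemma pen_min_is_derive s x u y : 0 <= s <= sbar -> pen_sol f g s x y ->
  is_derive x u (pen_min f g s) (dot (pen_gx f g s x y) u).
Proof. by move=> sb my; apply: derive_of_quadratic => v; exact: pen_min_expand. Qed.

(** Both sides are the gradient of [pen_min] at x, by the envelope formula. *)
Lemma pen_gx_sol s x y y' : 0 <= s <= sbar -> pen_sol f g s x y -> pen_sol f g s x y' ->
  pen_gx f g s x y = pen_gx f g s x y'.
Proof.
move=> sb my my'; apply/rowP => i; rewrite -!dot_delta.
have [_ <-] := pen_min_is_derive (delta_mx 0 i) sb my.
by have [_ <-] := pen_min_is_derive (delta_mx 0 i) sb my'.
Qed.

(** Vectors are rows and multiply from the left: [Hxy] sends an x-displacement to the first-order
    change of the y-gradient, [Hyx] a y-displacement to that of the x-gradient. *)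
Definition Hyy x y : 'M[R]_dy := drsubmx (hessian g (row_mx x y)).
Definition Hxy x y : 'M[R]_(dx, dy) := ursubmx (hessian g (row_mx x y)).
Definition Hyx x y : 'M[R]_(dy, dx) := dlsubmx (hessian g (row_mx x y)).

Lemma hessian_block x y u w : row_mx u w *m hessian g (row_mx x y) =
  row_mx (u *m ulsubmx (hessian g (row_mx x y)) + w *m Hyx x y)
         (u *m Hxy x y + w *m Hyy x y).
Proof. by rewrite -[in LHS](submxK (hessian g _)) mul_row_block. Qed.

Lemma hessian_symg x y u w u' w' :
  dot (row_mx u w *m hessian g (row_mx x y)) (row_mx u' w') =
  dot (row_mx u' w' *m hessian g (row_mx x y)) (row_mx u w).
Proof.
have [dg _] := ba_g_smooth BA.
exact: (hessian_sym _ _ _ (ltW rhog0) dg (ba_g_twice BA) (ba_g_hess_lip BA)).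
Qed.

Lemma Hyy_sym x y w w' : dot (w *m Hyy x y) w' = dot (w' *m Hyy x y) w.
Proof.
have := hessian_symg x y 0 w 0 w'.
by rewrite !hessian_block !dot_row_mx !dot0r !mul0mx !add0r.
Qed.

Lemma Hyx_sym x y u w : dot (w *m Hyx x y) u = dot (u *m Hxy x y) w.
Proof.
have := hessian_symg x y 0 w u 0.
by rewrite !hessian_block !dot_row_mx !dot0r !mul0mx !add0r !addr0.
Qed.

Let gx x y : 'rV[R]_dx := lsubmx (grad g (row_mx x y)).
Let gy x y : 'rV[R]_dy := rsubmx (grad g (row_mx x y)).
Let fx x y : 'rV[R]_dx := lsubmx (grad f (row_mx x y)).
Let fy x y : 'rV[R]_dy := rsubmx (grad f (row_mx x y)).

Lemma gy_taylor x y u w :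
  enorm (gy (x + u) (y + w) - gy x y - (u *m Hxy x y + w *m Hyy x y)) <=
  rhog / 2 * (enorm u ^+ 2 + enorm w ^+ 2).
Proof.
have := hessian_taylor (row_mx x y) (row_mx u w) (ltW rhog0) (ba_g_twice BA) (ba_g_hess_lip BA).
rewrite add_row_mx enorm_row_mx; apply: le_trans.
apply: le_trans (enorm_rsubmx _).
by rewrite hessian_block linearB linearB /= row_mxKr.
Qed.

Lemma gx_taylor x y w :
  enorm (gx x (y + w) - gx x y - w *m Hyx x y) <= rhog / 2 * enorm w ^+ 2.
Proof.
have := hessian_taylor (row_mx x y) (row_mx 0 w) (ltW rhog0) (ba_g_twice BA) (ba_g_hess_lip BA).
rewrite add_row_mx addr0 enorm_row_0mx; apply: le_trans.
apply: le_trans (enorm_lsubmx _).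
by rewrite hessian_block linearB linearB /= row_mxKl mul0mx add0r.
Qed.

Lemma gradf_y_lip x y w : enorm (grad f (row_mx x (y + w)) - grad f (row_mx x y)) <= Lf * enorm w.
Proof.
have [_ fL] := ba_f_smooth BA.
by apply: le_trans (fL _ _) _; rewrite sub_row_mx subrr enorm_row_0mx (addrC y) addrK.
Qed.

Lemma gy_sol x y : Ystar g x y -> gy x y = 0.
Proof.
rewrite -(pen_sol0 f) => my; have := pen_gy_sol Lf0 Lg0 BA (lexx 0) my.
by rewrite /pen_gy /pen_grad scale0r add0r.
Qed.

(** [c] is the speed at which solutions move with s. [cE] bounds the first-order residual: gradient
    Lipschitz constant of f over a distance c s, and Hessian Lipschitz constant of g over the same
    distance. *)
Let c : R := 2 * Cf / mu.
Let cE : R := Lf * c + rhog / 2 * c ^+ 2.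

Let c0 : 0 <= c. Proof. by rewrite divr_ge0 ?mulr_ge0 ?ltW. Qed.
Let cE0 : 0 <= cE.
Proof. by rewrite addr_ge0// ?mulr_ge0 ?sqr_ge0 ?divr_ge0 ?ltW// ?mulr_gt0 ?invr_gt0// ?mulr_gt0. Qed.

(** Expanding the stationarity condition of the penalty problem around y and dividing by s shows
    that w / s solves the adjoint equation up to O(s). *)
Lemma shift_first_order s x y w : 0 < s <= sbar -> Ystar g x y -> pen_sol f g s x (y + w) ->
  enorm w <= c * s -> enorm (fy x y + (s^-1 *: w) *m Hyy x y) <= s * cE.
Proof.
move=> /andP[s0 sb] my myw wle.
have : pen_gy f g s x (y + w) = 0 by exact: (pen_gy_sol Lf0 Lg0 BA (ltW s0) myw).
rewrite /pen_gy /pen_grad linearD linearZ /= -/(fy x (y + w)) -/(gy x (y + w)) => e0.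
have := gy_taylor x y 0 w; rewrite addr0 enorm0 mul0mx !add0r expr0n add0r (gy_sol my) subr0.
set E := gy _ _ - _ => Ele.
have wH : w *m Hyy x y = - (s *: fy x (y + w)) - E.
  have gyE : gy x (y + w) = - (s *: fy x (y + w)).
    by apply/eqP; rewrite -addr_eq0 addrC e0.
  by rewrite /E gyE opprB addrCA subrr addr0.
have -> : fy x y + (s^-1 *: w) *m Hyy x y = (fy x y - fy x (y + w)) - s^-1 *: E.
  rewrite -scalemxAl wH scalerBr scalerN scalerA mulVf ?gt_eqF// scale1r.
  by rewrite addrA.
apply: le_trans (enormB _ _) _; rewrite /cE mulrDr; apply: lerD.
  rewrite enormBC /fy -linearB; apply: le_trans (enorm_rsubmx _) _.
  apply: le_trans (gradf_y_lip _ _ _) _.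
  by rewrite mulrCA ler_wpM2l ?(ltW Lf0)// mulrC.
have si : 0 < s^-1 by rewrite invr_gt0.
rewrite enormZ gtr0_norm// ler_pdivrMl//.
apply: le_trans Ele _.
have -> : s * (s * (rhog / 2 * c ^+ 2)) = rhog / 2 * (c * s) ^+ 2 by ring.
rewrite ler_wpM2l ?divr_ge0 ?(ltW rhog0)// ler_sqr ?nnegrE ?enorm_ge0//.
by rewrite mulr_ge0// ltW.
Qed.

Lemma small_step (C e : R) : 0 <= C -> 0 < e -> exists2 s, 0 < s <= sbar & s * C <= e.
Proof.
move=> C0 e0; exists (Num.min sbar (e / (C + 1))).
  by rewrite lt_min sbar0 divr_gt0 ?ltr_wpDl//= ge_min lexx.
apply: (@le_trans _ _ (e / (C + 1) * C)); first by rewrite ler_wpM2r// ge_min lexx orbT.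
by rewrite mulrAC ler_pdivrMr ?ltr_wpDl// ler_wpM2l ?(ltW e0)// lerDl.
Qed.

(* p is the limit of (y_s - y) / s, where y_s is a solution of the penalty problem near y. *)
Lemma adjoint_exists x y : Ystar g x y ->
  exists2 p, enorm p <= c & p *m Hyy x y = - fy x y.
Proof.
move=> my; apply: preimage_of_approx => // e e0.
have [s s0 se] := small_step cE0 e0; have /andP[s00 ssb] := s0.
have sb : 0 <= s <= sbar by rewrite ltW.
have [ys mys le] := pen_sol_shift mu0 Cf0 Lf0 Lg0 BA sb my.
exists (s^-1 *: (ys - y)).
  by rewrite enormZ gtr0_norm ?invr_gt0// ler_pdivrMl// mulrC.
rewrite -enormN opprB addrC opprK; apply: le_trans se.
by apply: shift_first_order => //; rewrite (addrC y) subrK.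
Qed.

(** Here v is a first-order velocity of lower-level solutions as x moves along u. The approximate
    solutions are (y' - y) / t with y' a solution at x + t u near y. It serves to trade u Hxy for v
    Hyy. *)
Lemma tangent_exists x y u : Ystar g x y ->
  exists2 v, enorm v <= 2 * Lg / mu * enorm u & v *m Hyy x y = - (u *m Hxy x y).
Proof.
move=> my; pose d := 2 * Lg / mu.
have d0 : 0 <= d by rewrite divr_ge0 ?mulr_ge0 ?ltW.
apply: preimage_of_approx => [|e e0]; first by rewrite mulr_ge0 ?enorm_ge0.
pose C := rhog / 2 * (1 + d ^+ 2) * enorm u ^+ 2.
have C0 : 0 <= C.
  have d2 : 0 <= 1 + d ^+ 2 by rewrite addr_ge0// sqr_ge0.
  by rewrite mulr_ge0 ?sqr_ge0// mulr_ge0// divr_ge0// ltW.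
have [t /andP[t0 _] te] := small_step C0 e0.
have sb0 : 0 <= (0 : R) <= sbar by rewrite lexx ltW.
have my' := my; rewrite -(pen_sol0 f) in my'.
have [y' my2] := pen_sol_lip mu0 Lf0 Lg0 BA (x + t *: u) sb0 my'.
rewrite (addrC x) addrK /Lpen mul0r add0r -/d enormZ (gtr0_norm t0) => le.
exists (t^-1 *: (y' - y)).
  by rewrite enormZ gtr0_norm ?invr_gt0// ler_pdivrMl// mulrCA.
have := gy_taylor x y (t *: u) (y' - y); rewrite (addrC y) subrK.
rewrite (gy_sol my) gy_sol; last by rewrite -(pen_sol0 f).
rewrite subr0 sub0r enormN => h.
rewrite -(ler_pM2l t0) -[X in X * _](gtr0_norm t0) -enormZ scalerBr scalerN -!scalemxAl.
rewrite scalerA mulfV ?gt_eqF// scale1r -opprD enormN scalemxAl.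
apply: (le_trans h); apply: (@le_trans _ _ (t * (t * C))); last by rewrite ler_pM2l.
rewrite enormZ (gtr0_norm t0).
have -> : t * (t * C) = rhog / 2 * ((t * enorm u) ^+ 2 + (d * (t * enorm u)) ^+ 2).
  by rewrite /C; ring.
rewrite ler_wpM2l ?divr_ge0 ?(ltW rhog0)// lerD2l ler_sqr ?nnegrE ?enorm_ge0//.
exact: (mulr_ge0 d0 (mulr_ge0 (ltW t0) (enorm_ge0 u))).
Qed.

Let cK : c <= 2 * kappa.
Proof. by rewrite /c -mulrA ler_wpM2l// ler_pM2r ?invr_gt0. Qed.

Let cE_le : cE <= 4 * ell * kappa ^+ 2.
Proof.
have l0 := ell_gt0; have K1 := kappa_ge1.
have K2 : kappa <= kappa ^+ 2 by rewrite expr2 ler_peMl// (le_trans ler01).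
have h1 : Lf * c <= ell * (2 * kappa) by apply: ler_pM => //; exact: ltW.
have h2 : c ^+ 2 <= (2 * kappa) ^+ 2 by rewrite ler_sqr ?nnegrE// (le_trans c0).
have h3 : rhog * c ^+ 2 <= ell * (2 * kappa) ^+ 2.
  by apply: ler_pM => //; [exact: ltW|exact: sqr_ge0].
have h4 : ell * kappa <= ell * kappa ^+ 2 by rewrite ler_pM2l.
have e4 : (2 * kappa) ^+ 2 = 4 * kappa ^+ 2 by ring.
by move: h1 h3 h4; rewrite /cE e4; move: (c ^+ 2) (kappa ^+ 2) kappa => c2 k2 k; lra.
Qed.

Let lk3 : 0 <= ell * kappa ^+ 3.
Proof.
by rewrite mulr_ge0 ?(ltW ell_gt0)// exprn_ge0// (le_trans ler01 kappa_ge1).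
Qed.

(** Three errors add up: the variation of the x-gradient of f, the Hessian remainder of g, and the
    mismatch of w / s with the adjoint p. The first two together contribute 4, the last one 8, in
    units of ell kappa^3 s. *)
Lemma penalty_bias s x y w p u : 0 < s <= sbar -> Ystar g x y -> pen_sol f g s x (y + w) ->
  enorm w <= c * s -> p *m Hyy x y = - fy x y ->
  dot (s^-1 *: (pen_gx f g s x (y + w) - pen_gx f g 0 x y) - (fx x y + p *m Hyx x y)) u <=
  12 * (ell * kappa ^+ 3) * s * enorm u.
Proof.
move=> s0b my myw wle pH; have /andP[s0 sb] := s0b.
have [v vle vH] := tangent_exists u my.
have sU : s^-1 *: (pen_gx f g s x (y + w) - pen_gx f g 0 x y) - (fx x y + p *m Hyx x y) =
    (fx x (y + w) - fx x y) + s^-1 *: (gx x (y + w) - gx x y - w *m Hyx x y) +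
    (s^-1 *: w - p) *m Hyx x y.
  have -> : pen_gx f g s x (y + w) = s *: fx x (y + w) + gx x (y + w).
    by rewrite /pen_gx /pen_grad linearD linearZ.
  have -> : pen_gx f g 0 x y = gx x y by rewrite /pen_gx /pen_grad scale0r add0r.
  rewrite mulmxBl -scalemxAl; move: (fx x (y + w)) (fx x y) (gx _ _) (gx _ _) (w *m _) (p *m _).
  by move=> a b d e k l; apply/rowP => i; rewrite !mxE; field; rewrite gt_eqF.
rewrite sU; set z := s^-1 *: w - p; rewrite dotDl (dotDl (fx x (y + w) - fx x y)).
have u0 := enorm_ge0 u; have l0 := ell_gt0; have K1 := kappa_ge1.
have K0 : 0 <= kappa by exact: le_trans K1.
have h1 : dot (fx x (y + w) - fx x y) u <= Lf * c * s * enorm u.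
  apply: le_trans (dot_le _ _) _; rewrite ler_wpM2r// /fx -linearB.
  apply: le_trans (enorm_lsubmx _) _; apply: le_trans (gradf_y_lip _ _ _) _.
  by rewrite -mulrA ler_wpM2l// ltW.
have h2 : dot (s^-1 *: (gx x (y + w) - gx x y - w *m Hyx x y)) u <=
    rhog / 2 * c ^+ 2 * s * enorm u.
  apply: le_trans (dot_le _ _) _; rewrite ler_wpM2r//.
  have si : 0 < s^-1 by rewrite invr_gt0.
  rewrite enormZ gtr0_norm// ler_pdivrMl//; apply: le_trans (gx_taylor _ _ _) _.
  have -> : s * (rhog / 2 * c ^+ 2 * s) = rhog / 2 * (c * s) ^+ 2 by ring.
  rewrite ler_wpM2l ?divr_ge0 ?(ltW rhog0)// ler_sqr ?nnegrE ?enorm_ge0//.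
  by rewrite mulr_ge0// ltW.
(* z itself need not be small, since w / s and p may differ along the kernel of [Hyy]. By symmetry
   of the Hessian the term equals - (z Hyy) . v, and z Hyy is small by [shift_first_order]. *)
have h3 : dot (z *m Hyx x y) u <= s * cE * (2 * kappa * enorm u).
  rewrite Hyx_sym -[u *m _]opprK -vH dotNl Hyy_sym -dotNl.
  apply: le_trans (dot_le _ _) _; rewrite enormN; apply: ler_pM; rewrite ?enorm_ge0//.
    rewrite /z mulmxBl pH opprK addrC; exact: shift_first_order.
  apply: le_trans vle _; rewrite ler_wpM2r// -mulrA ler_wpM2l//.
  by rewrite ler_pM2r ?invr_gt0.
have h4 : s * cE * (2 * kappa * enorm u) <= s * (4 * ell * kappa ^+ 2) * (2 * kappa * enorm u).
  by rewrite ler_wpM2r ?(mulr_ge0 (mulr_ge0 (ler0n _ 2) K0) u0)// ler_pM2l.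
have h5 : cE * (s * enorm u) <= 4 * ell * kappa ^+ 2 * (s * enorm u).
  by rewrite ler_wpM2r// mulr_ge0// ltW.
have h6 : ell * kappa ^+ 2 * (s * enorm u) <= ell * kappa ^+ 3 * (s * enorm u).
  rewrite ler_wpM2r ?mulr_ge0 ?(ltW s0)// ler_pM2l//.
  by rewrite (exprS _ 2) ler_peMl ?exprn_ge0.
have -> : 12 * (ell * kappa ^+ 3) * s * enorm u =
  4 * (ell * kappa ^+ 3 * (s * enorm u)) + s * (4 * ell * kappa ^+ 2) * (2 * kappa * enorm u).
  by ring.
rewrite {1}/cE in h5.
move: h1 h2 h3 h4 h5 h6.
set a := dot _ _; set b := dot _ _; set d := dot _ _.
set A := ell * kappa ^+ 3 * _; set B := s * (4 * ell * _) * _; set D := s * cE * _.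
move: (kappa ^+ 2) => k2; move: a b d A B D => a b d A B D; lra.
Qed.

Lemma penalty_bias_norm s x ys y p : 0 < s <= sbar -> Ystar g x y -> pen_sol f g s x ys ->
  p *m Hyy x y = - fy x y ->
  enorm (s^-1 *: (pen_gx f g s x ys - pen_gx f g 0 x y) - (fx x y + p *m Hyx x y)) <=
  12 * (ell * kappa ^+ 3) * s.
Proof.
move=> s0b my mys pH; have /andP[s0 sb] := s0b.
have sb' : 0 <= s <= sbar by rewrite ltW.
have [yw myw le] := pen_sol_shift mu0 Cf0 Lf0 Lg0 BA sb' my.
apply: enorm_le_dot => [|u].
  exact: (mulr_ge0 (mulr_ge0 (ler0n _ 12) lk3) (ltW s0)).
rewrite (pen_gx_sol sb' mys myw).
by have := @penalty_bias s x y (yw - y) p u s0b my; rewrite (addrC y) subrK; apply.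
Qed.

(** For every small s both candidates are within 12 ell kappa^3 s of one and the same penalty
    hypergradient, which depends neither on p nor on the choice of minimizer; s tends to 0. *)
Lemma hypergrad_unique x y y' p p' : Ystar g x y -> Ystar g x y' ->
  p *m Hyy x y = - fy x y -> p' *m Hyy x y' = - fy x y' ->
  fx x y + p *m Hyx x y = fx x y' + p' *m Hyx x y'.
Proof.
move=> my my' pH pH'; apply/eqP; rewrite -subr_eq0; apply/eqP/enorm_eq0/eqP.
rewrite eq_le enorm_ge0 andbT; apply/ler_addgt0Pr => e e0; rewrite add0r.
have C0 : 0 <= 24 * (ell * kappa ^+ 3) by rewrite mulr_ge0.
have [s s0 se] := small_step C0 e0; apply: le_trans se.
have /andP[s00 sb] := s0; have sb' : 0 <= s <= sbar by rewrite ltW.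
have [ys mys] := pen_sol_exists BA x sb'.
have h1 := penalty_bias_norm s0 my mys pH; have h2 := penalty_bias_norm s0 my' mys pH'.
have e0' : pen_gx f g 0 x y = pen_gx f g 0 x y'.
  by apply: pen_gx_sol; rewrite ?lexx ?(ltW sbar0)// pen_sol0.
rewrite -e0' in h2; set q := s^-1 *: _ in h1 h2.
rewrite enormBC in h1; apply: le_trans (enorm_tri q _ _) _.
by apply: le_trans (lerD h1 h2) _; lra.
Qed.

(** The adjoint equation and the symmetry of the Hessian convert the linear term of f in w into one
    in u, up to p . E. Here E is the linearisation of the y-gradient of g between two of its zeros,
    so it is of second order. *)
Lemma lower_two_point x u y y2 p : Ystar g x y -> Ystar g (x + u) y2 ->
  enorm (y2 - y) <= 2 * kappa * enorm u ->
  enorm p <= c -> p *m Hyy x y = - fy x y ->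
  `|f (row_mx (x + u) y2) - f (row_mx x y) - dot (fx x y + p *m Hyx x y) u| <=
  8 * (ell * kappa ^+ 3) * enorm u ^+ 2.
Proof.
move=> my my2 le pc pH; set w := y2 - y in le *.
have y2E : y2 = y + w by rewrite /w addrC subrK.
have := gy_taylor x y u w; rewrite -y2E (gy_sol my) (gy_sol my2) subrr sub0r enormN.
set E := u *m _ + _ => Ele.
have := smooth_taylor (row_mx x y) (row_mx u w) (ba_f_smooth BA).
rewrite add_row_mx -y2E -[grad f _]hsubmxK dot_row_mx enorm_row_mx -/(fx x y) -/(fy x y).
set A := f _; set B := f _ => fle.
have K1 := kappa_ge1; have l0 := ell_gt0; have K0 : 0 <= kappa by exact: le_trans K1.
have fyw : dot (fy x y) w = dot (p *m Hyx x y) u - dot p E.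
  rewrite -[fy x y]opprK -pH dotNl Hyy_sym Hyx_sym (dotC p) /E dotDl; ring.
have pE : `|dot p E| <= c * (rhog / 2 * (enorm u ^+ 2 + enorm w ^+ 2)).
  by apply: le_trans (cauchy_schwarz _ _) _; apply: ler_pM; rewrite ?enorm_ge0.
have u0 := sqr_ge0 (enorm u).
have w2 : enorm w ^+ 2 <= 4 * kappa ^+ 2 * enorm u ^+ 2.
  have -> : 4 * kappa ^+ 2 * enorm u ^+ 2 = (2 * kappa * enorm u) ^+ 2 by ring.
  by rewrite ler_sqr ?nnegrE ?enorm_ge0// (le_trans _ le)// enorm_ge0.
(* 5 = 1 + 4; with Lf + c rhog <= 3 ell kappa below, the constant becomes 15/2, rounded up to 8. *)
have S5 : enorm u ^+ 2 + enorm w ^+ 2 <= 5 * kappa ^+ 2 * enorm u ^+ 2.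
  have : enorm u ^+ 2 <= kappa ^+ 2 * enorm u ^+ 2.
    by rewrite ler_peMl// -(expr1n _ 2) ler_sqr ?nnegrE.
  by lra.
set S := enorm u ^+ 2 + _ in S5 fle pE *; have S0 : 0 <= S by rewrite addr_ge0// sqr_ge0.
have h1 : `|A - B - dot (fx x y + p *m Hyx x y) u| <= Lf / 2 * S + c * (rhog / 2 * S).
  rewrite fyw in fle; rewrite dotDl.
  have -> : A - B - (dot (fx x y) u + dot (p *m Hyx x y) u) =
      (A - B - (dot (fx x y) u + (dot (p *m Hyx x y) u - dot p E))) - dot p E by ring.
  by apply: le_trans (ler_normB _ _) _; exact: lerD.
apply: (le_trans h1).
have h2 : Lf / 2 * S + c * (rhog / 2 * S) <= (Lf + c * rhog) / 2 * (5 * kappa ^+ 2 * enorm u ^+ 2).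
  have -> : Lf / 2 * S + c * (rhog / 2 * S) = (Lf + c * rhog) / 2 * S by ring.
  by rewrite ler_wpM2l// divr_ge0// (addr_ge0 (ltW Lf0) (mulr_ge0 c0 (ltW rhog0))).
apply: (le_trans h2).
have h3 : Lf + c * rhog <= 3 * ell * kappa.
  have : c * rhog <= 2 * kappa * ell by apply: ler_pM => //; exact: ltW.
  have : ell <= ell * kappa by rewrite ler_peMr// ltW.
  by move: Lfl; lra.
have T0 : 0 <= kappa ^+ 2 * enorm u ^+ 2 by rewrite mulr_ge0 ?sqr_ge0.
have := ler_wpM2r T0 h3.
have -> : 3 * ell * kappa * (kappa ^+ 2 * enorm u ^+ 2) = 3 * (ell * kappa ^+ 3 * enorm u ^+ 2) by ring.
have : 0 <= ell * kappa ^+ 3 * enorm u ^+ 2 by rewrite mulr_ge0.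
set T := kappa ^+ 2 * _; set T3 := ell * kappa ^+ 3 * _.
have -> : (Lf + c * rhog) / 2 * (5 * kappa ^+ 2 * enorm u ^+ 2) = 5 / 2 * ((Lf + c * rhog) * T).
  by rewrite /T; ring.
have -> : 8 * (ell * kappa ^+ 3) * enorm u ^+ 2 = 8 * T3 by rewrite /T3; ring.
by lra.
Qed.

(** On the minimizers of g the penalty function at [sbar] is sbar f plus a constant, and it is
    bounded below because it has a minimizer; hence f is bounded below there. *)
Lemma phi_has_inf x : has_inf [set f (row_mx x y) | y in Ystar g x].
Proof.
have sb0 : 0 <= (0 : R) <= sbar by rewrite lexx ltW.
have sb1 : 0 <= sbar <= sbar by rewrite lexx ltW.
split.
  have [y] := pen_sol_exists BA x sb0; rewrite pen_sol0 => my.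
  by exists (f (row_mx x y)), y.
exists ((pen_min f g sbar x - pen_min f g 0 x) / sbar) => _ [y my <-].
rewrite ler_pdivrMr//.
rewrite -(pen_sol0 f) in my; rewrite (pen_minE my); have := pen_min_le BA x y sb1.
by move: (pen_min _ _ _ _) => m; rewrite /pen; lra.
Qed.

Lemma phi_le x y : Ystar g x y -> phi f g x <= f (row_mx x y).
Proof. by move=> my; apply: ge_inf; [exact: (phi_has_inf x).2 | exists y]. Qed.

Lemma phi_near x e : 0 < e -> exists2 y, Ystar g x y & f (row_mx x y) < phi f g x + e.
Proof.
by move=> e0; have [_ [y my <-]] := inf_adherent e0 (phi_has_inf x); exists y.
Qed.

Lemma lower_sol_lip x u y : Ystar g x y ->
  exists2 y2, Ystar g (x + u) y2 & enorm (y2 - y) <= 2 * kappa * enorm u.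
Proof.
have sb0 : 0 <= (0 : R) <= sbar by rewrite lexx ltW.
rewrite -(pen_sol0 f) => my.
have [y2 my2 le] := pen_sol_lip mu0 Lf0 Lg0 BA (x + u) sb0 my.
exists y2; first by rewrite -(pen_sol0 f).
apply: (le_trans le); rewrite (addrC x) addrK ler_wpM2r ?enorm_ge0// /Lpen mul0r add0r.
by rewrite -mulrA ler_wpM2l// ler_pM2r ?invr_gt0.
Qed.

(** Near-minimizers of f over the solution sets suffice. For the lower bound one at x + u is traced
    back to x, for the upper bound one at x is followed to x + u; [hypergrad_unique] makes the
    linear term independent of the point reached. *)
Lemma phi_expand_aux x y p u : Ystar g x y -> p *m Hyy x y = - fy x y ->
  `|phi f g (x + u) - phi f g x - dot (fx x y + p *m Hyx x y) u| <=
  8 * (ell * kappa ^+ 3) * enorm u ^+ 2.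
Proof.
move=> my pH; rewrite ler_norml; apply/andP; split.
  apply/ler_addgt0Pr => e e0.
  have [y2 my2 ly2] := phi_near (x + u) e0.
  have [y1 my1] := lower_sol_lip (- u) my2; rewrite addrK in my1 *.
  rewrite enormN enormBC => le.
  have [p1 p1c p1H] := adjoint_exists my1.
  have := lower_two_point my1 my2 le p1c p1H.
  rewrite (hypergrad_unique my1 my p1H pH) ler_norml => /andP[h _].
  have := phi_le my1; move: h ly2; set A := f _; set B := f _; lra.
apply/ler_addgt0Pr => e e0.
have [y1 my1 ly1] := phi_near x e0.
have [y2 my2 le] := lower_sol_lip u my1.
have [p1 p1c p1H] := adjoint_exists my1.
have := lower_two_point my1 my2 le p1c p1H.
rewrite (hypergrad_unique my1 my p1H pH) ler_norml => /andP[_ h].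
have := phi_le my2; move: h ly1; set A := f _; set B := f _; lra.
Qed.

Lemma grad_phiE x y p : Ystar g x y -> p *m Hyy x y = - fy x y ->
  grad (phi f g) x = fx x y + p *m Hyx x y.
Proof. by move=> my pH; apply: grad_of_quadratic => u; exact: phi_expand_aux. Qed.

Lemma lower_sol_exists x : exists y, Ystar g x y.
Proof.
have [|y] := @pen_sol_exists _ _ _ _ _ _ _ _ _ _ _ _ BA 0 x; first by rewrite lexx ltW.
by rewrite pen_sol0; exists y.
Qed.

Theorem phi_expand x u :
  `|phi f g (x + u) - phi f g x - dot (grad (phi f g) x) u| <=
  8 * (ell * kappa ^+ 3) * enorm u ^+ 2.
Proof.
have [y my] := lower_sol_exists x; have [p _ pH] := adjoint_exists my.
by rewrite (grad_phiE my pH); exact: phi_expand_aux.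
Qed.

Theorem phi_penalty_bias s x ys y : 0 < s <= sbar -> Ystar g x y -> pen_sol f g s x ys ->
  enorm (s^-1 *: (pen_gx f g s x ys - pen_gx f g 0 x y) - grad (phi f g) x) <=
  12 * (ell * kappa ^+ 3) * s.
Proof.
move=> sb my mys; have [p _ pH] := adjoint_exists my.
by rewrite (grad_phiE my pH); exact: penalty_bias_norm.
Qed.

Lemma phi_continuous : continuous (phi f g).
Proof.
apply: continuous_of_expansion => x.
by exists (grad (phi f g) x), (8 * (ell * kappa ^+ 3)) => u; exact: phi_expand.
Qed.

Lemma phi_derivable x u : derivable (phi f g) x u.
Proof. by have [] := derive_of_quadratic u (phi_expand x). Qed.

(** The gap becomes a squared distance by quadratic growth, the nearest solution is moved to x', and
    smoothness converts the distance back into a gap. The coefficient 16 is twice the one in the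
    recursion for delta. *)
Lemma pen_gap_move s x x' y L : 0 <= s <= sbar -> Lpen Lf Lg s <= L -> L <= 2 * Lg ->
  pen f g s (row_mx x' y) - pen_min f g s x' <=
  L * (8 / mu * (pen f g s (row_mx x y) - pen_min f g s x) +
       16 * Lg ^+ 2 / mu ^+ 2 * enorm (x' - x) ^+ 2).
Proof.
move=> sb sL L2; have /andP[s0 _] := sb; have Ls := Lpen_gt0 Lf0 Lg0 s0.
have [y1 my1 le1] := pen_growth mu0 Lf0 Lg0 BA x y sb.
have [y2 my2 le2] := pen_sol_lip mu0 Lf0 Lg0 BA x' sb my1.
have L0 : 0 < L by exact: lt_le_trans sL.
apply: le_trans (pen_gap_le Lf0 Lg0 BA y sb my2) _.
have r0 := enorm_ge0 (x' - x).
have h2 : enorm (y1 - y2) ^+ 2 <= 16 * Lg ^+ 2 / mu ^+ 2 * enorm (x' - x) ^+ 2.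
  have -> : 16 * Lg ^+ 2 / mu ^+ 2 * enorm (x' - x) ^+ 2 =
      (2 * (2 * Lg) / mu * enorm (x' - x)) ^+ 2 by field; rewrite gt_eqF.
  rewrite ler_sqr ?nnegrE ?enorm_ge0//; last first.
    by rewrite mulr_ge0// divr_ge0 ?(ltW mu0)// mulr_ge0// mulr_ge0// ltW.
  rewrite enormBC; apply: (le_trans le2); rewrite ler_wpM2r// ler_wpM2r ?invr_ge0 ?(ltW mu0)//.
  by rewrite ler_wpM2l// (le_trans sL).
have h3 := enorm_sum2 (y - y1) (y1 - y2); rewrite addrA subrK in h3.
have h4 : enorm (y - y2) ^+ 2 <= 2 * (8 / mu * (pen f g s (row_mx x y) - pen_min f g s x)) +
    2 * (16 * Lg ^+ 2 / mu ^+ 2 * enorm (x' - x) ^+ 2).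
  by apply: (le_trans h3); apply: lerD; rewrite ler_pM2l.
apply: (@le_trans _ _ (L / 2 * enorm (y - y2) ^+ 2)).
  by rewrite ler_wpM2r ?sqr_ge0// ler_wpM2r// invr_ge0.
have L20 : 0 <= L / 2 by rewrite divr_ge0// ltW.
apply: (le_trans (ler_wpM2l L20 h4)).
by set A := 8 / mu * _; set C := 16 * _ / _ * _; lra.
Qed.

(** b1 is the effect of inexact inner solutions, b2 the penalty bias at exact ones. The constant is
    64 = 2 * 4 * 8: a sum of two squares, a smoothness constant of at most 2 Lg squared, and
    quadratic growth. *)
Lemma hypergrad_error s x y z : 0 < s <= sbar -> s * Lf <= Lg ->
  exists b1 b2 : 'rV[R]_dx,
  [/\ s^-1 *: (pen_gx f g s x y - pen_gx f g 0 x z) - grad (phi f g) x = b1 + b2,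
      enorm b1 ^+ 2 <= 64 * Lg ^+ 2 / (mu * s ^+ 2) *
        ((pen f g s (row_mx x y) - pen_min f g s x) +
         (pen f g 0 (row_mx x z) - pen_min f g 0 x)) &
      enorm b2 <= 12 * (ell * kappa ^+ 3) * s].
Proof.
move=> sb sLf; have /andP[s0 ssb] := sb.
have sb' : 0 <= s <= sbar by rewrite ltW.
have sb0 : 0 <= (0 : R) <= sbar by rewrite lexx ltW.
have [y' my' ley] := pen_growth mu0 Lf0 Lg0 BA x y sb'.
have [z' mz' lez] := pen_growth mu0 Lf0 Lg0 BA x z sb0.
exists (s^-1 *: ((pen_gx f g s x y - pen_gx f g s x y') - (pen_gx f g 0 x z - pen_gx f g 0 x z'))).
exists (s^-1 *: (pen_gx f g s x y' - pen_gx f g 0 x z') - grad (phi f g) x).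
split; last by apply: phi_penalty_bias => //; rewrite -(pen_sol0 f).
  by apply/rowP => i; rewrite !mxE; ring.
have lipx s' w w' : 0 <= s' -> s' * Lf <= Lg ->
    enorm (pen_gx f g s' x w - pen_gx f g s' x w') ^+ 2 <= 4 * Lg ^+ 2 * enorm (w - w') ^+ 2.
  move=> s'0 s'L.
  have -> : 4 * Lg ^+ 2 * enorm (w - w') ^+ 2 = (2 * Lg * enorm (w - w')) ^+ 2 by ring.
  rewrite ler_sqr ?nnegrE ?enorm_ge0//; last by rewrite !mulr_ge0 ?enorm_ge0// ltW.
  rewrite /pen_gx -linearB; apply: le_trans (enorm_lsubmx _) _.
  apply: le_trans (pen_grad_lip BA _ _ s'0) _.
  rewrite sub_row_mx subrr enorm_row_0mx ler_wpM2r ?enorm_ge0// /Lpen.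
  by rewrite mulr2n mulrDl mul1r lerD2r.
have si : 0 < s^-1 by rewrite invr_gt0.
rewrite enormZ (gtr0_norm si) exprMn.
have e2 := enorm_sum2 (pen_gx f g s x y - pen_gx f g s x y') (- (pen_gx f g 0 x z - pen_gx f g 0 x z')).
rewrite enormN in e2.
have h1 := lipx s y y' (ltW s0) sLf.
have h2 : enorm (pen_gx f g 0 x z - pen_gx f g 0 x z') ^+ 2 <= 4 * Lg ^+ 2 * enorm (z - z') ^+ 2.
  by apply: lipx; rewrite ?mul0r// ltW.
have L40 : 0 <= 4 * Lg ^+ 2 by rewrite mulr_ge0// sqr_ge0.
have h3 := ler_wpM2l L40 ley; have h4 := ler_wpM2l L40 lez.
have h5 := le_trans h1 h3; have h6 := le_trans h2 h4.
have s2 : 0 <= s^-1 ^+ 2 by exact: sqr_ge0.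
apply: (@le_trans _ _ (s^-1 ^+ 2 * (2 * (4 * Lg ^+ 2 * (8 / mu * (pen f g s (row_mx x y) - pen_min f g s x))) +
   2 * (4 * Lg ^+ 2 * (8 / mu * (pen f g 0 (row_mx x z) - pen_min f g 0 x)))))).
  rewrite ler_wpM2l//; apply: (le_trans e2); apply: lerD; rewrite ler_pM2l//.
set A := pen f g s _ - _; set C := pen f g 0 _ - _.
by rewrite le_eqVlt; apply/orP; left; apply/eqP; field; rewrite !gt_eqF.
Qed.

End Hypergradient.

(** * Measurability and fresh samples *)

(** Coordinatewise, so that the source can be given any sub-sigma-algebra while no sigma-algebra on
    row vectors is involved. *)
Definition measurable_vec (R : realType) (d : measure_display) (T : measurableType d)
    (n : nat) (v : T -> 'rV[R]_n) : Prop :=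
  forall i, measurable_fun setT (fun t => v t 0 i).

Section Caratheodory.
Context (R : realType) (d dS : measure_display) (T : measurableType d) (S : measurableType dS).
Context (n : nat).
Implicit Types (F : 'rV[R]_n -> S -> R) (v : T -> 'rV[R]_n) (s : T -> S).

Let grid (k : nat) (p : 'rV[R]_n) : 'rV[int]_n := \row_i Num.floor (k.+1%:R * p 0 i).
Let ungrid (k : nat) (q : 'rV[int]_n) : 'rV[R]_n := \row_i ((q 0 i)%:~R / k.+1%:R).

Let ungridK k p : `|p - ungrid k (grid k p)| <= k.+1%:R^-1.
Proof.
rewrite [leLHS]mx_normrE bigmax_le ?invr_ge0// => -[i j] _; rewrite !mxE ord1.
set x := p 0 j; have k0 : (0 : R) < k.+1%:R by rewrite ltr0n.
have /andP[h1 h2] := floor_itv (k.+1%:R * x); move: h1 h2.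
set z := (Num.floor _)%:~R; rewrite intrD => h1 h2.
have -> : x - z / k.+1%:R = (k.+1%:R * x - z) / k.+1%:R.
  by rewrite mulrBl mulrAC mulfV ?mul1r// gt_eqF.
rewrite normrM normfV (ger0_norm (ltW k0)) ler_pdivrMr// mulVf ?gt_eqF//.
by rewrite ger0_norm ?subr_ge0// lerBlDr addrC ltW.
Qed.

Let measurable_grid k v q : measurable_vec v -> measurable [set t | grid k (v t) = q].
Proof.
move=> mv.
have -> : [set t | grid k (v t) = q] = \bigcap_(i in [set: 'I_n])
    [set t | Num.floor (k.+1%:R * v t 0 i) = q 0 i].
  apply/seteqP; split => t /=.
    by move=> /rowP + i _ => /(_ i); rewrite mxE.
  by move=> H; apply/rowP => i; rewrite mxE; exact: H.
apply: fin_bigcap_measurable => // i _.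
have k0 : (0 : R) < k.+1%:R by rewrite ltr0n.
have -> : [set t | Num.floor (k.+1%:R * v t 0 i) = q 0 i] =
    (fun t => v t 0 i) @^-1` `[(q 0 i)%:~R / k.+1%:R, (q 0 i + 1)%:~R / k.+1%:R[.
  apply/seteqP; split => t /=; rewrite in_itv /= ler_pdivrMr// ltr_pdivlMr// (mulrC _ k.+1%:R).
    by move=> <-; rewrite floor_le floorD1_gt.
  by move=> h; apply: floor_def.
by rewrite -[X in measurable X]setTI; apply: (mv i).
Qed.

(** v is rounded down to the lattice of mesh 1/(k+1), a countable set of values. On each cell the
    composition is F p after s, and continuity in p passes to the limit in k. *)
Lemma measurable_caratheodory F v s :
  (forall p, measurable_fun setT (F p)) -> (forall t, continuous (F^~ t)) ->
  measurable_vec v -> measurable_fun setT s -> measurable_fun setT (fun t => F (v t) (s t)).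
Proof.
move=> mF cF mv ms.
apply: (@measurable_fun_cvg _ _ _ _ (fun k t => F (ungrid k (grid k (v t))) (s t))).
  move=> k _ A mA; rewrite setTI.
  have -> : (fun t => F (ungrid k (grid k (v t))) (s t)) @^-1` A =
      \bigcup_q ([set t | grid k (v t) = q] `&` (fun t => F (ungrid k q) (s t)) @^-1` A).
    apply/seteqP; split => t /=; first by move=> At; exists (grid k (v t)).
    by move=> [q _ [/= <-]].
  apply: countable_bigcupT_measurable => //.
  move=> q; apply: measurableI; first exact: measurable_grid.
  rewrite -[X in measurable X]setTI.
  by apply: (measurableT_comp (mF (ungrid k q)) ms).
move=> t _; apply: (@cvg_comp _ _ _ (fun k => ungrid k (grid k (v t))) (F^~ (s t)) _ (nbhs (v t))).
  have H := @cvg_harmonic R; move/(@cvgrPdist_le R R^o) : H => H.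
  apply/(@cvgrPdist_le R 'rV[R]_n) => e /H{}H; near=> k.
  apply: le_trans (ungridK k (v t)) _.
  have : `|0 - harmonic k| <= e :> R by near: k.
  by rewrite sub0r normrN /harmonic /= ger0_norm ?invr_ge0.
exact: cF.
Unshelve. all: by end_near. Qed.

(** A partial derivative is a pointwise limit of difference quotients along 1/(k+1). Asking only for
    derivability in the given direction lets the lemma apply to [phi] as well. *)
Lemma measurable_partial_comp F v s i :
  (forall p, measurable_fun setT (F p)) -> (forall t, continuous (F^~ t)) ->
  (forall t p, derivable (F^~ t) p (delta_mx 0 i)) ->
  measurable_vec v -> measurable_fun setT s ->
  measurable_fun setT (fun t => grad (F^~ (s t)) (v t) 0 i).
Proof.
move=> mF cF dF mv ms.
have cvg0 : (fun k => @harmonic R k) @ \oo --> 0^'.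
  move=> A [e /= e0 eA].
  have := @cvg_harmonic R; move/(@cvgrPdist_lt R R^o) => /(_ e e0) [N _ NH].
  exists N => // k Nk; apply: eA; first exact: NH.
  by rewrite /harmonic /= invr_eq0 pnatr_eq0.
apply: (@measurable_fun_cvg _ _ _ _ (fun k t => (harmonic k)^-1 *
    (F (harmonic k *: delta_mx 0 i + v t) (s t) - F (v t) (s t)))).
  move=> k; apply: measurable_funM => //; apply: measurable_funB.
    apply: measurable_caratheodory => // j; under eq_fun do rewrite mxE.
    by apply: measurable_funD => //; exact: mv.
  exact: measurable_caratheodory.
move=> t _; rewrite mxE.
have /cvg_ex[l dl] := dF (s t) (v t).
have -> : 'D_(delta_mx 0 i) (F^~ (s t)) (v t) = l by exact: cvg_lim dl.
exact: (cvg_comp _ _ cvg0 dl).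
Qed.

Lemma measurable_grad_comp F v s i :
  (forall p, measurable_fun setT (F p)) -> (forall t p, differentiable (F^~ t) p) ->
  measurable_vec v -> measurable_fun setT s ->
  measurable_fun setT (fun t => grad (F^~ (s t)) (v t) 0 i).
Proof.
move=> mF dF; apply: measurable_partial_comp => // t p.
  exact: differentiable_continuous.
exact: diff_derivable.
Qed.

Lemma measurable_enorm2 (v : T -> 'rV[R]_n) : measurable_vec v ->
  measurable_fun setT (fun t => enorm (v t) ^+ 2).
Proof.
move=> mv; rewrite (_ : (fun _ => _) = (fun t => \sum_(i < n) v t 0 i * v t 0 i)).
  by apply: measurable_sum => i; apply: measurable_funM; exact: mv.
by apply/funext => t; rewrite -dot_sqr.
Qed.

End Caratheodory.

(** * A sample independent of a sigma-algebra *)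

Section Fresh.
Context (R : realType) (dO dS : measure_display) (Om : measurableType dO) (S : measurableType dS).
Context (P : probability Om R) (D : probability S R) (s : Om -> S) (G : set (set Om)).

(** G generates the information relative to which s is fresh. The product rule is stated with D, so
    that E = setT gives the law of s. *)
Definition independent_of : Prop :=
  [/\ measurable_fun setT s, <<s G >> `<=` measurable &
      forall E A, <<s G >> E -> measurable A -> (P (E `&` s @^-1` A) = P E * D A)%E].

Hypothesis indep : independent_of.
Local Notation OmG := (g_sigma_algebraType G).

Let idG : Om -> OmG := id.
Let midG : measurable_fun setT idG.
Proof. by have [_ sub _] := indep => _ A mA; rewrite setTI; exact: sub. Qed.
Let pair_s : Om -> OmG * S := fun w => (w, s w).
Let mpair : measurable_fun setT pair_s.
Proof. by have [ms _ _] := indep; apply: measurable_fun_pair. Qed.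

Let idG_mixin := isMeasurableFun.Build _ _ _ _ _ midG.
Let idG_pack : {mfun Om >-> OmG} := HB.pack idG idG_mixin.
Let pair_mixin := isMeasurableFun.Build _ _ _ _ _ mpair.
Let pair_pack : {mfun Om >-> (OmG * S)%type} := HB.pack pair_s pair_mixin.

Lemma measurable_of_sub d' (T' : measurableType d') (h : Om -> T') :
  measurable_fun setT (h : OmG -> T') -> measurable_fun setT h.
Proof. by move=> mh; apply: (measurableT_comp mh midG). Qed.

(* The law of the pair (past, fresh sample) is a product measure. *)
Lemma fresh_integral (Phi : OmG * S -> \bar R) :
  measurable_fun setT Phi -> (forall z, 0 <= Phi z)%E ->
  (\int[P]_w Phi (w, s w) = \int[P]_w \int[D]_x Phi (w, x))%E.
Proof.
move=> mPhi Phi0.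
have -> : (\int[P]_w Phi (w, s w) = \int[distribution P pair_pack]_z Phi z)%E.
  by rewrite ge0_integral_distribution.
have -> : (\int[distribution P pair_pack]_z Phi z =
    \int[distribution P idG_pack \x D]_z Phi z)%E.
  apply: eq_measure_integral => A mA _; apply/esym; apply: product_measure_unique => // E B mE mB.
  have [_ _ ind] := indep; exact: ind.
rewrite fubini_tonelli1// ge0_integral_distribution//.
  exact: measurable_fun_fubini_tonelli_F.
by move=> y; apply: integral_ge0 => x _.
Qed.

Lemma fresh_integral_measurable (Phi : OmG * S -> \bar R) :
  measurable_fun setT Phi -> (forall z, 0 <= Phi z)%E ->
  measurable_fun setT ((fun w => \int[D]_x Phi (w, x))%E : OmG -> \bar R).
Proof. by move=> mPhi Phi0; exact: measurable_fun_fubini_tonelli_F. Qed.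

End Fresh.

Lemma le_of_eq_le (R : realType) (x y z : \bar R) : x = y -> (y <= z)%E -> (x <= z)%E.
Proof. by move=> ->. Qed.

(** * Second moments of minibatch noise *)

Section Oracle.
Context (R : realType) (n : nat) (dS : measure_display) (S : measurableType dS).
Context (D : probability S R) (M : R) (h : 'rV[R]_n -> R) (F : 'rV[R]_n -> S -> R).
Hypothesis orc : stochastic_oracle D M h F.

Definition noise (p : 'rV[R]_n) (x : S) : 'rV[R]_n := grad (F^~ x) p - grad h p.

Let noise_centered c p :
  D.-integrable setT (EFin \o (fun x => dot c (noise p x))) /\
  (\int[D]_x (dot c (noise p x))%:E = 0)%E.
Proof.
pose cent (X : S -> R) := D.-integrable setT (EFin \o X) /\ (\int[D]_x (X x)%:E = 0)%E.
suff : cent (\sum_(i < n) (fun x => c 0 i * noise p x 0 i)).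
  rewrite (_ : \sum_(i < n) _ = (fun x => dot c (noise p x)))//.
  by apply/funext => x; rewrite fct_sumE.
apply: (big_ind cent) => [|X Y [iX eX] [iY eY]|i _].
- split; first exact: integrable0.
  by rewrite integral0.
- rewrite /cent (_ : EFin \o (X + Y) = ((EFin \o X) \+ (EFin \o Y))%E)//.
  split; first exact: integrableD.
  by have := integralD_EFin measurableT iX iY; rewrite /= eX eY adde0.
- have iG := so_grad_integrable orc p i.
  have ic : D.-integrable setT (EFin \o (fun _ : S => grad h p 0 i)).
    exact: finite_measure_integrable_cst.
  have iN : D.-integrable setT (EFin \o (fun x => noise p x 0 i)).
    rewrite (_ : _ \o _ = ((EFin \o (fun s => (grad (F^~ s) p 0 i)%R)) \-
       (EFin \o (fun _ : S => (grad h p 0 i)%R)))%E); first exact: integrableB.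
    by apply/funext => x /=; rewrite !mxE.
  split; first by have := integrableZl measurableT (c 0 i) iN.
  transitivity ((c 0 i)%:E * \int[D]_x (noise p x 0 i)%:E)%E.
    by rewrite -integralZl.
  rewrite (_ : \int[D]_x _ = 0)%E ?mule0//.
  transitivity (\int[D]_x ((EFin \o (fun s => (grad (F^~ s) p 0 i)%R)) \-
       (EFin \o (fun _ : S => (grad h p 0 i)%R))) x)%E.
    by apply: eq_integral => x _ /=; rewrite !mxE.
  rewrite integralB//.
  have := so_grad_mean orc p i; rewrite unlock => ->.
  have := expectation_cst D (grad h p 0 i); rewrite unlock => ->.
  by rewrite subee.
Qed.

(** The cross term integrates to zero because the noise is centred, so the two squares add without a
    factor 2. *)
Lemma noise_second_moment c p :
  (\int[D]_x (enorm (c + noise p x) ^+ 2)%:E <= (enorm c ^+ 2 + M ^+ 2)%:E)%E.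
Proof.
have [ic ec] := noise_centered (2 *: c) p.
have mN : measurable_fun setT (fun x => enorm (noise p x) ^+ 2).
  apply: measurable_enorm2 => i; rewrite /noise; under eq_fun do rewrite mxE [X in _ + X]mxE.
  apply: measurable_funB => //.
  by have /integrableP[/measurable_EFinP] := so_grad_integrable orc p i.
have vN := so_grad_var orc p; rewrite unlock in vN.
have iN : D.-integrable setT (EFin \o (fun x => enorm (noise p x) ^+ 2)).
  apply/integrableP; split; first exact/measurable_EFinP.
  apply: le_lt_trans (ltry (M ^+ 2)); apply: le_trans vN.
  rewrite le_eqVlt; apply/orP; left; apply/eqP; apply: eq_integral => x _ /=.
  by rewrite ger0_norm ?sqr_ge0.
have i1 : D.-integrable setT (EFin \o (fun x => dot (2 *: c) (noise p x) + enorm c ^+ 2)).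
  have i2 : D.-integrable setT (EFin \o (fun _ : S => enorm c ^+ 2)).
    exact: finite_measure_integrable_cst.
  by have := integrableD measurableT ic i2.
apply: (@le_of_eq_le _ _ (\int[D]_x ((EFin \o (fun x => (dot (2 *: c) (noise p x) + enorm c ^+ 2)%R)) \+
    (EFin \o (fun x => (enorm (noise p x) ^+ 2)%R))) x)%E).
  apply: eq_integral => x _ /=; rewrite enorm_sqrD dotZl -EFinD; congr (_%:E); ring.
rewrite integralD_EFin//.
have i2 : D.-integrable setT (EFin \o (fun _ : S => enorm c ^+ 2)).
  exact: finite_measure_integrable_cst.
have := integralD_EFin measurableT ic i2.
rewrite /= ec.
have := expectation_cst D (enorm c ^+ 2); rewrite unlock => ->; rewrite add0e => ->.
by rewrite EFinD; apply: leeD.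
Qed.

Lemma measurable_noise (d : measure_display) (T : measurableType d) (v : T -> 'rV[R]_n) (s : T -> S) :
  (forall p, differentiable h p) -> measurable_vec v -> measurable_fun setT s ->
  measurable_vec (fun t => noise (v t) (s t)).
Proof.
move=> dh mv ms i; rewrite (_ : (fun _ => _) =
    (fun t => grad (F^~ (s t)) (v t) 0 i - grad h (v t) 0 i)).
  apply: measurable_funB.
    apply: measurable_grad_comp => // [p|t p]; last exact: so_differentiable orc _ _.
    by have /integrableP[/measurable_EFinP] := so_integrable orc p.
  exact: (measurable_grad_comp (F := fun p _ => h p) _ _ _ mv ms).
by apply/funext => t; rewrite !mxE.
Qed.

Context (dO : measure_display) (Om : measurableType dO) (P : probability Om R).
Hypothesis dh : forall p, differentiable h p.

Definition measurable_wrt (G : set (set Om)) d' (T' : measurableType d') (u : Om -> T') : Prop :=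
  measurable_fun setT (u : g_sigma_algebraType G -> T').
Definition measurable_vec_wrt (G : set (set Om)) m (u : Om -> 'rV[R]_m) : Prop :=
  @measurable_vec R _ (g_sigma_algebraType G) m u.

Variables (B : nat) (s : nat -> Om -> S) (G : nat -> set (set Om)).
Variables (v : Om -> 'rV[R]_n) (W : Om -> R).
Hypothesis W0 : forall w, 0 <= W w.
Hypothesis ind : forall i, (i < B)%N -> independent_of P D (s i) (G i).
Hypothesis mv : forall i, (i < B)%N -> measurable_vec_wrt (G i) v.
Hypothesis mW : forall i, (i < B)%N -> measurable_wrt (G i) W.
Hypothesis ms : forall i j, (j < i < B)%N -> measurable_wrt (G i) (s j).

Let S_ m w := \sum_(i < m) noise (v w) (s i w).

(* Conditionally on the other samples the last one adds a centred increment,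
   so second moments add up. *)
Lemma batch_noise_sum m : (m <= B)%N ->
  (\int[P]_w (W w * enorm (S_ m w) ^+ 2)%:E <= (m%:R * M ^+ 2)%:E * \int[P]_w (W w)%:E)%E.
Proof.
elim: m => [_|m IH mB].
  rewrite mul0r mul0e; rewrite integral0_eq// => w _.
  by rewrite /S_ big_ord0 enorm0 expr0n mulr0.
have indm := ind mB; have mvm := mv mB; have mWm := mW mB.
have msm : measurable_vec_wrt (G m) (S_ m).
  move=> i; rewrite /S_; under eq_fun do rewrite summxE.
  apply: measurable_sum => j; apply: measurable_noise => //.
  by apply: ms; rewrite ltn_ord.
pose Phi (z : g_sigma_algebraType (G m) * S) : \bar R :=
  (W z.1 * enorm (S_ m z.1 + noise (v z.1) z.2) ^+ 2)%:E.
have mN : measurable_fun setT (fun z : g_sigma_algebraType (G m) * S =>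
    enorm (S_ m z.1 + noise (v z.1) z.2) ^+ 2).
  apply: measurable_enorm2 => i.
  under eq_fun do rewrite mxE.
  apply: measurable_funD; first exact: (measurableT_comp (msm i) measurable_fst).
  have mv1 : measurable_vec (fun z : g_sigma_algebraType (G m) * S => v z.1).
    by move=> j; exact: (measurableT_comp (mvm j) measurable_fst).
  exact: (measurable_noise dh mv1 measurable_snd).
have mPhi : measurable_fun setT Phi.
  apply/measurable_EFinP; apply: measurable_funM => //.
  exact: (measurableT_comp mWm measurable_fst).
have Phi0 z : (0 <= Phi z)%E by rewrite lee_fin mulr_ge0// sqr_ge0.
have mWO : measurable_fun setT W by exact: (measurable_of_sub indm mWm).
have mS2 : measurable_fun setT (fun w => enorm (S_ m w) ^+ 2).
  apply: measurable_enorm2 => i; exact: (measurable_of_sub indm (msm i)).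
apply: (@le_of_eq_le _ _ (\int[P]_w Phi (w, s m w))%E).
  by apply: eq_integral => w _; rewrite /Phi /S_ /= big_ord_recr.
rewrite (fresh_integral indm mPhi Phi0).
apply: (@le_trans _ _ (\int[P]_w ((W w * enorm (S_ m w) ^+ 2)%:E + (M ^+ 2)%:E * (W w)%:E))%E).
  apply: ge0_le_integral => //.
  - by move=> w _; apply: integral_ge0 => x _.
  - exact: (measurable_of_sub indm (fresh_integral_measurable D mPhi Phi0)).
  - apply: emeasurable_funD; first by apply/measurable_EFinP; exact: measurable_funM.
    by apply/measurable_EFinP; apply: measurable_funM.
  - move=> w _; rewrite /Phi /=.
    under eq_integral do rewrite EFinM.
    rewrite ge0_integralZl_EFin//; last 2 first.
    - by move=> x _; rewrite lee_fin sqr_ge0.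
    - apply/measurable_EFinP.
      have mp : measurable_fun setT (fun x : S => ((w, x) : g_sigma_algebraType (G m) * S)).
        exact: measurable_fun_pair.
      exact: (measurableT_comp mN mp).
    apply: le_trans (lee_wpmul2l _ (noise_second_moment (S_ m w) (v w))) _.
      by rewrite lee_fin.
    by rewrite -!EFinM -EFinD lee_fin mulrDr (mulrC (M ^+ 2)).
rewrite ge0_integralD//; last 4 first.
- by move=> w _; rewrite lee_fin mulr_ge0// sqr_ge0.
- by apply/measurable_EFinP; exact: measurable_funM.
- by move=> w _; rewrite -EFinM lee_fin mulr_ge0// sqr_ge0.
- by apply/measurable_EFinP; apply: measurable_funM.
rewrite ge0_integralZl_EFin ?sqr_ge0//; last 2 first.
- by move=> w _; rewrite lee_fin.
- exact/measurable_EFinP.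
have M20 := sqr_ge0 M.
rewrite -natr1 mulrDl mul1r EFinD ge0_muleDl ?lee_fin ?(mulr_ge0 (ler0n _ m) M20)//.
by apply: leeD => //; apply: IH; exact: ltnW.
Qed.

(** W stands in for conditioning: it is later the constant 1 or the indicator that the inner count
    equals j. *)
Lemma minibatch_noise : (0 < B)%N ->
  (\int[P]_w (W w * enorm (minibatch F B (s^~ w) (v w) - grad h (v w)) ^+ 2)%:E <=
   (M ^+ 2 / B%:R)%:E * \int[P]_w (W w)%:E)%E.
Proof.
move=> B0; have Br : 0 < B%:R :> R by rewrite ltr0n.
have E w : minibatch F B (s^~ w) (v w) - grad h (v w) = B%:R^-1 *: S_ B w.
  rewrite /minibatch /S_ /noise sumrB scalerBr sumr_const card_ord -[grad h (v w) *+ B]scaler_nat.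
  by rewrite scalerA mulVf ?gt_eqF// scale1r.
have Bi : 0 <= B%:R^-1 :> R by rewrite invr_ge0 ltW.
have mWO : measurable_fun setT W by exact: (measurable_of_sub (ind B0) (mW B0)).
have mS2 : measurable_fun setT (fun w => enorm (S_ B w) ^+ 2).
  apply: measurable_enorm2 => i; rewrite /S_; under eq_fun do rewrite summxE.
  apply: measurable_sum => j; apply: measurable_noise => //.
    by move=> k; exact: (measurable_of_sub (ind B0) (mv B0 k)).
  by have [] := ind (ltn_ord j).
apply: (@le_of_eq_le _ _ (\int[P]_w ((B%:R^-1 ^+ 2)%:E * (W w * enorm (S_ B w) ^+ 2)%:E))%E).
  apply: eq_integral => w _; rewrite E enormZ ger0_norm// -EFinM; congr (_%:E).
  by rewrite exprMn mulrCA.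
rewrite ge0_integralZl_EFin ?sqr_ge0//; last 2 first.
- by move=> w _; rewrite lee_fin mulr_ge0// sqr_ge0.
- by apply/measurable_EFinP; exact: measurable_funM.
have c0 : (0 <= (B%:R^-1 ^+ 2 : R)%:E)%E by rewrite lee_fin sqr_ge0.
apply: le_trans (lee_wpmul2l c0 (batch_noise_sum (leqnn B))) _.
rewrite muleA -EFinM.
have -> : B%:R^-1 ^+ 2 * (B%:R * M ^+ 2) = M ^+ 2 / B%:R by field; rewrite gt_eqF.
exact: lexx.
Qed.

End Oracle.

(** * The information carried by a set of samples *)

Section Cylinders.
Context (R : realType) (I J : choiceType) (dO dX dZ : measure_display).
Context (Om : measurableType dO) (X : measurableType dX) (Z : measurableType dZ).
Context (P : probability Om R) (DX : probability X R) (DZ : probability Z R).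
Context (xi : I -> Om -> X) (zeta : J -> Om -> Z).
Hypothesis fresh : fresh_samples P DX DZ xi zeta.

Definition cylinder (s : seq I) (u : seq J) (A : I -> set X) (C : J -> set Z) : set Om :=
  (\bigcap_(i in [set` s]) (xi i @^-1` A i)) `&` (\bigcap_(j in [set` u]) (zeta j @^-1` C j)).

(** A pi-system generating the information in the samples with labels in Lx and Lz. Closure under
    intersection is what lets the finite product rule extend to the sigma-algebra. *)
Definition cylinders (Lx : set I) (Lz : set J) : set (set Om) :=
  [set E | exists s u A C, [/\ uniq s, uniq u, [set` s] `<=` Lx & [set` u] `<=` Lz] /\
     [/\ forall i, measurable (A i), forall j, measurable (C j) & E = cylinder s u A C]].

Lemma cylinder_measurable s u A C : (forall i, measurable (A i)) ->
  (forall j, measurable (C j)) -> measurable (cylinder s u A C).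
Proof.
move=> mA mC; apply: measurableI; apply: fin_bigcap_measurable => // i _.
  by rewrite -[X in measurable X]setTI; apply: (fs_xi_meas fresh).
by rewrite -[X in measurable X]setTI; apply: (fs_zeta_meas fresh).
Qed.

Lemma cylinders_measurable Lx Lz : cylinders Lx Lz `<=` measurable.
Proof. by move=> E [s [u [A [C [_ [mA mC ->]]]]]]; exact: cylinder_measurable. Qed.

Lemma cylinders_setT Lx Lz : cylinders Lx Lz setT.
Proof.
exists [::], [::], (fun=> setT), (fun=> setT); split; first by split.
by split => //; apply/seteqP; split.
Qed.

Lemma cylinders_setI Lx Lz : setI_closed (cylinders Lx Lz).
Proof.
move=> E E' [s [u [A [C [[us uu sL uL] [mA mC ->]]]]]].
move=> [s' [u' [A' [C' [[us' uu' sL' uL'] [mA' mC' ->]]]]]].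
exists (undup (s ++ s')), (undup (u ++ u')).
(* A label constrained by only one of the two cylinders gets the trivial constraint [setT] from the
   other. *)
exists (fun i => (if i \in s then A i else setT) `&` (if i \in s' then A' i else setT)).
exists (fun j => (if j \in u then C j else setT) `&` (if j \in u' then C' j else setT)).
split; first split; rewrite ?undup_uniq//.
- by move=> i /=; rewrite mem_undup mem_cat => /orP[/sL|/sL'].
- by move=> i /=; rewrite mem_undup mem_cat => /orP[/uL|/uL'].
split.
- by move=> i; apply: measurableI; case: ifP.
- by move=> i; apply: measurableI; case: ifP.
apply/seteqP; split => w.
  move=> [[h1 h2] [h3 h4]]; split => i /=; rewrite mem_undup mem_cat => _; split.
  - by case: ifP => // /h1.
  - by case: ifP => // /h3.
  - by case: ifP => // /h2.
  - by case: ifP => // /h4.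
move=> [h1 h2]; split; split => i /= iin.
- by have := h1 i; rewrite /= mem_undup mem_cat iin => /(_ isT)[].
- by have := h2 i; rewrite /= mem_undup mem_cat iin => /(_ isT)[].
- by have := h1 i; rewrite /= mem_undup mem_cat iin orbT => /(_ isT)[].
- by have := h2 i; rewrite /= mem_undup mem_cat iin orbT => /(_ isT)[].
Qed.

(** For fixed A both sides are finite measures in E; they agree on the pi-system, hence on the
    sigma-algebra it generates. *)
Lemma cylinders_independent (Lx : set I) (Lz : set J) dS (S : measurableType dS)
    (D : probability S R) (s : Om -> S) :
  measurable_fun setT s ->
  (forall E A, cylinders Lx Lz E -> measurable A -> (P (E `&` s @^-1` A) = P E * D A)%E) ->
  independent_of P D s (cylinders Lx Lz).
Proof.
move=> ms H; split=> //.
  apply: smallest_sub; [exact: sigma_algebra_measurable|exact: cylinders_measurable].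
move=> E A EG mA.
have msA : measurable (s @^-1` A) by rewrite -[X in measurable X]setTI; exact: ms.
have DA0 : (0 <= fine (D A))%R by apply: fine_ge0.
have DAE : ((fine (D A))%:E = D A)%E by rewrite fineK// fin_num_measure.
pose m2 : {measure set Om -> \bar R} := mscale (NngNum DA0) P.
pose m1 : {measure set Om -> \bar R} := mrestr P msA.
have m2E B : m2 B = (D A * P B)%E by rewrite -[in RHS]DAE.
suff : m1 E = m2 E by rewrite m2E muleC.
apply: (@g_sigma_algebra_measure_unique _ _ _ (cylinders Lx Lz) (@cylinders_measurable Lx Lz)
   (fun=> setT)) => //.
- by move=> _; exact: cylinders_setT.
- by rewrite bigcup_const//; exists 0%N.
- exact: cylinders_setI.
- by move=> B GB; rewrite m2E muleC -H.
- move=> _; apply: le_lt_trans (ltry 1); rewrite /m1 /mrestr /=.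
  by apply: probability_le1; exact: measurableI.
Qed.

Lemma prob_cylinder s u A C : uniq s -> uniq u -> (forall i, measurable (A i)) ->
  (forall j, measurable (C j)) -> P (cylinder s u A C) =
  ((\prod_(i <- s) fine (P (xi i @^-1` A i))) *
    (\prod_(j <- u) fine (P (zeta j @^-1` C j))))%:E.
Proof.
move=> us uu mA mC; rewrite -(fs_indep fresh)// fineK// fin_num_measure//.
exact: cylinder_measurable.
Qed.

Lemma xi_independent (a : I) :
  independent_of P DX (xi a) (cylinders [set i | i != a] setT).
Proof.
apply: cylinders_independent; first exact: (fs_xi_meas fresh).
move=> _ B [s [u [A [C [[us uu sL _] [mA mC ->]]]]]] mB.
have as_ : a \notin s by apply/negP => /sL /=; rewrite eqxx.
pose A' i := if i == a then B else A i.
have mA' i : measurable (A' i) by rewrite /A'; case: ifP.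
have AA' i : i \in s -> A' i = A i.
  by rewrite /A'; case: eqP => // ->; rewrite (negbTE as_).
have -> : cylinder s u A C `&` xi a @^-1` B = cylinder (a :: s) u A' C.
  apply/seteqP; split => w.
    move=> [[h1 h2] h3]; split => // i /=; rewrite inE => /orP[/eqP->|si].
      by rewrite /A' eqxx.
    by rewrite /preimage /= AA'//; exact: h1.
  move=> [h1 h2]; split; first split => // i /= si.
    by have := h1 i; rewrite /= inE si orbT /preimage /= AA'//; apply.
  by have := h1 a; rewrite /= inE eqxx /preimage /= /A' eqxx; apply.
rewrite !prob_cylinder//; last by rewrite /= as_.
have eA : \prod_(i <- s) fine (P (xi i @^-1` A' i)) = \prod_(i <- s) fine (P (xi i @^-1` A i)).
  by apply: eq_big_seq => i si; rewrite AA'.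
rewrite big_cons eA {1}/A' eqxx (fs_xi_law fresh)// -[DX B]fineK ?fin_num_measure// -EFinM.
by congr (_%:E); rewrite /=; ring.
Qed.

Lemma xi_measurable_wrt Lx Lz i : Lx i -> measurable_wrt (cylinders Lx Lz) (xi i).
Proof.
move=> Li _ A mA; rewrite setTI; apply: sub_sigma_algebra.
exists [:: i], [::], (fun=> A), (fun=> setT); split.
  by split => // j /=; rewrite inE => /eqP ->.
split => //; apply/seteqP; split => w.
  by move=> h; split => // j /=; rewrite inE => /eqP ->.
by move=> [h _]; apply: h; rewrite /= inE.
Qed.

End Cylinders.

Section Swap.
Context (R : realType) (I J : choiceType) (dO dX dZ : measure_display).
Context (Om : measurableType dO) (X : measurableType dX) (Z : measurableType dZ).
Context (P : probability Om R) (DX : probability X R) (DZ : probability Z R).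
Context (xi : I -> Om -> X) (zeta : J -> Om -> Z).

(** The two families play symmetric roles, so each result on xi transfers to zeta. *)
Lemma fresh_samplesC : fresh_samples P DX DZ xi zeta -> fresh_samples P DZ DX zeta xi.
Proof. by case=> *; split=> // *; rewrite setIC mulrC; auto. Qed.

Lemma cylindersC Lx Lz : cylinders xi zeta Lx Lz = cylinders zeta xi Lz Lx.
Proof.
apply/seteqP; split => _ [s [u [A [C [[us uu sL uL] [mA mC ->]]]]]];
  by exists u, s, C, A; split => //; split => //; rewrite /cylinder setIC.
Qed.

Lemma zeta_independent (a : J) : fresh_samples P DX DZ xi zeta ->
  independent_of P DZ (zeta a) (cylinders xi zeta setT [set j | j != a]).
Proof. by move=> fresh; rewrite cylindersC; exact: xi_independent (fresh_samplesC fresh) a. Qed.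

Lemma zeta_measurable_wrt Lx Lz j : Lz j ->
  measurable_wrt (cylinders xi zeta Lx Lz) (zeta j).
Proof. by rewrite cylindersC; exact: xi_measurable_wrt. Qed.

End Swap.

Section MeasurableVec.
Context (R : realType) (d : measure_display) (T : measurableType d).

Lemma measurable_vecD n (u v : T -> 'rV[R]_n) :
  measurable_vec u -> measurable_vec v -> measurable_vec (fun t => u t + v t).
Proof. by move=> mu mv i; under eq_fun do rewrite mxE; exact: measurable_funD. Qed.

Lemma measurable_vecB n (u v : T -> 'rV[R]_n) :
  measurable_vec u -> measurable_vec v -> measurable_vec (fun t => u t - v t).
Proof. by move=> mu mv i; under eq_fun do rewrite !mxE; exact: measurable_funB. Qed.

Lemma measurable_vecZ n (a : R) (u : T -> 'rV[R]_n) :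
  measurable_vec u -> measurable_vec (fun t => a *: u t).
Proof. by move=> mu i; under eq_fun do rewrite mxE; exact: measurable_funM. Qed.

Lemma measurable_vec_cst n (p : 'rV[R]_n) : measurable_vec (fun _ : T => p).
Proof. by move=> i; exact: measurable_cst. Qed.

Lemma measurable_vec_row m n (u : T -> 'rV[R]_m) (v : T -> 'rV[R]_n) :
  measurable_vec u -> measurable_vec v -> measurable_vec (fun t => row_mx (u t) (v t)).
Proof.
move=> mu mv i; case: (split_ordP i) => j ->.
  by under eq_fun do rewrite row_mxEl; exact: mu.
by under eq_fun do rewrite row_mxEr; exact: mv.
Qed.

Lemma measurable_vec_lsub m n (u : T -> 'rV[R]_(m + n)) :
  measurable_vec u -> measurable_vec (fun t => lsubmx (u t)).
Proof. by move=> mu i; under eq_fun do rewrite mxE; exact: mu. Qed.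

Lemma measurable_vec_rsub m n (u : T -> 'rV[R]_(m + n)) :
  measurable_vec u -> measurable_vec (fun t => rsubmx (u t)).
Proof. by move=> mu i; under eq_fun do rewrite mxE; exact: mu. Qed.

Lemma measurable_vec_nat n (u : nat -> T -> 'rV[R]_n) (N : T -> nat) :
  (forall k, measurable_vec (u k)) -> (forall k, measurable [set t | N t = k]) ->
  measurable_vec (fun t => u (N t) t).
Proof.
move=> mu mN i _ A mA; rewrite setTI.
have -> : (fun t => u (N t) t 0 i) @^-1` A =
    \bigcup_k ([set t | N t = k] `&` (fun t => u k t 0 i) @^-1` A).
  apply/seteqP; split => t /=; first by exists (N t).
  by move=> [k _ [/= <-]].
apply: bigcupT_measurable => k; apply: measurableI => //.
by rewrite -[X in measurable X]setTI; exact: mu.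
Qed.

Lemma measurable_minibatch n dS (S : measurableType dS) (F : 'rV[R]_n -> S -> R)
    (B : nat) (s : nat -> T -> S) (v : T -> 'rV[R]_n) :
  (forall p, measurable_fun setT (F p)) -> (forall t p, differentiable (F^~ t) p) ->
  (forall i, measurable_fun setT (s i)) -> measurable_vec v ->
  measurable_vec (fun t => minibatch F B (s^~ t) (v t)).
Proof.
move=> mF dF ms mv; apply: measurable_vecZ => i; under eq_fun do rewrite summxE.
by apply: measurable_sum => j; exact: measurable_grad_comp.
Qed.

Lemma measurable_enorm n (u : T -> 'rV[R]_n) :
  measurable_vec u -> measurable_fun setT (fun t => enorm (u t)).
Proof.
move=> mu; apply: (measurableT_comp (@continuous_measurable_fun R Num.sqrt _)).
  exact: sqrt_continuous.
rewrite (_ : (fun _ => _) = (fun t => enorm (u t) ^+ 2)); first exact: measurable_enorm2.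
by apply/funext => t; rewrite -dot_sqr; apply: eq_bigr => i _; rewrite expr2.
Qed.

End MeasurableVec.

(** * Measurability of the iterates *)

Section MeasurableIterates.
Context (R : realType) (dx dy : nat) (dX dZ d : measure_display).
Context (X : measurableType dX) (Z : measurableType dZ) (T : measurableType d).
Context (F : 'rV[R]_(dx + dy) -> X -> R) (G : 'rV[R]_(dx + dy) -> Z -> R).
Hypotheses (mF : forall p, measurable_fun setT (F p)) (mG : forall p, measurable_fun setT (G p)).
Hypotheses (dF : forall s p, differentiable (F^~ s) p) (dG : forall s p, differentiable (G^~ s) p).
Context (eta tau sigma : R) (B : nat) (K : R -> nat) (next : R -> R -> R).
Hypothesis mK : forall k, measurable [set r | K r = k].
Hypothesis mnext : forall (a b : T -> R), measurable_fun setT a -> measurable_fun setT b ->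
  measurable_fun setT (fun t => next (a t) (b t)).
Context (xi : fidx -> T -> X) (zeta : gidx -> T -> Z).

Lemma z_inner_measurable t (x : T -> 'rV[R]_dx) (z : T -> 'rV[R]_dy) k :
  measurable_vec x -> measurable_vec z ->
  (forall j i, (j < k)%N -> measurable_fun setT (zeta (false, t, Some j, i))) ->
  measurable_vec (fun w => z_inner G tau B (zeta^~ w) t (x w) (z w) k).
Proof.
move=> mx mz; elim: k => [//|k IH] ms /=.
have {}IH := IH (fun j i jk => ms j i (ltnW jk)).
apply: measurable_vecB => //; apply: measurable_vecZ; apply: measurable_vec_rsub.
apply: (measurable_minibatch B (s := fun i => zeta (false, t, Some k, i))) => //.
  by move=> i; exact: ms.
exact: measurable_vec_row.
Qed.

Lemma y_inner_measurable t (x : T -> 'rV[R]_dx) (y : T -> 'rV[R]_dy) k :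
  measurable_vec x -> measurable_vec y ->
  (forall j i, (j < k)%N -> measurable_fun setT (xi (t, Some j, i))) ->
  (forall j i, (j < k)%N -> measurable_fun setT (zeta (true, t, Some j, i))) ->
  measurable_vec (fun w => y_inner F G tau sigma B (xi^~ w) (zeta^~ w) t (x w) (y w) k).
Proof.
move=> mx my; elim: k => [//|k IH] mxi mzeta /=.
have {}IH := IH (fun j i jk => mxi j i (ltnW jk)) (fun j i jk => mzeta j i (ltnW jk)).
apply: measurable_vecB => //; apply: measurable_vecZ; apply: measurable_vecD.
  apply: measurable_vecZ; apply: measurable_vec_rsub.
  apply: (measurable_minibatch B (s := fun i => xi (t, Some k, i))) => //.
    by move=> i; exact: mxi.
  exact: measurable_vec_row.
apply: measurable_vec_rsub.
apply: (measurable_minibatch B (s := fun i => zeta (true, t, Some k, i))) => //.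
  by move=> i; exact: mzeta.
exact: measurable_vec_row.
Qed.

Lemma hypergrad_measurable t (x : T -> 'rV[R]_dx) (y z : T -> 'rV[R]_dy) :
  measurable_vec x -> measurable_vec y -> measurable_vec z ->
  (forall i, measurable_fun setT (xi (t, None, i))) ->
  (forall b i, measurable_fun setT (zeta (b, t, None, i))) ->
  measurable_vec (fun w => hypergrad F G sigma B (xi^~ w) (zeta^~ w) t (x w) (y w) (z w)).
Proof.
move=> mx my mz mxi mzeta; apply: measurable_vecD.
  apply: measurable_vec_lsub.
  apply: (measurable_minibatch B (s := fun i => xi (t, None, i))) => //.
  exact: measurable_vec_row.
apply: measurable_vecZ; apply: measurable_vecB; apply: measurable_vec_lsub.
  apply: (measurable_minibatch B (s := fun i => zeta (true, t, None, i))) => //.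
  exact: measurable_vec_row.
apply: (measurable_minibatch B (s := fun i => zeta (false, t, None, i))) => //.
exact: measurable_vec_row.
Qed.

Context (x0 : 'rV[R]_dx) (y0 : 'rV[R]_dy) (delta0 : R).
Let st t w := F2BSA F G eta tau sigma B K next (xi^~ w) (zeta^~ w) x0 y0 delta0 t.

Definition state_measurable t : Prop :=
  [/\ measurable_vec (fun w => st_x (st t w)), measurable_vec (fun w => st_y (st t w)),
      measurable_vec (fun w => st_z (st t w)) &
      measurable_fun setT (fun w => st_delta (st t w))].

Lemma count_measurable t k : measurable_fun setT (fun w => st_delta (st t w)) ->
  measurable [set w | K (st_delta (st t w)) = k].
Proof. by move=> md; rewrite -[X in measurable X]setTI; exact: (md measurableT _ (mK k)). Qed.

Lemma F2BSA_measurable t :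
  (forall t' o i, (t' < t)%N -> measurable_fun setT (xi (t', o, i))) ->
  (forall b t' o i, (t' < t)%N -> measurable_fun setT (zeta (b, t', o, i))) ->
  state_measurable t.
Proof.
elim: t => [|t IH] mxi mzeta.
  by split; (try exact: measurable_vec_cst); exact: measurable_cst.
have [mx my mz md] : state_measurable t.
  by apply: IH => *; [apply: mxi|apply: mzeta]; exact: ltnW.
have my' : measurable_vec (fun w => st_y (st t.+1 w)).
  apply: (measurable_vec_nat
    (u := fun k w => y_inner F G tau sigma B (xi^~ w) (zeta^~ w) t (st_x (st t w)) (st_y (st t w)) k)
    (N := fun w => K (st_delta (st t w)))) => k; last exact: count_measurable.
  by apply: y_inner_measurable => // j i _; [exact: mxi|exact: mzeta].
have mz' : measurable_vec (fun w => st_z (st t.+1 w)).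
  apply: (measurable_vec_nat
    (u := fun k w => z_inner G tau B (zeta^~ w) t (st_x (st t w)) (st_z (st t w)) k)
    (N := fun w => K (st_delta (st t w)))) => k; last exact: count_measurable.
  by apply: z_inner_measurable => // j i _; exact: mzeta.
have mx' : measurable_vec (fun w => st_x (st t.+1 w)).
  apply: measurable_vecB => //; apply: measurable_vecZ.
  by apply: hypergrad_measurable => // *; [exact: mxi|exact: mzeta].
split => //; apply: mnext => //; apply: measurable_enorm.
exact: measurable_vecB.
Qed.

End MeasurableIterates.

(** * Inner loop in expectation *)

Section Expectation.
Context (R : realType) (d : measure_display) (Om : measurableType d) (P : probability Om R).
Implicit Types (f g h : Om -> R) (c : R).

(** The class on which the integral in the extended reals is additive and monotone; the bounds on
    the iterates can then be derived without proving finiteness first. *)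
Definition nnm f : Prop := measurable_fun setT f /\ forall w, 0 <= f w.
Definition Ex f : \bar R := (\int[P]_w (f w)%:E)%E.

Lemma Ex_ge0 f : nnm f -> (0 <= Ex f)%E.
Proof. by move=> [_ f0]; apply: integral_ge0 => w _; rewrite lee_fin. Qed.

Lemma nnmD f g : nnm f -> nnm g -> nnm (fun w => f w + g w).
Proof.
by move=> [mf f0] [mg g0]; split; [exact: measurable_funD|move=> w; exact: addr_ge0].
Qed.

Lemma nnmM f g : nnm f -> nnm g -> nnm (fun w => f w * g w).
Proof.
by move=> [mf f0] [mg g0]; split; [exact: measurable_funM|move=> w; exact: mulr_ge0].
Qed.

Lemma nnm_cst c : 0 <= c -> nnm (fun=> c).
Proof. by move=> c0; split. Qed.

Lemma nnmZ c f : 0 <= c -> nnm f -> nnm (fun w => c * f w).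
Proof. by move=> c0; apply: nnmM; exact: nnm_cst. Qed.

Lemma nnm_indic (A : set Om) : measurable A -> nnm (\1_A : Om -> R).
Proof. by move=> mA; split => [|w]; [exact: measurable_indic|rewrite indicE]. Qed.

Lemma nnm_enorm2 n (v : Om -> 'rV[R]_n) : measurable_vec v -> nnm (fun w => enorm (v w) ^+ 2).
Proof. by move=> mv; split => [|w]; [exact: measurable_enorm2|exact: sqr_ge0]. Qed.

Lemma Ex_le f g : nnm f -> nnm g -> (forall w, f w <= g w) -> (Ex f <= Ex g)%E.
Proof.
move=> [mf f0] [mg g0] fg; apply: ge0_le_integral => //.
- by move=> w _; rewrite lee_fin.
- exact/measurable_EFinP.
- exact/measurable_EFinP.
- by move=> w _; rewrite lee_fin.
Qed.

Lemma ExD f g : nnm f -> nnm g -> (Ex (fun w => f w + g w)%R = Ex f + Ex g)%E.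
Proof.
move=> [mf f0] [mg g0]; rewrite /Ex.
under eq_integral do rewrite EFinD.
rewrite ge0_integralD//; try exact/measurable_EFinP.
- by move=> w _; rewrite lee_fin.
- by move=> w _; rewrite lee_fin.
Qed.

Lemma ExZ c f : 0 <= c -> nnm f -> (Ex (fun w => c * f w)%R = c%:E * Ex f)%E.
Proof.
move=> c0 [mf f0]; rewrite /Ex.
under eq_integral do rewrite EFinM.
rewrite ge0_integralZl_EFin//; last exact/measurable_EFinP.
by move=> w _; rewrite lee_fin.
Qed.

Lemma Ex_cst c : Ex (fun=> c) = c%:E.
Proof. by have := expectation_cst P c; rewrite unlock. Qed.

Lemma Ex_le_add c1 c2 f g h : 0 <= c1 -> 0 <= c2 -> nnm f -> nnm g -> nnm h ->
  (forall w, f w <= c1 * g w + c2 * h w) -> (Ex f <= c1%:E * Ex g + c2%:E * Ex h)%E.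
Proof.
move=> c10 c20 nf ng nh H; rewrite -!ExZ// -ExD; try exact: nnmZ.
by apply: Ex_le => //; apply: nnmD; exact: nnmZ.
Qed.

Lemma Ex_partition f (N : Om -> nat) : nnm f -> (forall j, measurable [set w | N w = j]) ->
  (Ex f = \sum_(j <oo) Ex (fun w => \1_[set w | N w = j] w * f w)%R)%E.
Proof.
move=> [mf f0] mN.
have cover : \bigcup_j [set w | N w = j] = setT by apply/seteqP; split => // w _; exists (N w).
rewrite /Ex -{1}cover ge0_integral_bigcup//.
- apply: eq_eseriesr => j _; rewrite integral_mkcond; apply: eq_integral => w _.
  rewrite patchE indicE; case: ifPn => _; first by rewrite mul1r.
  by rewrite mul0r.
- by rewrite cover; exact/measurable_EFinP.
- by move=> w _; rewrite lee_fin.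
- by move=> i j _ _ [w [/= <- <-]].
Qed.

Section InnerLoop.
Context (a e : nat -> Om -> R) (N : Om -> nat) (mu L V : R).
Hypotheses (mu0 : 0 < mu) (muL : mu <= L) (V0 : 0 <= V).
Hypotheses (na : forall k, nnm (a k)) (ne : forall k, nnm (e k)).
Hypothesis mN : forall j, measurable [set w | N w = j].
Hypothesis step : forall k w, a k.+1 w <= (1 - mu / L) * a k w + e k w / (2 * L).
Hypothesis noise_le : forall j k, (k < j)%N ->
  (Ex (fun w => \1_[set w | N w = j] w * e k w)%R <= V%:E * Ex (\1_[set w | N w = j]))%E.

Let rho := 1 - mu / L.
Let L0 : 0 < L. Proof. exact: lt_le_trans muL. Qed.
Let rho0 : 0 <= rho. Proof. by rewrite subr_ge0 ler_pdivrMr// mul1r. Qed.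

(** On the event N = j the loop has deterministic length. V / (2 mu) is the fixed point of r -> (1 -
    mu / L) r + V / (2 L), so the noise never accumulates beyond it. *)
Let inner_fixed j k : (k <= j)%N ->
  (Ex (fun w => \1_[set w | N w = j] w * a k w)%R <=
   Ex (fun w => \1_[set w | N w = j] w * (rho ^+ k * a 0 w + V / (2 * mu)))%R)%E.
Proof.
have c0 : 0 <= V / (2 * mu) by rewrite divr_ge0// mulr_ge0// ltW.
have nI := nnm_indic (mN j); set I := \1_[set w | N w = j] in nI *.
have nb m : nnm (fun w => I w * (rho ^+ m * a 0 w + V / (2 * mu))).
  apply: nnmM => //; apply: nnmD; last exact: nnm_cst.
  by apply: nnmZ => //; exact: exprn_ge0.
elim: k => [_|k IH kj].
  apply: Ex_le => // [|w]; first exact: nnmM.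
  by rewrite ler_wpM2l ?nI.2// expr0 mul1r lerDl.
have iL : 0 <= (2 * L)^-1 by rewrite invr_ge0 mulr_ge0// ltW.
have h1 : (Ex (fun w => I w * a k.+1 w)%R <=
    rho%:E * Ex (fun w => I w * a k w)%R + ((2 * L)^-1)%:E * Ex (fun w => I w * e k w)%R)%E.
  apply: Ex_le_add => // [|||w]; try exact: nnmM.
  have -> : rho * (I w * a k w) + (2 * L)^-1 * (I w * e k w) =
      I w * (rho * a k w + e k w / (2 * L)) by ring.
  by rewrite ler_wpM2l ?nI.2.
apply: (le_trans h1).
have h2 : (((2 * L)^-1)%:E * Ex (fun w => I w * e k w)%R <= (V / (2 * L))%:E * Ex I)%E.
  rewrite [V / _]mulrC EFinM -muleA; apply: lee_wpmul2l; first by rewrite lee_fin.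
  exact: noise_le.
have h3 : (rho%:E * Ex (fun w => I w * a k w)%R <=
    rho%:E * Ex (fun w => I w * (rho ^+ k * a 0 w + V / (2 * mu)))%R)%E.
  by apply: lee_wpmul2l; [rewrite lee_fin|apply: IH; exact: ltnW].
apply: (le_trans (leeD h3 h2)).
rewrite -!ExZ//; last by rewrite divr_ge0// mulr_ge0// ltW.
rewrite -ExD; [|exact: nnmZ|].
  apply: Ex_le => // [|w].
    apply: nnmD; first exact: nnmZ.
    by apply: nnmZ => //; rewrite divr_ge0// mulr_ge0// ltW.
  rewrite le_eqVlt; apply/orP; left; apply/eqP; rewrite /rho exprS.
  by field; rewrite !gt_eqF.
by apply: nnmZ => //; rewrite divr_ge0// mulr_ge0// ltW.
Qed.

Lemma inner_loop : nnm (fun w => a (N w) w) -> nnm (fun w => rho ^+ (N w) * a 0 w) ->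
  (Ex (fun w => a (N w) w) <= Ex (fun w => rho ^+ (N w) * a 0 w)%R + (V / (2 * mu))%:E)%E.
Proof.
move=> naN nrN.
have c0 : 0 <= V / (2 * mu) by rewrite divr_ge0// mulr_ge0// ltW.
rewrite -[X in (_ + X)%E]Ex_cst -(ExD nrN (nnm_cst c0)).
have nb : nnm (fun w => rho ^+ N w * a 0 w + V / (2 * mu)) by apply: nnmD => //; exact: nnm_cst.
rewrite (Ex_partition naN mN) (Ex_partition nb mN).
apply: lee_nneseries => j.
  by move=> _ _; apply: Ex_ge0; apply: nnmM => //; exact: nnm_indic.
move=> _.
have E1 : (fun w => \1_[set w | N w = j] w * a (N w) w) =
    (fun w => \1_[set w | N w = j] w * a j w) :> (Om -> R).
  apply/funext => w; rewrite indicE; case: (boolP (w \in _)); last by rewrite !mul0r.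
  by rewrite inE /= => ->.
have E2 : (fun w => \1_[set w | N w = j] w * (rho ^+ N w * a 0 w + V / (2 * mu))) =
    (fun w => \1_[set w | N w = j] w * (rho ^+ j * a 0 w + V / (2 * mu))) :> (Om -> R).
  apply/funext => w; rewrite indicE; case: (boolP (w \in _)); last by rewrite !mul0r.
  by rewrite inE /= => ->.
by rewrite E1 E2; exact: inner_fixed.
Qed.

End InnerLoop.

End Expectation.

Lemma measurable_continuous_comp (R : realType) (d : measure_display) (T : measurableType d)
    (n : nat) (h : 'rV[R]_n -> R) (v : T -> 'rV[R]_n) :
  continuous h -> measurable_vec v -> measurable_fun setT (fun t => h (v t)).
Proof.
by move=> ch mv; exact: (@measurable_caratheodory R _ _ T T n (fun p _ => h p) v id).
Qed.

Lemma some_ltn_eqF j k : (j < k)%N -> (Some j == Some k) = false.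
Proof. by move=> jk; apply/negbTE/eqP => -[e]; rewrite e ltnn in jk. Qed.
Lemma some_eq_none (j : nat) : (Some j == None) = false. Proof. by []. Qed.

(** * The random iterates *)

Section Run.
Context (R : realType) (dx dy : nat) (dX dZ dO : measure_display).
Context (X : measurableType dX) (Z : measurableType dZ) (Om : measurableType dO).
Context (DX : probability X R) (DZ : probability Z R) (P : probability Om R).
Context (F : 'rV[R]_(dx + dy) -> X -> R) (G : 'rV[R]_(dx + dy) -> Z -> R).
Context (f g : 'rV[R]_(dx + dy) -> R) (xi : fidx -> Om -> X) (zeta : gidx -> Om -> Z).
Context (Mf Mg : R).
Hypotheses (df : forall p, differentiable f p) (dg : forall p, differentiable g p).
Hypotheses (orcF : stochastic_oracle DX Mf f F) (orcG : stochastic_oracle DZ Mg g G).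
Hypothesis fresh : fresh_samples P DX DZ xi zeta.
Context (eta tau sigma : R) (B : nat) (K : R -> nat) (next : R -> R -> R).
Hypothesis B0 : (0 < B)%N.
Hypothesis mK : forall k, measurable [set r | K r = k].
Hypothesis mnext : forall d (T : measurableType d) (a b : T -> R),
  measurable_fun setT a -> measurable_fun setT b ->
  measurable_fun setT (fun t => next (a t) (b t)).
Context (x0 : 'rV[R]_dx) (y0 : 'rV[R]_dy) (delta0 : R).

Let mF p : measurable_fun setT (F p).
Proof. by have /integrableP[/measurable_EFinP] := so_integrable orcF p. Qed.
Let mG p : measurable_fun setT (G p).
Proof. by have /integrableP[/measurable_EFinP] := so_integrable orcG p. Qed.
Let dF s p : differentiable (F^~ s) p. Proof. exact: so_differentiable orcF s p. Qed.
Let dG s p : differentiable (G^~ s) p. Proof. exact: so_differentiable orcG s p. Qed.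

Definition run t w := F2BSA F G eta tau sigma B K next (xi^~ w) (zeta^~ w) x0 y0 delta0 t.
Definition run_count t w := K (st_delta (run t w)).
Definition run_y t k w :=
  y_inner F G tau sigma B (xi^~ w) (zeta^~ w) t (st_x (run t w)) (st_y (run t w)) k.
Definition run_z t k w :=
  z_inner G tau B (zeta^~ w) t (st_x (run t w)) (st_z (run t w)) k.

Definition batchF t o w p := minibatch F B (fun i => xi (t, o, i) w) p.
Definition batchG b t o w p := minibatch G B (fun i => zeta (b, t, o, i) w) p.

(** All the information except that in sample a. An iterate that does not use sample a is measurable
    for it, while sample a is independent of it. *)
Definition gen_xi a := cylinders xi zeta [set i | i != a] setT.
Definition gen_zeta a := cylinders xi zeta setT [set j | j != a].

Definition before (Lx : set fidx) (Lz : set gidx) t : Prop :=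
  (forall t' o i, (t' < t)%N -> Lx (t', o, i)) /\
  (forall b t' o i, (t' < t)%N -> Lz (b, t', o, i)).

Let st_wrt Lx Lz t := @state_measurable R dx dy dX dZ _ X Z
  (g_sigma_algebraType (cylinders xi zeta Lx Lz)) F G eta tau sigma B K next xi zeta x0 y0 delta0 t.

Let xi_w Lx Lz a : Lx a -> measurable_wrt (cylinders xi zeta Lx Lz) (xi a).
Proof. exact: xi_measurable_wrt. Qed.
Let zeta_w Lx Lz a : Lz a -> measurable_wrt (cylinders xi zeta Lx Lz) (zeta a).
Proof. exact: zeta_measurable_wrt. Qed.

Let run_wrt Lx Lz t : before Lx Lz t -> st_wrt Lx Lz t.
Proof.
move=> [hx hz]; apply: F2BSA_measurable => //; first by move=> ? ? *; exact: mnext.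
  by move=> t' o i tt'; exact: (xi_w (hx _ _ _ tt')).
by move=> b t' o i tt'; exact: (zeta_w (hz _ _ _ _ tt')).
Qed.

Let count_wrt Lx Lz t k : before Lx Lz t ->
  @measurable _ (g_sigma_algebraType (cylinders xi zeta Lx Lz)) [set w | run_count t w = k].
Proof. by move=> /run_wrt[_ _ _ md]; exact: count_measurable. Qed.

Let indic_count_wrt Lx Lz t k : before Lx Lz t ->
  measurable_wrt (cylinders xi zeta Lx Lz) (\1_[set w | run_count t w = k] : Om -> R).
Proof. by move=> b; apply: measurable_indic; exact: count_wrt. Qed.

Let run_y_wrt Lx Lz t k : before Lx Lz t ->
  (forall j i, (j < k)%N -> Lx (t, Some j, i)) ->
  (forall j i, (j < k)%N -> Lz (true, t, Some j, i)) ->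
  measurable_vec_wrt (cylinders xi zeta Lx Lz) (run_y t k).
Proof.
move=> b hx hz; have [mx my _ _] := run_wrt b.
apply: y_inner_measurable => // j i jk.
  exact: (xi_w (hx _ _ jk)).
exact: (zeta_w (hz _ _ jk)).
Qed.

Let run_z_wrt Lx Lz t k : before Lx Lz t ->
  (forall j i, (j < k)%N -> Lz (false, t, Some j, i)) ->
  measurable_vec_wrt (cylinders xi zeta Lx Lz) (run_z t k).
Proof.
move=> b hz; have [mx _ mz _] := run_wrt b.
apply: z_inner_measurable => // j i jk.
exact: (zeta_w (hz _ _ jk)).
Qed.

Let final_y_wrt Lx Lz t : before Lx Lz t -> (forall j i, Lx (t, Some j, i)) ->
  (forall b j i, Lz (b, t, Some j, i)) ->
  measurable_vec_wrt (cylinders xi zeta Lx Lz) (fun w => st_y (run t.+1 w)).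
Proof.
move=> b hx hz.
have my k : measurable_vec_wrt (cylinders xi zeta Lx Lz) (run_y t k) by exact: run_y_wrt.
exact: (@measurable_vec_nat R _ (g_sigma_algebraType (cylinders xi zeta Lx Lz)) dy
  (run_y t) (run_count t) my (fun k => count_wrt k b)).
Qed.

Let final_z_wrt Lx Lz t : before Lx Lz t -> (forall b j i, Lz (b, t, Some j, i)) ->
  measurable_vec_wrt (cylinders xi zeta Lx Lz) (fun w => st_z (run t.+1 w)).
Proof.
move=> b hz.
have mz k : measurable_vec_wrt (cylinders xi zeta Lx Lz) (run_z t k) by exact: run_z_wrt.
exact: (@measurable_vec_nat R _ (g_sigma_algebraType (cylinders xi zeta Lx Lz)) dy
  (run_z t) (run_count t) mz (fun k => count_wrt k b)).
Qed.

Lemma batchF_noise t o (v : Om -> 'rV[R]_(dx + dy)) (W : Om -> R) : (forall w, 0 <= W w) ->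
  (forall i, measurable_vec_wrt (gen_xi (t, o, i)) v) ->
  (forall i, measurable_wrt (gen_xi (t, o, i)) W) ->
  (Ex P (fun w => W w * enorm (batchF t o w (v w) - grad f (v w)) ^+ 2)%R <=
   (Mf ^+ 2 / B%:R)%:E * Ex P W)%E.
Proof.
move=> W0 mv mW.
apply: (minibatch_noise orcF (P := P) df (s := fun i => xi (t, o, i)) (G := fun i => gen_xi (t, o, i))) => //.
  by move=> i _; exact: xi_independent fresh _.
move=> i j /andP[ji _]; apply: xi_w.
by rewrite /= xpair_eqE eqxx /= ltn_eqF.
Qed.

Lemma batchG_noise b t o (v : Om -> 'rV[R]_(dx + dy)) (W : Om -> R) : (forall w, 0 <= W w) ->
  (forall i, measurable_vec_wrt (gen_zeta (b, t, o, i)) v) ->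
  (forall i, measurable_wrt (gen_zeta (b, t, o, i)) W) ->
  (Ex P (fun w => W w * enorm (batchG b t o w (v w) - grad g (v w)) ^+ 2)%R <=
   (Mg ^+ 2 / B%:R)%:E * Ex P W)%E.
Proof.
move=> W0 mv mW.
apply: (minibatch_noise orcG (P := P) dg (s := fun i => zeta (b, t, o, i)) (G := fun i => gen_zeta (b, t, o, i))) => //.
  by move=> i _; exact: zeta_independent _ fresh.
move=> i j /andP[ji _]; apply: zeta_w.
by rewrite /= xpair_eqE eqxx /= ltn_eqF.
Qed.

Lemma batchF_noise1 t o (v : Om -> 'rV[R]_(dx + dy)) :
  (forall i, measurable_vec_wrt (gen_xi (t, o, i)) v) ->
  (Ex P (fun w => enorm (batchF t o w (v w) - grad f (v w)) ^+ 2)%R <= (Mf ^+ 2 / B%:R)%:E)%E.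
Proof.
move=> mv; pose q w := enorm (batchF t o w (v w) - grad f (v w)) ^+ 2.
have -> : (fun w => enorm (batchF t o w (v w) - grad f (v w)) ^+ 2) = (fun w => 1 * q w).
  by apply/funext => w; rewrite mul1r.
rewrite -[leRHS]mule1 -(Ex_cst P 1); apply: batchF_noise => // i.
exact: measurable_cst.
Qed.

Lemma batchG_noise1 b t o (v : Om -> 'rV[R]_(dx + dy)) :
  (forall i, measurable_vec_wrt (gen_zeta (b, t, o, i)) v) ->
  (Ex P (fun w => enorm (batchG b t o w (v w) - grad g (v w)) ^+ 2)%R <= (Mg ^+ 2 / B%:R)%:E)%E.
Proof.
move=> mv; pose q w := enorm (batchG b t o w (v w) - grad g (v w)) ^+ 2.
have -> : (fun w => enorm (batchG b t o w (v w) - grad g (v w)) ^+ 2) = (fun w => 1 * q w).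
  by apply/funext => w; rewrite mul1r.
rewrite -[leRHS]mule1 -(Ex_cst P 1); apply: batchG_noise => // i.
exact: measurable_cst.
Qed.

Lemma before_xi t o i : before [set j | j != (t, o, i)] setT t.
Proof.
by split => // t' o' i' tt' /=; rewrite !xpair_eqE (ltn_eqF tt').
Qed.

Lemma before_zeta b t o i : before setT [set j | j != (b, t, o, i)] t.
Proof.
by split => // b' t' o' i' tt' /=; rewrite !xpair_eqE (ltn_eqF tt') andbF.
Qed.

Definition noise_y t k w : 'rV[R]_dy :=
  let p := row_mx (st_x (run t w)) (run_y t k w) in
  sigma *: rsubmx (batchF t (Some k) w p - grad f p) +
  rsubmx (batchG true t (Some k) w p - grad g p).

Definition noise_z t k w : 'rV[R]_dy :=
  let p := row_mx (st_x (run t w)) (run_z t k w) in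
  rsubmx (batchG false t (Some k) w p - grad g p).

(** Puts the inner iteration in the form of an inexact gradient step on [pen sigma], which
    [pen_inexact_step] handles; [run_zS] does this with penalty 0, that is, with g. *)
Lemma run_yS t k w : run_y t k.+1 w =
  run_y t k w - tau *: (pen_gy f g sigma (st_x (run t w)) (run_y t k w) + noise_y t k w).
Proof.
rewrite /run_y /= -/(run_y t k w) /noise_y /pen_gy /pen_grad; congr (_ - _ *: _).
set p := row_mx _ _; rewrite -/(batchF t (Some k) w p) -/(batchG true t (Some k) w p).
by apply/rowP => i; rewrite !mxE; ring.
Qed.

Lemma run_zS t k w : run_z t k.+1 w =
  run_z t k w - tau *: (pen_gy f g 0 (st_x (run t w)) (run_z t k w) + noise_z t k w).
Proof.
rewrite /run_z /= -/(run_z t k w) /noise_z /pen_gy /pen_grad; congr (_ - _ *: _).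
set p := row_mx _ _; rewrite -/(batchG false t (Some k) w p).
by apply/rowP => i; rewrite !mxE; ring.
Qed.

Lemma run_state_measurable t : state_measurable F G eta tau sigma B K next xi zeta x0 y0 delta0 t.
Proof.
apply: F2BSA_measurable => //; first by move=> ? ? *; exact: mnext.
  by move=> *; exact: fs_xi_meas fresh _.
by move=> *; exact: fs_zeta_meas fresh _.
Qed.

Lemma run_count_measurable t k : measurable [set w | run_count t w = k].
Proof. by have [_ _ _ md] := run_state_measurable t; exact: count_measurable. Qed.

Lemma run_y_measurable t k : measurable_vec (run_y t k).
Proof.
have [mx my _ _] := run_state_measurable t; apply: y_inner_measurable => // *.
  exact: fs_xi_meas fresh _.
exact: fs_zeta_meas fresh _.
Qed.

Lemma run_z_measurable t k : measurable_vec (run_z t k).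
Proof.
have [mx _ mz _] := run_state_measurable t; apply: z_inner_measurable => // *.
exact: fs_zeta_meas fresh _.
Qed.

Lemma batchF_measurable t o (v : Om -> 'rV[R]_(dx + dy)) : measurable_vec v ->
  measurable_vec (fun w => batchF t o w (v w)).
Proof.
move=> mv; apply: (measurable_minibatch B (s := fun i => xi (t, o, i))) => // i.
exact: fs_xi_meas fresh _.
Qed.

Lemma batchG_measurable b t o (v : Om -> 'rV[R]_(dx + dy)) : measurable_vec v ->
  measurable_vec (fun w => batchG b t o w (v w)).
Proof.
move=> mv; apply: (measurable_minibatch B (s := fun i => zeta (b, t, o, i))) => // i.
exact: fs_zeta_meas fresh _.
Qed.

Lemma grad_measurable (h : 'rV[R]_(dx + dy) -> R) (v : Om -> 'rV[R]_(dx + dy)) :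
  (forall p, differentiable h p) -> measurable_vec v -> measurable_vec (fun w => grad h (v w)).
Proof.
by move=> dh mv i; exact: (@measurable_grad_comp R _ _ Om Om _ (fun p _ => h p) v id).
Qed.

Lemma noise_y_nnm t k : nnm (fun w => enorm (noise_y t k w) ^+ 2).
Proof.
apply: nnm_enorm2; have [mx _ _ _] := run_state_measurable t.
have mp : measurable_vec (fun w => row_mx (st_x (run t w)) (run_y t k w)).
  by apply: measurable_vec_row => //; exact: run_y_measurable.
apply: measurable_vecD; first apply: measurable_vecZ; apply: measurable_vec_rsub;
  apply: measurable_vecB.
- exact: batchF_measurable.
- exact: grad_measurable.
- exact: batchG_measurable.
- exact: grad_measurable.
Qed.

Lemma noise_z_nnm t k : nnm (fun w => enorm (noise_z t k w) ^+ 2).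
Proof.
apply: nnm_enorm2; have [mx _ _ _] := run_state_measurable t.
have mp : measurable_vec (fun w => row_mx (st_x (run t w)) (run_z t k w)).
  by apply: measurable_vec_row => //; exact: run_z_measurable.
by apply: measurable_vec_rsub; apply: measurable_vecB; [exact: batchG_measurable|exact: grad_measurable].
Qed.

Let batch_sqr_nnm_F t o (v : Om -> 'rV[R]_(dx + dy)) : measurable_vec v ->
  nnm (fun w => enorm (batchF t o w (v w) - grad f (v w)) ^+ 2).
Proof.
by move=> mv; apply: nnm_enorm2; apply: measurable_vecB; [exact: batchF_measurable|exact: grad_measurable].
Qed.

Let batch_sqr_nnm_G b t o (v : Om -> 'rV[R]_(dx + dy)) : measurable_vec v ->
  nnm (fun w => enorm (batchG b t o w (v w) - grad g (v w)) ^+ 2).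
Proof.
by move=> mv; apply: nnm_enorm2; apply: measurable_vecB; [exact: batchG_measurable|exact: grad_measurable].
Qed.

(** The factor 2 comes from splitting the noise of the y-step into its f-part and g-part; the z-step
    satisfies the same bound. *)
Definition noise_level : R := 2 * (sigma ^+ 2 * Mf ^+ 2 + Mg ^+ 2) / B%:R.

Lemma noise_level_ge0 : 0 <= noise_level.
Proof.
have h : 0 <= sigma ^+ 2 * Mf ^+ 2 by rewrite -exprMn sqr_ge0.
by rewrite divr_ge0// mulr_ge0// addr_ge0// sqr_ge0.
Qed.

(** The iterate uses inner samples of index below k, and the event on the count depends on earlier
    outer steps, so every sample of the batch at step k is fresh for both. *)
Lemma noise_z_le t j k : (k < j)%N ->
  (Ex P (fun w => \1_[set w | run_count t w = j] w * enorm (noise_z t k w) ^+ 2)%R <=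
   noise_level%:E * Ex P (\1_[set w | run_count t w = j]))%E.
Proof.
move=> kj; have mI := run_count_measurable t j; have nI := nnm_indic R mI.
set I := \1_[set w | run_count t w = j] in nI *.
pose p w := row_mx (st_x (run t w)) (run_z t k w).
have mp : measurable_vec p.
  have [mx _ _ _] := run_state_measurable t.
  by apply: measurable_vec_row => //; exact: run_z_measurable.
have nG := batch_sqr_nnm_G false t (Some k) mp.
apply: (@le_trans _ _ ((Mg ^+ 2 / B%:R)%:E * Ex P I)%E).
  apply: le_trans (batchG_noise (v := p) nI.2 _ _) => [|i|i]; last 2 first.
  - have b := before_zeta false t (Some k) i; have [mx _ _ _] := run_wrt b.
    apply: measurable_vec_row; first exact: mx.
    by apply: run_z_wrt => // j' i' j'k /=; rewrite !xpair_eqE (some_ltn_eqF j'k) !andbF.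
  - exact: (indic_count_wrt j (before_zeta false t (Some k) i)).
  apply: Ex_le => [||w]; [exact: nnmM nI (noise_z_nnm t k)|exact: nnmM nI nG|].
  by rewrite ler_wpM2l ?nI.2// ler_sqr ?nnegrE ?enorm_ge0// enorm_rsubmx.
apply: lee_wpmul2r; first exact: Ex_ge0.
rewrite lee_fin /noise_level ler_wpM2r ?invr_ge0//.
by have := sqr_ge0 (sigma * Mf); have := sqr_ge0 Mg; rewrite exprMn; lra.
Qed.

Lemma noise_y_le t j k : (k < j)%N ->
  (Ex P (fun w => \1_[set w | run_count t w = j] w * enorm (noise_y t k w) ^+ 2)%R <=
   noise_level%:E * Ex P (\1_[set w | run_count t w = j]))%E.
Proof.
move=> kj; have mI := run_count_measurable t j; have nI := nnm_indic R mI.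
set I := \1_[set w | run_count t w = j] in nI *.
pose p w := row_mx (st_x (run t w)) (run_y t k w).
have mp : measurable_vec p.
  have [mx _ _ _] := run_state_measurable t.
  by apply: measurable_vec_row => //; exact: run_y_measurable.
have nG := batch_sqr_nnm_G true t (Some k) mp.
have nF := batch_sqr_nnm_F t (Some k) mp.
have hF : (Ex P (fun w => I w * enorm (batchF t (Some k) w (p w) - grad f (p w)) ^+ 2)%R <=
    (Mf ^+ 2 / B%:R)%:E * Ex P I)%E.
  apply: batchF_noise; first exact: nI.2.
    move=> i; have b := before_xi t (Some k) i; have [mx _ _ _] := run_wrt b.
    apply: measurable_vec_row; first exact: mx.
    by apply: run_y_wrt => // j' i' j'k /=; rewrite !xpair_eqE (some_ltn_eqF j'k) !andbF.
  by move=> i; exact: (indic_count_wrt j (before_xi t (Some k) i)).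
have hG : (Ex P (fun w => I w * enorm (batchG true t (Some k) w (p w) - grad g (p w)) ^+ 2)%R <=
    (Mg ^+ 2 / B%:R)%:E * Ex P I)%E.
  apply: batchG_noise; first exact: nI.2.
    move=> i; have b := before_zeta true t (Some k) i; have [mx _ _ _] := run_wrt b.
    apply: measurable_vec_row; first exact: mx.
    by apply: run_y_wrt => // j' i' j'k /=; rewrite !xpair_eqE (some_ltn_eqF j'k) !andbF.
  by move=> i; exact: (indic_count_wrt j (before_zeta true t (Some k) i)).
have s2 : 0 <= 2 * sigma ^+ 2 by rewrite mulr_ge0// sqr_ge0.
apply: (@le_trans _ _ ((2 * sigma ^+ 2)%:E * ((Mf ^+ 2 / B%:R)%:E * Ex P I) +
   2%:E * ((Mg ^+ 2 / B%:R)%:E * Ex P I))%E).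
  apply: le_trans (leeD (lee_wpmul2l _ hF) (lee_wpmul2l _ hG)); rewrite ?lee_fin//.
  apply: (Ex_le_add P s2 (ler0n _ 2) (nnmM nI (noise_y_nnm t k)) (nnmM nI nF) (nnmM nI nG)) => w.
  set qF := enorm (_ - grad f _) ^+ 2; set qG := enorm (_ - grad g _) ^+ 2.
  have -> : 2 * sigma ^+ 2 * (I w * qF) + 2 * (I w * qG) =
    I w * (2 * (sigma ^+ 2 * qF) + 2 * qG) by ring.
  rewrite ler_wpM2l ?nI.2//; apply: le_trans (enorm_sum2 _ _) _.
  rewrite enormZ exprMn real_normK ?num_real// lerD// ler_wpM2l//.
    by rewrite ler_wpM2l ?sqr_ge0// ler_sqr ?nnegrE ?enorm_ge0// enorm_rsubmx.
  by rewrite ler_sqr ?nnegrE ?enorm_ge0// enorm_rsubmx.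
have a0 : 0 <= 2 * sigma ^+ 2 * (Mf ^+ 2 / B%:R).
  by rewrite (mulr_ge0 s2)// divr_ge0// sqr_ge0.
have b0 : 0 <= 2 * (Mg ^+ 2 / B%:R) by rewrite mulr_ge0// divr_ge0// sqr_ge0.
rewrite !muleA -!EFinM -ge0_muleDl ?lee_fin//.
rewrite -EFinD; apply: lee_wpmul2r; first exact: Ex_ge0.
rewrite lee_fin le_eqVlt; apply/orP; left; apply/eqP; rewrite /noise_level.
by ring.
Qed.

(** Within step t the iterate fed to the estimate was built from samples labelled [Some], while the
    estimate uses the label [None]; its batch is therefore fresh. *)
Lemma outer_noiseF t :
  (Ex P (fun w => enorm (batchF t None w (row_mx (st_x (run t w)) (st_y (run t.+1 w))) -
      grad f (row_mx (st_x (run t w)) (st_y (run t.+1 w)))) ^+ 2)%R <= (Mf ^+ 2 / B%:R)%:E)%E.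
Proof.
apply: (@batchF_noise1 t None (fun w => row_mx (st_x (run t w)) (st_y (run t.+1 w)))) => i.
have b := before_xi t None i; have [mx _ _ _] := run_wrt b.
apply: measurable_vec_row; first exact: mx.
by apply: final_y_wrt => // j i' /=; rewrite !xpair_eqE some_eq_none !andbF.
Qed.

Lemma outer_noiseG_y t :
  (Ex P (fun w => enorm (batchG true t None w (row_mx (st_x (run t w)) (st_y (run t.+1 w))) -
      grad g (row_mx (st_x (run t w)) (st_y (run t.+1 w)))) ^+ 2)%R <= (Mg ^+ 2 / B%:R)%:E)%E.
Proof.
apply: (@batchG_noise1 true t None (fun w => row_mx (st_x (run t w)) (st_y (run t.+1 w)))) => i.
have b := before_zeta true t None i; have [mx _ _ _] := run_wrt b.
apply: measurable_vec_row; first exact: mx.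
by apply: final_y_wrt => // b' j i' /=; rewrite !xpair_eqE some_eq_none !andbF.
Qed.

Lemma outer_noiseG_z t :
  (Ex P (fun w => enorm (batchG false t None w (row_mx (st_x (run t w)) (st_z (run t.+1 w))) -
      grad g (row_mx (st_x (run t w)) (st_z (run t.+1 w)))) ^+ 2)%R <= (Mg ^+ 2 / B%:R)%:E)%E.
Proof.
apply: (@batchG_noise1 false t None (fun w => row_mx (st_x (run t w)) (st_z (run t.+1 w)))) => i.
have b := before_zeta false t None i; have [mx _ _ _] := run_wrt b.
apply: measurable_vec_row; first exact: mx.
by apply: final_z_wrt => // b' j i' /=; rewrite !xpair_eqE some_eq_none !andbF.
Qed.

End Run.

Lemma measurable_inv_pos (R : realType) (d : measure_display) (T : measurableType d) (h : T -> R) :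
  measurable_fun setT h -> (forall t, 0 < h t) -> measurable_fun setT (fun t => (h t)^-1).
Proof.
move=> mh h0; rewrite (_ : (fun _ => _) = (fun t => h t `^ (-1))).
  exact: (measurableT_comp (@measurable_powR R (-1)) mh).
by apply/funext => t; rewrite powR_inv1// ltW.
Qed.

Lemma measurable_nat_comp (R : realType) (d : measure_display) (T : measurableType d)
    (h : nat -> T -> R) (N : T -> nat) :
  (forall k, measurable_fun setT (h k)) -> (forall k, measurable [set t | N t = k]) ->
  measurable_fun setT (fun t => h (N t) t).
Proof.
move=> mh mN _ A mA; rewrite setTI.
have -> : (fun t => h (N t) t) @^-1` A = \bigcup_k ([set t | N t = k] `&` h k @^-1` A).
  apply/seteqP; split => t /=; first by exists (N t).
  by move=> [k _ [/= <-]].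
apply: bigcupT_measurable => k; apply: measurableI => //.
by rewrite -[X in measurable X]setTI; exact: mh.
Qed.

(** * The invariant relating the gap to the random accuracy parameter *)

Section Tracking.
Context (R : realType) (d : measure_display) (Om : measurableType d) (P : probability Om R).
Context (mu Lg L N : R) (K : R -> nat) (gap gapK delta r : nat -> Om -> R).
Hypotheses (mu0 : 0 < mu) (muL : mu <= L) (N0 : 0 < N).
Hypotheses (ngap : forall t, nnm (gap t)) (ngapK : forall t, nnm (gapK t)).
Hypotheses (mdelta : forall t, measurable_fun setT (delta t)).
Hypothesis delta_start : forall w, 128 ^+ 2 * N / mu <= delta 0 w.
Hypothesis gap_start : forall w, gap 0 w <= 3 * (L * delta 0 w).
Hypothesis delta_next : forall t w,
  delta t.+1 w = 2^-1 * delta t w + 8 * Lg ^+ 2 / mu ^+ 2 * r t w ^+ 2 + 128 ^+ 2 * N / mu.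
Hypothesis contract : forall x, 128 ^+ 2 * N / mu <= x ->
  (1 - mu / L) ^+ (K x) * (L * x) <= 2 / 128 ^+ 2 * N.
Hypothesis gap_next : forall t w,
  gap t.+1 w <= L * (8 / mu * gapK t w + 16 * Lg ^+ 2 / mu ^+ 2 * r t w ^+ 2).
Hypothesis mK : forall t k, measurable [set w | K (delta t w) = k].
Hypothesis inner : forall t,
  (Ex P (gapK t) <= Ex P (fun w => (1 - mu / L) ^+ K (delta t w) * gap t w)%R + (N / 64 ^+ 2)%:E)%E.

Let L0 : 0 < L. Proof. exact: lt_le_trans muL. Qed.
Let rho0 : 0 <= 1 - mu / L. Proof. by rewrite subr_ge0 ler_pdivrMr// mul1r. Qed.
Let c0 : 0 < 128 ^+ 2 * N / mu. Proof. by rewrite divr_gt0// mulr_gt0// exprn_gt0. Qed.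

Let r2_ge0 t w : 0 <= 8 * Lg ^+ 2 / mu ^+ 2 * r t w ^+ 2.
Proof. by rewrite mulr_ge0 ?sqr_ge0// divr_ge0 ?sqr_ge0// mulr_ge0 ?sqr_ge0. Qed.

Lemma delta_ge t w : 128 ^+ 2 * N / mu <= delta t w.
Proof.
elim: t => [|t IH]; first exact: delta_start.
by rewrite delta_next; have := r2_ge0 t w; have := le_trans (ltW c0) IH; lra.
Qed.

Let Ld0 t w : 0 < L * delta t w.
Proof. by rewrite mulr_gt0// (lt_le_trans c0)// delta_ge. Qed.

Definition ratio t w : R := gap t w * (L * delta t w)^-1.

Lemma ratio_nnm t : nnm (ratio t).
Proof.
have [mg g0] := ngap t; split => [|w]; last by rewrite mulr_ge0 ?invr_ge0 ?(ltW (Ld0 t w)).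
by apply: measurable_funM => //; apply: measurable_inv_pos => //; exact: measurable_funM.
Qed.

Lemma contracted_nnm t : nnm (fun w => (1 - mu / L) ^+ K (delta t w) * gap t w).
Proof.
have [mg g0] := ngap t; split => [|w]; last by rewrite mulr_ge0 ?exprn_ge0.
apply: (measurable_nat_comp (h := fun k w => (1 - mu / L) ^+ k * gap t w)
  (N := fun w => K (delta t w))) => // k.
exact: measurable_funM.
Qed.

(** The gap is written as (L delta) times the ratio. The contraction acts path by path on L delta,
    leaving a deterministic multiple of N times the ratio, of which only the mean is needed. *)
Lemma Ex_gapK t : (Ex P (ratio t) <= 3%:E)%E -> (Ex P (gapK t) <= (N / 40 ^+ 2)%:E)%E.
Proof.
move=> r3; apply: (le_trans (inner t)).
have h : (Ex P (fun w => (1 - mu / L) ^+ K (delta t w) * gap t w)%R <=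
    (2 / 128 ^+ 2 * N)%:E * Ex P (ratio t))%E.
  have n0 : 0 <= 2 / 128 ^+ 2 * N by rewrite mulr_ge0 ?ltW// divr_gt0// exprn_gt0.
  rewrite -ExZ//; last exact: ratio_nnm.
  apply: Ex_le => [||w]; [exact: contracted_nnm|exact/nnmZ/ratio_nnm|].
  have -> : gap t w = (L * delta t w) * ratio t w.
    by rewrite /ratio mulrCA mulfV ?mulr1// gt_eqF.
  by rewrite mulrA ler_wpM2r ?(ratio_nnm t).2// contract// delta_ge.
apply: (le_trans (leeD (le_trans h (lee_wpmul2l _ r3)) (lexx _))).
  by rewrite lee_fin mulr_ge0 ?ltW// divr_gt0// exprn_gt0.
(* 6 / 128^2 + 1 / 64^2 = 10 / 128^2, just below 1 / 40^2. *)
by rewrite -EFinM -EFinD lee_fin; move: N0; lra.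
Qed.

(** The movement term in [gap_next] is at most 2 L delta, by the recursion for delta. The term with
    [gapK] is divided by the floor 128^2 N / mu of delta and contributes at most 8 / (128^2 40^2) in
    mean, so the sum stays below 3. *)
Lemma Ex_ratio t : (Ex P (ratio t) <= 3%:E)%E.
Proof.
elim: t => [|t IH].
  rewrite -(Ex_cst P 3); apply: Ex_le => [||w]; [exact: ratio_nnm|exact: nnm_cst|].
  by rewrite /ratio ler_pdivrMr.
have gK := Ex_gapK IH.
have k0 : 0 <= 8 / (128 ^+ 2 * N) by rewrite divr_ge0// mulr_ge0 ?exprn_ge0// ltW.
have : (Ex P (ratio t.+1) <= 1%:E * Ex P (fun=> 2)%R + (8 / (128 ^+ 2 * N))%:E * Ex P (gapK t))%E.
  have n2 : nnm (fun _ : Om => 2 : R) by exact: nnm_cst.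
  apply: (Ex_le_add P ler01 k0 (ratio_nnm t.+1) n2 (ngapK t)) => w.
  rewrite mul1r /ratio ler_pdivrMr// mulrCA; apply: (le_trans (gap_next t w)).
  rewrite ler_pM2l//.
  have d1 : 8 * Lg ^+ 2 / mu ^+ 2 * r t w ^+ 2 <= delta t.+1 w.
    by rewrite delta_next; have := le_trans (ltW c0) (delta_ge t w); move: c0; lra.
  have g0 := (ngapK t).2 w.
  have d2 : 8 / (128 ^+ 2 * N) * gapK t w * (128 ^+ 2 * N / mu) <=
     8 / (128 ^+ 2 * N) * gapK t w * delta t.+1 w.
    by rewrite ler_wpM2l ?delta_ge// mulr_ge0.
  have p0 : (128 ^+ 2 : R) != 0 by rewrite expf_neq0// pnatr_eq0.
  have e (c : R) : c != 0 -> 8 / (c * N) * gapK t w * (c * N / mu) = 8 / mu * gapK t w.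
    by move=> cn0; field; rewrite cn0 !gt_eqF.
  by move: d1 d2; rewrite e//; lra.
move/le_trans; apply.
rewrite Ex_cst mul1e.
apply: (@le_trans _ _ (2%:E + (8 / (128 ^+ 2 * N))%:E * (N / 40 ^+ 2)%:E)%E).
  by apply: leeD => //; apply: lee_wpmul2l => //; rewrite lee_fin.
rewrite -EFinM -EFinD lee_fin.
have e (c c' : R) : c != 0 -> c' != 0 -> 8 / (c * N) * (N / c') = 8 / (c * c').
  by move=> h h'; field; rewrite ?h ?h' ?gt_eqF.
rewrite e ?expf_neq0 ?pnatr_eq0//.
by lra.
Qed.

Theorem Ex_gapK_le t : (Ex P (gapK t) <= (N / 40 ^+ 2)%:E)%E.
Proof. by apply: Ex_gapK; exact: Ex_ratio. Qed.

End Tracking.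

Lemma Ex_sum (R : realType) (d : measure_display) (Om : measurableType d) (P : probability Om R)
    (h : nat -> Om -> R) t : (forall s, nnm (h s)) ->
  nnm (fun w => \sum_(s < t) h s w) /\
  (Ex P (fun w => \sum_(s < t) h s w)%R = \sum_(s < t) Ex P (h s))%E.
Proof.
move=> nh; elim: t => [|t [nt IH]].
  have -> : (fun w => \sum_(s < 0) h s w) = (fun=> 0) by apply/funext => w; rewrite big_ord0.
  by rewrite big_ord0 Ex_cst; split => //; exact: nnm_cst.
have -> : (fun w => \sum_(s < t.+1) h s w) = (fun w => \sum_(s < t) h s w + h t w).
  by apply/funext => w; rewrite big_ord_recr.
by split; [exact: nnmD|rewrite ExD// IH big_ord_recr].
Qed.

Lemma enorm_sum5 (R : realType) (n : nat) (a b c d e : 'rV[R]_n) :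
  enorm (a + b + c + d + e) ^+ 2 <=
  5 * (enorm a ^+ 2 + enorm b ^+ 2 + enorm c ^+ 2 + enorm d ^+ 2 + enorm e ^+ 2).
Proof.
rewrite -!dot_sqr /dot -!big_split mulr_sumr; apply: ler_sum => i _ /=; rewrite !mxE.
move: (a 0 i) (b 0 i) (c 0 i) (d 0 i) (e 0 i) => {}a {}b {}c {}d {}e.
rewrite -subr_ge0.
(* Lagrange identity: the defect in Cauchy-Schwarz is the sum of the ten squared differences. *)
have -> : 5 * (a * a + b * b + c * c + d * d + e * e) - (a + b + c + d + e) * (a + b + c + d + e) =
  (a - b) ^+ 2 + (a - c) ^+ 2 + (a - d) ^+ 2 + (a - e) ^+ 2 + (b - c) ^+ 2 + (b - d) ^+ 2 +
  (b - e) ^+ 2 + (c - d) ^+ 2 + (c - e) ^+ 2 + (d - e) ^+ 2 by ring.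
by rewrite !addr_ge0 ?sqr_ge0.
Qed.

(** The term [0 *: a'] gives the z-part literally the shape of [pen_grad] at penalty 0. *)
Lemma hypergrad_noise (R : realType) (m n : nat) (s : R) (u v v' a a' c c' : 'rV[R]_(m + n))
    (q : 'rV[R]_m) : s != 0 ->
  lsubmx u + s^-1 *: (lsubmx v - lsubmx v') - q =
  lsubmx (u - a) + s^-1 *: lsubmx (v - c) + (- s^-1) *: lsubmx (v' - c') +
  (s^-1 *: (lsubmx (s *: a + c) - lsubmx (0 *: a' + c')) - q).
Proof. by move=> s0; apply/rowP => i; rewrite !mxE; field. Qed.

Lemma enorm_scale_lsubmx (R : realType) (m n : nat) (c : R) (u : 'rV[R]_(m + n)) :
  enorm (c *: lsubmx u) ^+ 2 <= c ^+ 2 * enorm u ^+ 2.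
Proof.
rewrite enormZ exprMn real_normK ?num_real// ler_wpM2l ?sqr_ge0//.
by rewrite ler_sqr ?nnegrE ?enorm_ge0// enorm_lsubmx.
Qed.

Lemma error_sum_le (R : realType) (e1 e2 e3 e4 e5 q1 q2 q3 k1 k2 q4 c : R) :
  e1 <= q1 -> e2 <= k1 * q2 -> e3 <= k1 * q3 -> e4 <= k2 * q4 -> e5 <= c ->
  5 * (e1 + e2 + e3 + e4 + e5) <= 5 * q1 + 5 * k1 * (q2 + q3) + 5 * k2 * q4 + 5 * c.
Proof. by move=> *; lra. Qed.

(** The step size turns the curvature term into e/4 u^2. Polarising the inner product supplies - e/2
    u^2, so half of it survives; this is the part of the decrease that later pays for the squared
    steps. *)
Lemma descent_le (R : realType) (q e A C D S m u v : R) : 0 < q -> e = (32 * q)^-1 ->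
  `|A - C - - (e * D)| <= 8 * q * (e * u) ^+ 2 ->
  A - m + (S + (e / 2 * v ^+ 2 + e / 4 * u ^+ 2)) <=
  C - m + S + e / 2 * (u ^+ 2 - 2 * D + v ^+ 2).
Proof.
move=> q0 eE; have -> : 8 * q * (e * u) ^+ 2 = e / 4 * u ^+ 2.
  by rewrite eE; field; rewrite gt_eqF.
by rewrite ler_norml => /andP[_]; lra.
Qed.

Lemma delta_step (R : realType) (d d0 s a h D : R) : d <= d0 + s + 2 * D -> h <= a ->
  0 <= s -> 0 <= D -> D <= d0 -> 2^-1 * d + h + D <= d0 + (s + a) + 2 * D.
Proof. by move=> *; lra. Qed.

(** * Stationarity *)

Section Analysis.
Context (R : realType) (dx dy : nat) (dX dZ dO : measure_display).
Context (X : measurableType dX) (Z : measurableType dZ) (Om : measurableType dO).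
Context (DX : probability X R) (DZ : probability Z R) (P : probability Om R).
Context (F : 'rV[R]_(dx + dy) -> X -> R) (G : 'rV[R]_(dx + dy) -> Z -> R).
Context (f g : 'rV[R]_(dx + dy) -> R) (xi : fidx -> Om -> X) (zeta : gidx -> Om -> Z).
Context (mu Cf Lf Lg rhof rhog sbar ell Mf Mg : R).
Hypotheses (mu0 : 0 < mu) (Cf0 : 0 < Cf) (Lf0 : 0 < Lf) (Lg0 : 0 < Lg).
Hypotheses (rhog0 : 0 < rhog) (sbar0 : 0 < sbar).
Hypothesis BA : bilevel_assumption mu Cf Lf Lg rhof rhog sbar f g.
Hypotheses (Cfl : Cf <= ell) (Lfl : Lf <= ell) (Lgl : Lg <= ell) (rhogl : rhog <= ell).
Hypothesis muLg : mu <= Lg.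
Hypotheses (orcF : stochastic_oracle DX Mf f F) (orcG : stochastic_oracle DZ Mg g G).
Hypothesis fresh : fresh_samples P DX DZ xi zeta.
Context (sigma eps : R) (B : nat) (K : R -> nat).
Context (x0 : 'rV[R]_dx) (y0 : 'rV[R]_dy) (delta0 : R).
Hypotheses (B0 : (0 < B)%N) (sigma0 : 0 < sigma) (eps0 : 0 < eps) (sigmab : sigma <= sbar).
Hypothesis sigmaLf : sigma * Lf <= Lg.

Local Notation kappa := (ell / mu).
Local Notation L := (Lpen Lf Lg sigma).
Let N := mu * sigma ^+ 2 * eps ^+ 2 / Lg ^+ 2.
Let eta := (32 * (ell * kappa ^+ 3))^-1.
Let next := fun delta r : R =>
  2^-1 * delta + 8 * Lg ^+ 2 / mu ^+ 2 * r ^+ 2 + 128 ^+ 2 * N / mu.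

Hypothesis sigma_small : 128 * (ell * kappa ^+ 3) * sigma <= eps.
Hypothesis batch_large : (sigma ^+ 2 * Mf ^+ 2 + Mg ^+ 2) / B%:R <=
  mu ^+ 2 * sigma ^+ 2 * eps ^+ 2 / (64 ^+ 2 * Lg ^+ 2).
Hypothesis mK : forall k, measurable [set r | K r = k].
Hypothesis contract : forall x, 128 ^+ 2 * N / mu <= x ->
  (1 - mu / L) ^+ (K x) * (L * x) <= 2 / 128 ^+ 2 * N.
Hypothesis delta0_ge : 128 ^+ 2 * N / mu <= delta0.
Hypothesis gap_y0 : pen f g sigma (row_mx x0 y0) - pen_min f g sigma x0 <= 3 * (L * delta0).
Hypothesis gap_z0 : pen f g 0 (row_mx x0 y0) - pen_min f g 0 x0 <= 3 * (L * delta0).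

Local Notation run := (run F G xi zeta eta L^-1 sigma B K next x0 y0 delta0).
Local Notation run_count := (run_count F G xi zeta eta L^-1 sigma B K next x0 y0 delta0).
Local Notation run_y := (run_y F G xi zeta eta L^-1 sigma B K next x0 y0 delta0).
Local Notation run_z := (run_z F G xi zeta eta L^-1 sigma B K next x0 y0 delta0).
Local Notation noise_y := (noise_y F G f g xi zeta eta L^-1 sigma B K next x0 y0 delta0).
Local Notation noise_z := (noise_z F G g xi zeta eta L^-1 sigma B K next x0 y0 delta0).
Local Notation xt t := (fun w => st_x (run t w)).

Let df : forall p, differentiable f p. Proof. by have [] := ba_f_smooth BA. Qed.
Let dg : forall p, differentiable g p. Proof. by have [] := ba_g_smooth BA. Qed.

Let mnext d (T : measurableType d) (a b : T -> R) : measurable_fun setT a ->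
  measurable_fun setT b -> measurable_fun setT (fun t => next (a t) (b t)).
Proof.
move=> ma mb; apply: measurable_funD => //; apply: measurable_funD; apply: measurable_funM => //.
exact: measurable_funX.
Qed.

Let N0 : 0 < N.
Proof.
by rewrite divr_gt0 ?exprn_gt0 ?Lg0// mulr_gt0 ?exprn_gt0 ?eps0// mulr_gt0 ?exprn_gt0 ?mu0 ?sigma0.
Qed.
Let L0 : 0 < L. Proof. exact: (Lpen_gt0 Lf0 Lg0 (ltW sigma0)). Qed.
Let L2 : L <= 2 * Lg. Proof. by rewrite /Lpen mulr2n mulrDl mul1r lerD2r. Qed.
Let LgL : Lg <= L.
Proof. by rewrite /Lpen lerDr (mulr_ge0 (ltW sigma0) (ltW Lf0)). Qed.
Let muL : mu <= L. Proof. exact: (le_trans muLg LgL). Qed.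
Let lk0 : 0 < ell * kappa ^+ 3.
Proof.
have l0 := lt_le_trans Lg0 Lgl.
by rewrite mulr_gt0// exprn_gt0// divr_gt0.
Qed.
Let eta0 : 0 < eta. Proof. by rewrite invr_gt0 mulr_gt0. Qed.

Lemma run_state t : state_measurable F G eta L^-1 sigma B K next xi zeta x0 y0 delta0 t.
Proof. exact: (run_state_measurable orcF orcG fresh _ _ _ _ mK mnext). Qed.

Lemma gap_nnm s (u : Om -> 'rV[R]_dx) (v : Om -> 'rV[R]_dy) : 0 <= s <= sbar ->
  measurable_vec u -> measurable_vec v ->
  nnm (fun w => pen f g s (row_mx (u w) (v w)) - pen_min f g s (u w)).
Proof.
move=> sb mu' mv; have /andP[s0 _] := sb; split=> [|w].
  apply: measurable_funB.
    by apply: measurable_continuous_comp; [exact: (pen_continuous BA)|exact: measurable_vec_row].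
  by apply: measurable_continuous_comp => //; exact: (pen_min_continuous mu0 Lf0 Lg0 BA).
by rewrite subr_ge0; exact: (pen_min_le BA).
Qed.

Lemma noise_level_le : noise_level Mf Mg sigma B / (2 * mu) <= N / 64 ^+ 2.
Proof.
have -> : noise_level Mf Mg sigma B / (2 * mu) =
    (sigma ^+ 2 * Mf ^+ 2 + Mg ^+ 2) / B%:R / mu.
  rewrite /noise_level; set c := B%:R^-1; set a := _ + _.
  by field; rewrite gt_eqF.
rewrite ler_pdivrMr//; apply: (le_trans batch_large).
rewrite /N invfM; set c := (64 ^+ 2)^-1.
by rewrite le_eqVlt; apply/orP; left; apply/eqP; field; rewrite gt_eqF.
Qed.

Section Inner.
Context (s : R) (u : nat -> Om -> 'rV[R]_dy) (uk nz : nat -> nat -> Om -> 'rV[R]_dy).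
Hypothesis sr : 0 <= s <= sigma.
Hypothesis uk0 : forall t w, uk t 0%N w = u t w.
Hypothesis ukK : forall t w, uk t (run_count t w) w = u t.+1 w.
Hypothesis ukS : forall t k w, uk t k.+1 w =
  uk t k w - L^-1 *: (pen_gy f g s (st_x (run t w)) (uk t k w) + nz t k w).
Hypotheses (mu_ : forall t, measurable_vec (u t)) (muk : forall t k, measurable_vec (uk t k)).
Hypothesis nnz : forall t k, nnm (fun w => enorm (nz t k w) ^+ 2).
Hypothesis nz_le : forall t j k, (k < j)%N ->
  (Ex P (fun w => \1_[set w | run_count t w = j] w * enorm (nz t k w) ^+ 2)%R <=
   (noise_level Mf Mg sigma B)%:E * Ex P (\1_[set w | run_count t w = j]))%E.
Hypothesis start : forall w, pen f g s (row_mx (st_x (run 0 w)) (u 0%N w)) -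
  pen_min f g s (st_x (run 0 w)) <= 3 * (L * delta0).

Let sb : 0 <= s <= sbar.
Proof. by move: sr => /andP[-> /=] /le_trans; apply. Qed.
Let sL : Lpen Lf Lg s <= L.
Proof. by rewrite lerD2r ler_wpM2r ?(ltW Lf0)//; case/andP: sr. Qed.

(** One argument for both loops: s = sigma for y and s = 0 for z. They share the step 1/L, and L is
    a valid smoothness constant for either problem. *)
Lemma inner_gap t : (Ex P (fun w => pen f g s (row_mx (st_x (run t w)) (u t.+1 w)) -
    pen_min f g s (st_x (run t w)))%R <= (N / 40 ^+ 2)%:E)%E.
Proof.
pose gap t w := pen f g s (row_mx (st_x (run t w)) (u t w)) - pen_min f g s (st_x (run t w)).
pose gapK t w := pen f g s (row_mx (st_x (run t w)) (u t.+1 w)) - pen_min f g s (st_x (run t w)).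
have mx t' : measurable_vec (xt t') by have [] := run_state t'.
have md t' : measurable_fun setT (fun w => st_delta (run t' w)) by have [] := run_state t'.
have mc t' k : measurable [set w | run_count t' w = k].
  exact: (run_count_measurable orcF orcG fresh _ _ _ _ mK mnext).
apply: (@Ex_gapK_le R _ Om P mu Lg L N K gap gapK (fun t w => st_delta (run t w))
  (fun t w => enorm (st_x (run t.+1 w) - st_x (run t w)))) => //.
- by move=> t'; exact: gap_nnm.
- by move=> t'; exact: gap_nnm.
- move=> t' w; rewrite /gap /gapK; apply: (pen_gap_move mu0 Lf0 Lg0 BA) => //.
- move=> t'.
  pose a k w := pen f g s (row_mx (st_x (run t' w)) (uk t' k w)) - pen_min f g s (st_x (run t' w)).
  have na k : nnm (a k) by exact: gap_nnm.
  have step k w : a k.+1 w <= (1 - mu / L) * a k w + enorm (nz t' k w) ^+ 2 / (2 * L).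
    by rewrite /a ukS; exact: (pen_inexact_step Lf0 Lg0 BA).
  have e1 : gapK t' = (fun w => a (run_count t' w) w) by apply/funext => w; rewrite /a ukK.
  have e2 : gap t' = a 0%N by apply/funext => w; rewrite /a uk0.
  rewrite e1 e2.
  have V0 := noise_level_ge0 Mf Mg sigma B.
  have := @inner_loop R _ Om P a (fun k w => enorm (nz t' k w) ^+ 2) (run_count t') mu L
    (noise_level Mf Mg sigma B) mu0 muL V0 na (nnz t') (mc t') step (@nz_le t').
  move=> h; apply: le_trans (h _ _) _.
  + by rewrite -e1; exact: gap_nnm.
  + split=> [|w]; last first.
      by rewrite mulr_ge0 ?(na 0%N).2// exprn_ge0// subr_ge0 ler_pdivrMr// mul1r.
    apply: (measurable_nat_comp (h := fun k w => (1 - mu / L) ^+ k * a 0%N w)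
      (N := run_count t')) => // k.
    by apply: measurable_funM => //; exact: (na 0%N).1.
  + apply: leeD => //; rewrite lee_fin; exact: noise_level_le.
Qed.

End Inner.

Lemma gap_y_le t : (Ex P (fun w => pen f g sigma (row_mx (st_x (run t w)) (st_y (run t.+1 w))) -
    pen_min f g sigma (st_x (run t w)))%R <= (N / 40 ^+ 2)%:E)%E.
Proof.
apply: (@inner_gap sigma (fun t w => st_y (run t w)) run_y noise_y) => //.
- by rewrite lexx ltW.
- by move=> t' k w; exact: run_yS.
- by move=> t'; have [] := run_state t'.
- by move=> t' k; exact: (run_y_measurable orcF orcG fresh _ _ _ _ mK mnext).
- by move=> t' k; exact: (noise_y_nnm df dg orcF orcG fresh _ _ _ _ mK mnext).
- by move=> t' j k kj; exact: (noise_y_le df dg orcF orcG fresh _ _ _ B0 mK mnext).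
Qed.

Lemma gap_z_le t : (Ex P (fun w => pen f g 0 (row_mx (st_x (run t w)) (st_z (run t.+1 w))) -
    pen_min f g 0 (st_x (run t w)))%R <= (N / 40 ^+ 2)%:E)%E.
Proof.
apply: (@inner_gap 0 (fun t w => st_z (run t w)) run_z noise_z) => //.
- by rewrite lexx ltW.
- by move=> t' k w; exact: run_zS.
- by move=> t'; have [] := run_state t'.
- by move=> t' k; exact: (run_z_measurable orcF orcG fresh _ _ _ _ mK mnext).
- by move=> t' k; exact: (noise_z_nnm dg orcF orcG fresh _ _ _ _ mK mnext).
- by move=> t' j k kj; exact: (noise_z_le dg orcF orcG fresh _ _ _ B0 mK mnext).
Qed.

Let est t w : 'rV[R]_dx := hypergrad F G sigma B (xi^~ w) (zeta^~ w) t
  (st_x (run t w)) (st_y (run t.+1 w)) (st_z (run t.+1 w)).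

Let run_xS t w : st_x (run t.+1 w) = st_x (run t w) - eta *: est t w.
Proof. by []. Qed.

Let gphi t w : 'rV[R]_dx := grad (phi f g) (st_x (run t w)).

Let mx t : measurable_vec (fun w => st_x (run t w)). Proof. by have [] := run_state t. Qed.

Let my t : measurable_vec (fun w => st_y (run t w)). Proof. by have [] := run_state t. Qed.

Let mz t : measurable_vec (fun w => st_z (run t w)). Proof. by have [] := run_state t. Qed.

Let gphi_measurable t : measurable_vec (gphi t).
Proof.
move=> i; apply: (@measurable_partial_comp R _ _ Om Om _ (fun p _ => phi f g p) _ id) => //.
  move=> _; exact: (phi_continuous mu0 Cf0 Lf0 Lg0 rhog0 sbar0 BA Cfl Lfl Lgl rhogl muLg).
move=> _ p.
exact: (phi_derivable mu0 Cf0 Lf0 Lg0 rhog0 sbar0 BA Cfl Lfl Lgl rhogl muLg).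
Qed.

Let est_measurable t : measurable_vec (est t).
Proof.
have mF p : measurable_fun setT (F p).
  by have /integrableP[/measurable_EFinP] := so_integrable orcF p.
have mG p : measurable_fun setT (G p).
  by have /integrableP[/measurable_EFinP] := so_integrable orcG p.
apply: hypergrad_measurable => //.
- by move=> s p; exact: so_differentiable orcF s p.
- by move=> s p; exact: so_differentiable orcG s p.
- by move=> i; exact: fs_xi_meas fresh _.
- by move=> b i; exact: fs_zeta_meas fresh _.
Qed.

Let pt_y t w := row_mx (st_x (run t w)) (st_y (run t.+1 w)).
Let pt_z t w := row_mx (st_x (run t w)) (st_z (run t.+1 w)).
Let sqF t w := enorm (batchF F xi B t None w (pt_y t w) - grad f (pt_y t w)) ^+ 2.
Let sqGy t w := enorm (batchG G zeta B true t None w (pt_y t w) - grad g (pt_y t w)) ^+ 2.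
Let sqGz t w := enorm (batchG G zeta B false t None w (pt_z t w) - grad g (pt_z t w)) ^+ 2.
Let gap_y t w := pen f g sigma (pt_y t w) - pen_min f g sigma (st_x (run t w)).
Let gap_z t w := pen f g 0 (pt_z t w) - pen_min f g 0 (st_x (run t w)).

Let pt_y_measurable t : measurable_vec (pt_y t). Proof. exact: measurable_vec_row. Qed.
Let pt_z_measurable t : measurable_vec (pt_z t). Proof. exact: measurable_vec_row. Qed.

Let sqF_nnm t : nnm (sqF t).
Proof.
apply: nnm_enorm2; apply: measurable_vecB; last exact: grad_measurable.
exact: (batchF_measurable orcF fresh).
Qed.

Let sqGy_nnm t : nnm (sqGy t).
Proof.
apply: nnm_enorm2; apply: measurable_vecB; last exact: grad_measurable.
exact: (batchG_measurable orcG fresh).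
Qed.

Let sqGz_nnm t : nnm (sqGz t).
Proof.
apply: nnm_enorm2; apply: measurable_vecB; last exact: grad_measurable.
exact: (batchG_measurable orcG fresh).
Qed.

Let gap_y_nnm t : nnm (gap_y t).
Proof. by apply: gap_nnm => //; rewrite ltW. Qed.

Let gap_z_nnm t : nnm (gap_z t).
Proof. by apply: gap_nnm => //; rewrite lexx ltW. Qed.

Let sqF_le t : (Ex P (sqF t) <= (Mf ^+ 2 / B%:R)%:E)%E.
Proof. exact: (outer_noiseF df orcF orcG fresh eta L^-1 sigma B0 mK mnext x0 y0 delta0 t). Qed.

Let sqGy_le t : (Ex P (sqGy t) <= (Mg ^+ 2 / B%:R)%:E)%E.
Proof. exact: (outer_noiseG_y dg orcF orcG fresh eta L^-1 sigma B0 mK mnext x0 y0 delta0 t). Qed.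

Let sqGz_le t : (Ex P (sqGz t) <= (Mg ^+ 2 / B%:R)%:E)%E.
Proof. exact: (outer_noiseG_z dg orcF orcG fresh eta L^-1 sigma B0 mK mnext x0 y0 delta0 t). Qed.

Let c1 : R := 5 * (sigma ^+ 2)^-1.
Let c2 : R := 5 * (64 * Lg ^+ 2 / (mu * sigma ^+ 2)).
Let c3 : R := 5 * (12 * (ell * kappa ^+ 3) * sigma) ^+ 2.

(** Five sources of error, whence the factor 5: three batch noises, the inexact inner solutions, and
    the penalty bias. *)
Lemma est_error_le t w : enorm (est t w - gphi t w) ^+ 2 <=
  5 * sqF t w + c1 * (sqGy t w + sqGz t w) + c2 * (gap_y t w + gap_z t w) + c3.
Proof.
have s20 : 0 < sigma ^+ 2 by rewrite exprn_gt0.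
have sb : 0 < sigma <= sbar by rewrite sigma0.
have [b1 [b2 [eb h1 h2]]] := hypergrad_error mu0 Cf0 Lf0 Lg0 rhog0 sbar0 BA Cfl Lfl Lgl rhogl
  muLg (st_x (run t w)) (st_y (run t.+1 w)) (st_z (run t.+1 w)) sb sigmaLf.
pose eF := lsubmx (batchF F xi B t None w (pt_y t w) - grad f (pt_y t w)).
pose eGy := lsubmx (batchG G zeta B true t None w (pt_y t w) - grad g (pt_y t w)).
pose eGz := lsubmx (batchG G zeta B false t None w (pt_z t w) - grad g (pt_z t w)).
have E : est t w - gphi t w = eF + sigma^-1 *: eGy + (- sigma^-1) *: eGz + b1 + b2.
  by rewrite -[RHS]addrA -eb; apply: hypergrad_noise; rewrite gt_eqF.
rewrite E; apply: le_trans (enorm_sum5 _ _ _ _ _) _.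
have eF2 : enorm eF ^+ 2 <= sqF t w.
  have := enorm_scale_lsubmx 1 (batchF F xi B t None w (pt_y t w) - grad f (pt_y t w)).
  by rewrite scale1r expr1n mul1r.
have eGy2 : enorm (sigma^-1 *: eGy) ^+ 2 <= (sigma ^+ 2)^-1 * sqGy t w.
  by rewrite -exprVn; exact: enorm_scale_lsubmx.
have eGz2 : enorm ((- sigma^-1) *: eGz) ^+ 2 <= (sigma ^+ 2)^-1 * sqGz t w.
  by rewrite -exprVn -[_^-1 ^+ 2]sqrrN; exact: enorm_scale_lsubmx.
have eb2 : enorm b2 ^+ 2 <= (12 * (ell * kappa ^+ 3) * sigma) ^+ 2.
  rewrite ler_sqr ?nnegrE ?enorm_ge0//.
  exact: (mulr_ge0 (mulr_ge0 (ler0n _ 12) (ltW lk0)) (ltW sigma0)).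
exact: error_sum_le eF2 eGy2 eGz2 h1 eb2.
Qed.

(** In units of eps^2: 640 / 40^2 = 0.4 from the gaps, 5 (12/128)^2 < 0.05 from the bias, and 10 /
    64^2 < 0.01 from the batches. *)
Lemma est_error_const : 5 * (Mf ^+ 2 / B%:R) + c1 * (Mg ^+ 2 / B%:R + Mg ^+ 2 / B%:R) +
  c2 * (N / 40 ^+ 2 + N / 40 ^+ 2) + c3 <= eps ^+ 2 / 2.
Proof.
have s20 : 0 < sigma ^+ 2 by rewrite exprn_gt0.
have e2 : c2 * (N / 40 ^+ 2 + N / 40 ^+ 2) = 640 / 40 ^+ 2 * eps ^+ 2.
  have p40 : (40 ^+ 2 : R) != 0 by rewrite expf_neq0// pnatr_eq0.
  rewrite /c2 /N; move: p40; move: (40 ^+ 2 : R) => c p40.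
  by field; rewrite p40 !gt_eqF.
have e3 : c3 <= 5 * (12 / 128) ^+ 2 * eps ^+ 2.
  rewrite /c3 -[leRHS]mulrA -exprMn ler_pM2l// ler_sqr ?nnegrE; last first.
  - by rewrite mulr_ge0// ?divr_ge0// ltW.
  - exact: (mulr_ge0 (mulr_ge0 (ler0n _ 12) (ltW lk0)) (ltW sigma0)).
  by move: sigma_small; set q := ell * _; lra.
have e1 : 5 * (Mf ^+ 2 / B%:R) + c1 * (Mg ^+ 2 / B%:R + Mg ^+ 2 / B%:R) <= 10 / 64 ^+ 2 * eps ^+ 2.
  have h : 5 * (Mf ^+ 2 / B%:R) + c1 * (Mg ^+ 2 / B%:R + Mg ^+ 2 / B%:R) <=
      10 * ((sigma ^+ 2)^-1 * ((sigma ^+ 2 * Mf ^+ 2 + Mg ^+ 2) / B%:R)).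
    have -> : 10 * ((sigma ^+ 2)^-1 * ((sigma ^+ 2 * Mf ^+ 2 + Mg ^+ 2) / B%:R)) =
        10 * (Mf ^+ 2 / B%:R) + c1 * (Mg ^+ 2 / B%:R + Mg ^+ 2 / B%:R).
      by rewrite /c1; set b := B%:R^-1; field; rewrite gt_eqF.
    have : 0 <= Mf ^+ 2 / B%:R by rewrite divr_ge0// sqr_ge0.
    by move: (c1 * _) (Mf ^+ 2 / _) => a1 a2; lra.
  apply: (le_trans h); rewrite -mulrA ler_pM2l// ler_pdivrMl//; apply: (le_trans batch_large).
  have -> : sigma ^+ 2 * ((64 ^+ 2)^-1 * eps ^+ 2) =
     sigma ^+ 2 * eps ^+ 2 * (64 ^+ 2)^-1 * Lg ^+ 2 * (Lg ^+ 2)^-1.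
    by rewrite mulfK ?expf_neq0 ?gt_eqF//; set c := (64 ^+ 2)^-1; ring.
  have -> : mu ^+ 2 * sigma ^+ 2 * eps ^+ 2 / (64 ^+ 2 * Lg ^+ 2) =
     sigma ^+ 2 * eps ^+ 2 * (64 ^+ 2)^-1 * mu ^+ 2 * (Lg ^+ 2)^-1.
    by rewrite invfM; set c := (64 ^+ 2)^-1; ring.
  rewrite ler_wpM2r ?invr_ge0 ?sqr_ge0// ler_wpM2l//.
    by rewrite mulr_ge0 ?invr_ge0 ?exprn_ge0// mulr_ge0 ?sqr_ge0.
  by rewrite ler_sqr ?nnegrE// ltW.
rewrite e2; move: e1 e3; have := sqr_ge0 eps; move: (eps ^+ 2) (5 * (Mf ^+ 2 / _) + _) c3.
by move=> e a1 a2; lra.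
Qed.

Lemma est_error t :
  (Ex P (fun w => enorm (est t w - gphi t w) ^+ 2)%R <= (eps ^+ 2 / 2)%:E)%E.
Proof.
have c10 : 0 <= c1 by rewrite mulr_ge0// invr_ge0 exprn_ge0// ltW.
have c20 : 0 <= c2.
  by rewrite mulr_ge0// divr_ge0 ?mulr_ge0 ?sqr_ge0// ltW.
have c30 : 0 <= c3 by rewrite mulr_ge0// sqr_ge0.
have nE : nnm (fun w => enorm (est t w - gphi t w) ^+ 2).
  by apply: nnm_enorm2; exact: measurable_vecB.
have nF := sqF_nnm t.
have nG2 := nnmD (sqGy_nnm t) (sqGz_nnm t); have ng2 := nnmD (gap_y_nnm t) (gap_z_nnm t).
have n1 := nnmD (nnmZ (ler0n _ 5) nF) (nnmZ c10 nG2).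
have n2 := nnmD n1 (nnmZ c20 ng2).
have h := Ex_le P nE (nnmD n2 (nnm_cst Om c30)) (est_error_le t).
apply: (le_trans h).
rewrite (ExD P n2 (nnm_cst Om c30)) (ExD P n1 (nnmZ c20 ng2)).
rewrite (ExD P (nnmZ (ler0n _ 5) nF) (nnmZ c10 nG2)).
rewrite (ExZ P (ler0n _ 5) nF) (ExZ P c10 nG2) (ExZ P c20 ng2).
rewrite (ExD P (sqGy_nnm t) (sqGz_nnm t)) (ExD P (gap_y_nnm t) (gap_z_nnm t)) Ex_cst.
apply: (@le_trans _ _ (5%:E * (Mf ^+ 2 / B%:R)%:E +
   c1%:E * ((Mg ^+ 2 / B%:R)%:E + (Mg ^+ 2 / B%:R)%:E) +
   c2%:E * ((N / 40 ^+ 2)%:E + (N / 40 ^+ 2)%:E) + c3%:E)%E); last first.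
  by rewrite -!EFinD lee_fin; exact: est_error_const.
apply: leeD => //; apply: leeD; first apply: leeD.
- by apply: lee_wpmul2l; [rewrite lee_fin|exact: sqF_le].
- by apply: lee_wpmul2l; [rewrite lee_fin|apply: leeD; [exact: sqGy_le|exact: sqGz_le]].
- by apply: lee_wpmul2l; [rewrite lee_fin|apply: leeD; [exact: gap_y_le|exact: gap_z_le]].
Qed.

Context (b : R).
Hypothesis phi_bounded : has_lbound (range (phi f g)).
Hypothesis phi_gap : phi f g x0 - inf (range (phi f g)) <= b.

Let m := inf (range (phi f g)).

(** The gradient part yields stationarity, the estimate part controls the squared steps that feed
    delta. *)
Let drop t w : R := eta / 2 * enorm (gphi t w) ^+ 2 + eta / 4 * enorm (est t w) ^+ 2.

Let drop_nnm t : nnm (drop t).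
Proof.
have e2 : 0 <= eta / 2 by rewrite divr_ge0// ltW.
have e4 : 0 <= eta / 4 by rewrite divr_ge0// ltW.
by apply: nnmD; apply: nnmZ => //; exact: nnm_enorm2.
Qed.

(** A Lyapunov function: value gap plus all decreases so far. It is nonnegative, so the descent can
    be iterated in the extended reals without subtracting expectations. *)
Let level t w : R := phi f g (st_x (run t w)) - m + \sum_(s < t) drop s w.

Let phi_ge x : 0 <= phi f g x - m.
Proof. by rewrite subr_ge0; apply: ge_inf => //; exists x. Qed.

Let level_nnm t : nnm (level t).
Proof.
apply: nnmD; last by have [] := Ex_sum P t drop_nnm.
split=> [|w]; last exact: phi_ge.
apply: measurable_funB => //; apply: measurable_continuous_comp => //.
exact: (phi_continuous mu0 Cf0 Lf0 Lg0 rhog0 sbar0 BA Cfl Lfl Lgl rhogl muLg).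
Qed.

Lemma level_step t w : level t.+1 w <= level t w + eta / 2 * enorm (est t w - gphi t w) ^+ 2.
Proof.
rewrite /level big_ord_recr /=.
have := phi_expand mu0 Cf0 Lf0 Lg0 rhog0 sbar0 BA Cfl Lfl Lgl rhogl muLg (st_x (run t w))
  (- (eta *: est t w)).
rewrite -run_xS -/(gphi t w) enormN enormZ (gtr0_norm eta0) dotNr dotZr /drop enorm_sqrB dotC.
exact: descent_le.
Qed.

Lemma Ex_level t :
  (Ex P (level t) <= (phi f g x0 - m + t%:R * (eta * eps ^+ 2 / 4))%:E)%E.
Proof.
elim: t => [|t IH].
  rewrite mul0r addr0 -(Ex_cst P); apply: Ex_le; first exact: level_nnm.
    by apply: nnm_cst; exact: phi_ge.
  by move=> w; rewrite /level big_ord0 addr0.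
have e2 : 0 <= eta / 2 by rewrite divr_ge0// ltW.
have nE : nnm (fun w => enorm (est t w - gphi t w) ^+ 2).
  by apply: nnm_enorm2; exact: measurable_vecB.
have h : (Ex P (level t.+1) <= 1%:E * Ex P (level t) +
    (eta / 2)%:E * Ex P (fun w => enorm (est t w - gphi t w) ^+ 2)%R)%E.
  by apply: Ex_le_add => // w; rewrite mul1r; exact: level_step.
apply: (le_trans h); rewrite mul1e.
have e20 : (0 <= (eta / 2)%:E)%E by rewrite lee_fin.
apply: (le_trans (leeD IH (lee_wpmul2l e20 (est_error t)))).
rewrite -EFinM -EFinD lee_fin -[t.+1%:R]natr1 mulrDl mul1r.
by move: (t%:R * _) (phi f g x0 - m) => u v; lra.
Qed.

Lemma Ex_drop t :
  (Ex P (fun w => \sum_(s < t) drop s w)%R <= (b + t%:R * (eta * eps ^+ 2 / 4))%:E)%E.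
Proof.
apply: (@le_trans _ _ (Ex P (level t))).
  apply: Ex_le => // [|w]; first by have [] := Ex_sum P t drop_nnm.
  by rewrite /level lerDr phi_ge.
by apply: (le_trans (Ex_level t)); rewrite lee_fin lerD2r.
Qed.

Theorem stationary T : 4 * b < T%:R * (eta * eps ^+ 2) ->
  exists t, (t < T)%N /\ (Ex P (fun w => enorm (grad (phi f g) (st_x (run t w)))) <= eps%:E)%E.
Proof.
move=> bT; apply/not_existsP => H.
have nG t : nnm (fun w => enorm (gphi t w) ^+ 2) by exact: nnm_enorm2.
have big t : (t < T)%N -> ((eps ^+ 2)%:E <= Ex P (fun w => enorm (gphi t w) ^+ 2)%R)%E.
  move=> tT; rewrite leNgt; apply/negP => lt; apply: (H t); split => //.
  (* The passage from second to first moment uses q <= q^2 / (2 eps) + eps / 2 in place of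
     Jensen. *)
  have c0 : 0 <= (2 * eps)^-1 by rewrite invr_ge0 mulr_ge0// ltW.
  have n1 : nnm (fun w => enorm (gphi t w)).
    by split=> [|w]; [exact: measurable_enorm|exact: enorm_ge0].
  have n2 : nnm (fun _ : Om => eps / 2) by apply: nnm_cst; rewrite divr_ge0// ltW.
  have h : (Ex P (fun w => enorm (gphi t w)) <=
     (2 * eps)^-1%:E * Ex P (fun w => enorm (gphi t w) ^+ 2)%R + 1%:E * Ex P (fun=> eps / 2)%R)%E.
    apply: Ex_le_add => // w; rewrite mul1r -(ler_pM2l (_ : 0 < 2 * eps)) ?mulr_gt0//.
    have := sqr_ge0 (enorm (gphi t w) - eps); move: (enorm (gphi t w)) => q h.
    have -> : 2 * eps * ((2 * eps)^-1 * q ^+ 2 + eps / 2) = q ^+ 2 + eps ^+ 2.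
      by field; rewrite gt_eqF.
    by move: h; rewrite sqrrB -mulr_natl; lra.
  apply: (le_trans h); rewrite mul1e Ex_cst.
  apply: (@le_trans _ _ ((2 * eps)^-1%:E * (eps ^+ 2)%:E + (eps / 2)%:E)%E).
    by apply: leeD => //; apply: lee_wpmul2l; rewrite ?lee_fin//; exact: ltW.
  rewrite -EFinM -EFinD lee_fin le_eqVlt; apply/orP; left; apply/eqP.
  by field; rewrite gt_eqF.
have e2 : 0 <= eta / 2 by rewrite divr_ge0// ltW.
have e4 : 0 <= eta / 4 by rewrite divr_ge0// ltW.
(* If all T gradients were large, the total drop would be at least T eta eps^2 / 2; [Ex_drop] allows
   b + T eta eps^2 / 4, against the choice of T. *)
have lower : ((T%:R * (eta / 2 * eps ^+ 2))%:E <= Ex P (fun w => \sum_(s < T) drop s w)%R)%E.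
  have [_ ->] := Ex_sum P T drop_nnm.
  have -> : ((T%:R * (eta / 2 * eps ^+ 2))%:E = \sum_(s < T) (eta / 2 * eps ^+ 2)%:E)%E.
    by rewrite sumEFin sumr_const card_ord mulr_natl.
  apply: lee_sum => s _; rewrite EFinM.
  apply: (@le_trans _ _ ((eta / 2)%:E * Ex P (fun w => enorm (gphi s w) ^+ 2)%R)%E).
    by apply: lee_wpmul2l; [rewrite lee_fin|exact: big].
  rewrite -ExZ//; apply: Ex_le => // [|w]; first exact: nnmZ.
  by rewrite lerDl mulr_ge0 ?sqr_ge0.
have := le_trans lower (Ex_drop T); rewrite lee_fin.
by move: bT; move: (T%:R : R) (eps ^+ 2) => TT q; lra.
Qed.

Let run_deltaS t w : st_delta (run t.+1 w) = 2^-1 * st_delta (run t w) +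
  8 * Lg ^+ 2 / mu ^+ 2 * (eta * enorm (est t w)) ^+ 2 + 128 ^+ 2 * N / mu.
Proof.
have -> : st_delta (run t.+1 w) =
  next (st_delta (run t w)) (enorm (st_x (run t.+1 w) - st_x (run t w))) by [].
have -> : st_x (run t.+1 w) - st_x (run t w) = - (eta *: est t w).
  by rewrite run_xS addrAC subrr add0r.
by rewrite enormN enormZ (gtr0_norm eta0).
Qed.

Let c4 : R := 32 * Lg ^+ 2 * eta / mu ^+ 2.
Let D4 : R := 128 ^+ 2 * N / mu.

Let c40 : 0 <= c4.
Proof. by rewrite divr_ge0 ?sqr_ge0// mulr_ge0 ?(ltW eta0)// mulr_ge0 ?sqr_ge0. Qed.

Let D40 : 0 <= D4.
Proof. by rewrite divr_ge0 ?(ltW mu0)// mulr_ge0 ?(ltW N0)// exprn_ge0. Qed.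

(** Each squared step is paid for by a [drop], and the constant increments, halved at every later
    step, sum to at most 2 D4. *)
Lemma delta_le t w : st_delta (run t w) <= delta0 + c4 * \sum_(s < t) drop s w + 2 * D4.
Proof.
elim: t => [|t IH]; first by rewrite big_ord0 mulr0 addr0 /= lerDl mulr_ge0.
rewrite run_deltaS big_ord_recr /= [in leRHS]mulrDr.
have h : 8 * Lg ^+ 2 / mu ^+ 2 * (eta * enorm (est t w)) ^+ 2 <= c4 * drop t w.
  have -> : 8 * Lg ^+ 2 / mu ^+ 2 * (eta * enorm (est t w)) ^+ 2 =
      c4 * (eta / 4 * enorm (est t w) ^+ 2) by rewrite /c4; field; rewrite gt_eqF.
  by rewrite ler_wpM2l// /drop lerDr mulr_ge0 ?sqr_ge0// divr_ge0// ltW.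
have s0 : 0 <= c4 * \sum_(s < t) drop s w.
  by rewrite mulr_ge0//; apply: sumr_ge0 => s _; exact: (drop_nnm s).2.
exact: delta_step IH h s0 D40 delta0_ge.
Qed.

Lemma run_delta_ge t w : D4 <= st_delta (run t w).
Proof.
elim: t => [|t IH]; first exact: delta0_ge.
rewrite run_deltaS lerDr addr_ge0//.
  by rewrite mulr_ge0// (le_trans D40 IH).
by rewrite mulr_ge0 ?sqr_ge0// divr_ge0 ?sqr_ge0// mulr_ge0 ?sqr_ge0.
Qed.

Let delta_nnm t : nnm (fun w => st_delta (run t w)).
Proof.
split=> [|w]; first by have [] := run_state t.
exact: (le_trans D40 (run_delta_ge t w)).
Qed.

Lemma Ex_delta t T : (t <= T)%N -> (Ex P (fun w => st_delta (run t w)) <=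
  (delta0 + c4 * (b + T%:R * (eta * eps ^+ 2 / 4)) + 2 * D4)%:E)%E.
Proof.
move=> tT.
have [nS _] := Ex_sum P t drop_nnm.
have d0 : 0 <= delta0 + 2 * D4.
  by apply: addr_ge0; [exact: (le_trans D40 delta0_ge)|exact: mulr_ge0].
have h : (Ex P (fun w => st_delta (run t w)) <= c4%:E * Ex P (fun w => \sum_(s < t) drop s w)%R +
    1%:E * Ex P (fun=> delta0 + 2 * D4)%R)%E.
  apply: Ex_le_add => // w.
  by rewrite mul1r addrA [_ + delta0]addrC; exact: delta_le.
apply: (le_trans h); rewrite mul1e Ex_cst.
have c00 : (0 <= c4%:E)%E by rewrite lee_fin.
apply: (le_trans (leeD (lee_wpmul2l c00 (Ex_drop t)) (lexx _))).
rewrite -EFinD lee_fin addrA [_ + delta0]addrC lerD2r lerD2l.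
rewrite ler_wpM2l// lerD2l ler_wpM2r ?ler_nat//.
by rewrite divr_ge0// mulr_ge0 ?sqr_ge0// ltW.
Qed.

(** The count is a random function of delta; an affine majorant c + d x reduces its mean to that of
    delta. *)
Lemma Ex_calls T c d : 0 <= c -> 0 <= d ->
  (forall x, 128 ^+ 2 * N / mu <= x -> (K x).+1%:R <= c + d * x) ->
  (Ex P (fun w => (F2BSA_calls F G eta L^-1 sigma B K next (xi^~ w) (zeta^~ w) x0 y0 delta0 T)%:R)
   <= (3 * B%:R * T%:R * (c + d * (delta0 + c4 * (b + T%:R * (eta * eps ^+ 2 / 4)) + 2 * D4)))%:E)%E.
Proof.
move=> c0 d0 Kx; set D := delta0 + _ + _.
pose h (s : nat) w : R := (run_count s w).+1%:R.
have nh s : nnm (h s).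
  split=> [|w]; last exact: ler0n.
  apply: (measurable_nat_comp (h := fun k _ => k.+1%:R) (N := run_count s)) => k //.
  by have [_ _ _ md] := run_state s; exact: count_measurable.
have -> : (fun w => (F2BSA_calls F G eta L^-1 sigma B K next (xi^~ w) (zeta^~ w) x0 y0 delta0 T)%:R) =
    (fun w => 3 * B%:R * \sum_(s < T) h s w).
  by apply/funext => w; rewrite /F2BSA_calls natr_sum mulr_sumr; apply: eq_bigr => s _; rewrite !natrM.
have [nS ES] := Ex_sum P T nh.
have B3 : 0 <= 3 * B%:R :> R by rewrite mulr_ge0.
rewrite (ExZ P B3 nS) ES -[X in (_ <= X%:E)%E]mulrA (EFinM (3 * B%:R)).
apply: lee_wpmul2l; first by rewrite lee_fin.
have -> : ((T%:R * (c + d * D))%:E = \sum_(s < T) (c + d * D)%:E)%E.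
  by rewrite sumEFin sumr_const card_ord mulr_natl.
apply: lee_sum => s _.
have e : (Ex P (h s) <= d%:E * Ex P (fun w => st_delta (run s w)) + 1%:E * Ex P (fun=> c)%R)%E.
  apply: Ex_le_add => // w.
  by rewrite mul1r addrC; apply: Kx; exact: run_delta_ge.
apply: (le_trans e); rewrite mul1e Ex_cst.
have -> : ((c + d * D)%:E = d%:E * D%:E + c%:E)%E by rewrite addrC.
have d00 : (0 <= d%:E)%E by rewrite lee_fin.
exact: leeD (lee_wpmul2l d00 (Ex_delta (ltnW (ltn_ord s)))) (lexx _).
Qed.

End Analysis.

(** * Choice of constants, rounding, and logarithmic counts *)

(** * Parameters and oracle calls *)

Lemma ceiln_le_nat (R : realType) (r : R) (n : nat) : (ceiln r <= n)%N = (r <= n%:R).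
Proof.
rewrite /ceiln -lez_nat gez0_abs ?ceil_ge0 ?(lt_le_trans (ltrN10 R))// ?le_max ?lexx//.
by rewrite ceil_le_int ge_max ler0n.
Qed.

Lemma ceiln_ge (R : realType) (r : R) : r <= (ceiln r)%:R.
Proof. by rewrite -ceiln_le_nat. Qed.

Lemma ceiln_lt (R : realType) (r : R) : 0 <= r -> (ceiln r)%:R <= r + 1.
Proof.
move=> r0; case E : (ceiln r) => [|n]; first by rewrite addr_ge0.
have : ~~ (ceiln r <= n)%N by rewrite E ltnn.
by rewrite ceiln_le_nat -ltNge -natr1 lerD2r => /ltW.
Qed.

Lemma measurable_ceiln (R : realType) (d : measure_display) (T : measurableType d) (h : T -> R) k :
  measurable_fun setT h -> measurable [set t | ceiln (h t) = k].
Proof.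
move=> mh; have m n : measurable [set t | (ceiln (h t) <= n)%N].
  have -> : [set t | (ceiln (h t) <= n)%N] = setT `&` h @^-1` `]-oo, n%:R].
    by rewrite setTI; apply/predeqP => t; rewrite /preimage/= in_itv/= -ceiln_le_nat.
  exact: mh.
case: k => [|k].
  have -> : [set t | ceiln (h t) = 0%N] = [set t | (ceiln (h t) <= 0)%N]; last exact: m.
  by apply/seteqP; split => t /=; rewrite leqn0 => /eqP.
have -> : [set t | ceiln (h t) = k.+1] =
    [set t | (ceiln (h t) <= k.+1)%N] `\` [set t | (ceiln (h t) <= k)%N].
  apply/seteqP; split => t /=; first by move=> ->; rewrite leqnn ltnn.
  by move=> [a /negP]; rewrite -ltnNge => b; apply/eqP; rewrite eqn_leq a b.
exact: measurableD.
Qed.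

(** The tangent of the concave logarithm at a, with its constant -1 dropped. *)
Lemma ln_le_div (R : realType) (a u : R) : 0 < a -> 0 < u -> ln u <= ln a + u / a.
Proof.
move=> a0 u0; have ua : 0 < u / a by rewrite divr_gt0.
have -> : ln u = ln a + ln (u / a).
  by rewrite -lnM ?posrE// mulrC divfK// gt_eqF.
rewrite lerD2l (le_trans _ (_ : u / a - 1 <= _)) ?gerBl//.
have := @le_ln1Dx R (u / a - 1); rewrite [1 + _]addrC subrK; apply.
by rewrite ltrBrDl subrr.
Qed.

Lemma common_threshold (R : realType) (s : seq R) : all (fun c => 0 < c) s ->
  exists2 e0, 0 < e0 & forall e, e <= e0 -> all (fun c => e <= c) s.
Proof.
elim: s => [_|c s IH /= /andP[c0 /IH[e0 e00 H]]]; first by exists 1.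
exists (Num.min c e0) => [|e]; first by rewrite lt_min c0.
by rewrite le_min => /andP[-> /H].
Qed.

(** With u = Lg x / N the count makes the contraction factor at most u^-2: a factor 2 in the
    constant 4 covers L <= 2 Lg, the other is the exponent. One power of u cancels L x, the second
    is at least 128^2 by the floor on x. *)
Lemma inner_contraction (R : realType) (mu Lg L N x : R) (k : nat) :
  0 < mu -> mu <= Lg -> Lg <= L -> L <= 2 * Lg -> 0 < N -> 128 ^+ 2 * N / mu <= x ->
  4 * (Lg / mu * ln (Lg * x / N)) <= k%:R -> (1 - mu / L) ^+ k * (L * x) <= 2 / 128 ^+ 2 * N.
Proof.
move=> mu0 muL LgL L2 N0 xN hk.
have Lg0 := lt_le_trans mu0 muL; have L0 := lt_le_trans Lg0 LgL.
have c0 : (0 : R) < 128 ^+ 2 by rewrite exprn_gt0.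
have x0 : 0 < x by apply: lt_le_trans xN; rewrite divr_gt0// mulr_gt0.
set u := Lg * x / N in hk; have u0 : 0 < u by rewrite divr_gt0// mulr_gt0.
have uc : 128 ^+ 2 <= u.
  rewrite ler_pdivlMr//; have := ler_wpM2l (ltW mu0) xN.
  rewrite mulrC divfK ?gt_eqF// => /le_trans; apply.
  by rewrite ler_wpM2r// ltW.
have lnu : 0 <= ln u by rewrite ln_ge0// (le_trans _ uc)// expr_ge1// ler1n.
have step : (1 - mu / L) ^+ k <= u ^- 2.
  apply: (@le_trans _ _ (expR (- (mu / L)) ^+ k)).
    apply: lerXn2r; rewrite ?nnegrE ?expR_ge0//; last exact: expR_ge1Dx.
    by rewrite subr_ge0 ler_pdivrMr// mul1r (le_trans muL).
  have -> : u ^- 2 = expR (- (2 * ln u)) by rewrite expRN expRM_natl lnK.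
  rewrite -expRM_natl ler_expR mulrN lerN2.
  apply: (@le_trans _ _ (mu / (2 * Lg) * k%:R)).
    have -> : 2 * ln u = mu / (2 * Lg) * (4 * (Lg / mu * ln u)) by field; rewrite !gt_eqF.
    by rewrite ler_wpM2l// divr_ge0 ?mulr_ge0// ltW.
  rewrite mulrC ler_wpM2l// ler_wpM2l ?(ltW mu0)// lef_pV2 ?posrE// mulr_gt0//.
apply: (@le_trans _ _ (u ^- 2 * (2 * (u * N)))).
  apply: ler_pM => //; last first.
  - by rewrite /u divfK ?gt_eqF// mulrA ler_wpM2r// ltW.
  - by rewrite mulr_ge0 ?(ltW x0) ?(ltW L0).
  by rewrite exprn_ge0// subr_ge0 ler_pdivrMr// mul1r (le_trans muL).
have -> : u ^- 2 * (2 * (u * N)) = 2 / u * N by field; rewrite gt_eqF.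
by rewrite ler_wpM2r ?(ltW N0)// ler_wpM2l// lef_pV2 ?posrE.
Qed.

(* The count grows only logarithmically: [a] is the scale at which the logarithm is linearised. *)
Lemma inner_count_le (R : realType) (N mu Lg x a : R) :
  0 < mu -> mu <= Lg -> 0 < N -> 128 ^+ 2 * N / mu <= x -> 0 < a ->
  (ceiln (4 * (Lg / mu * ln (Lg * x / N)))).+1%:R <=
  (4 * (Lg / mu) * ln a + 2) + 4 * (Lg / mu) * (Lg / N / a) * x.
Proof.
move=> mu0 muL N0 xN a0; have Lg0 := lt_le_trans mu0 muL.
have c0 : (0 : R) < 128 ^+ 2 by rewrite exprn_gt0.
have x0 : 0 < x by apply: lt_le_trans xN; rewrite divr_gt0// mulr_gt0.
set u := Lg * x / N; have u0 : 0 < u by rewrite divr_gt0// mulr_gt0.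
have uc : 1 <= u.
  rewrite ler_pdivlMr// mul1r; have := ler_wpM2l (ltW mu0) xN.
  rewrite mulrC divfK ?gt_eqF// => h; apply: le_trans (_ : mu * x <= _).
    by apply: le_trans h; rewrite ler_peMl ?(ltW N0)// expr_ge1// ler1n.
  by rewrite ler_wpM2r// ltW.
have lnu : 0 <= ln u by rewrite ln_ge0.
have lm : 0 <= Lg / mu by rewrite divr_ge0 ?(ltW Lg0) ?(ltW mu0).
rewrite -natr1 (le_trans (lerD (ceiln_lt _) (lexx _)))//.
  by rewrite mulr_ge0// mulr_ge0.
have := ler_wpM2l lm (ln_le_div a0 u0).
have -> : 4 * (Lg / mu) * (Lg / N / a) * x = 4 * (Lg / mu * (u / a)).
  by rewrite /u; field; rewrite !gt_eqF.
by rewrite mulrDr; move: (Lg / mu) => l; lra.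
Qed.

(** In the small-eps regime the minimum defining sigma is attained by its eps-dependent entry. *)
Lemma penalty_scale (R : realType) (q rad kappa a c d eps : R) : 0 < q ->
  eps <= q * (rad / kappa) -> eps <= q * a -> eps <= q * c -> eps <= q * d ->
  128^-1 * Num.min (rad / kappa) (Num.min (eps / q) (Num.min a (Num.min c d))) = eps / (128 * q).
Proof.
move=> q0 h1 h2 h3 h4.
have h x : eps <= q * x -> eps / q <= x by rewrite ler_pdivrMr// mulrC.
rewrite [Num.min (eps / q) _]min_l ?le_min ?h// min_r ?h//.
by rewrite invfM mulrCA mulrA.
Qed.

Section Start.
Context (R : realType) (dx dy : nat) (mu Cf Lf Lg rhof rhog sbar : R).
Context (f g : 'rV[R]_(dx + dy) -> R).
Hypotheses (mu0 : 0 < mu) (Cf0 : 0 < Cf) (Lf0 : 0 < Lf) (Lg0 : 0 < Lg) (sbar0 : 0 < sbar).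
Hypothesis BA : bilevel_assumption mu Cf Lf Lg rhof rhog sbar f g.

(** Some minimizer of g lies within 2 sqrt(rad), as the infimum is only approached, and the penalty
    solution is at most sqrt(rad) further. The gap is then at most 9/2 L rad, below 12 L rad. *)
Lemma start_gap_le (s rad : R) (x : 'rV[R]_dx) (y : 'rV[R]_dy) : 0 <= s <= sbar ->
  0 < rad -> dist y (Ystar g x) ^+ 2 = rad -> 2 * Cf / mu * s <= Num.sqrt rad ->
  pen f g s (row_mx x y) - pen_min f g s x <= 3 * (Lpen Lf Lg s * (4 * rad)).
Proof.
move=> sb rad0 drad small; have /andP[s0 _] := sb.
have [y1 my1] := lower_sol_exists sbar0 BA x.
have d0 : 0 <= dist y (Ystar g x).
  by apply: lb_le_inf; [exists (enorm (y - y1)), y1|move=> _ [z _ <-]; exact: enorm_ge0].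
have r0 : 0 < Num.sqrt rad by rewrite sqrtr_gt0.
have dE : dist y (Ystar g x) = Num.sqrt rad by rewrite -drad sqrtr_sqr ger0_norm.
have hi : has_inf [set enorm (y - z) | z in Ystar g x].
  split; first by exists (enorm (y - y1)), y1.
  by exists 0 => _ [z _ <-]; exact: enorm_ge0.
have [_ [z mz <-]] := inf_adherent r0 hi; rewrite -/(dist y (Ystar g x)) dE => yz.
have [z' mz' zz'] := pen_sol_shift mu0 Cf0 Lf0 Lg0 BA sb mz.
have yz' : enorm (y - z') <= 3 * Num.sqrt rad.
  have -> : y - z' = (y - z) - (z' - z) by rewrite opprB addrA subrK.
  apply: (le_trans (enormB _ _)).
  by move: yz zz' small; move: (enorm (y - z)) (enorm (z' - z)) => u v; lra.
apply: (le_trans (pen_gap_le Lf0 Lg0 BA y sb mz')).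
have L0 : 0 <= Lpen Lf Lg s by rewrite ltW// Lpen_gt0.
have h : enorm (y - z') ^+ 2 <= 9 * rad.
  have -> : 9 * rad = (3 * Num.sqrt rad) ^+ 2 by rewrite exprMn sqr_sqrtr ?(ltW rad0)//; ring.
  by rewrite ler_sqr ?nnegrE ?enorm_ge0// (le_trans (enorm_ge0 _) yz').
have L2 : 0 <= Lpen Lf Lg s / 2 by rewrite divr_ge0.
apply: (le_trans (ler_wpM2l L2 h)).
have : 0 <= Lpen Lf Lg s * rad by rewrite mulr_ge0 ?(ltW rad0).
by move: (Lpen Lf Lg s) => l; lra.
Qed.

End Start.

Section ParameterChoice.
Context (R : realType) (b mu Lg Mf Mg rad ell eps sigma eta : R).
Hypotheses (mu0 : 0 < mu) (muLg : mu <= Lg) (Lgl : Lg <= ell) (eps0 : 0 < eps).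
Hypotheses (Mf0 : 0 <= Mf <= b) (Mg0 : 0 <= Mg <= b) (rad0 : 0 < rad <= b).
Local Notation kappa := (ell / mu).
Local Notation q := (ell * kappa ^+ 3).
Hypothesis sigmaE : sigma = eps / (128 * q).
Hypothesis epsq : eps <= q.
Hypothesis eps1 : eps <= 1.

Definition batch_size : nat := maxn 1 (ceiln (64 ^+ 2 *
  (Lg ^+ 2 * (sigma ^+ 2 * Mf ^+ 2 + Mg ^+ 2) / (mu ^+ 2 * sigma ^+ 2 * eps ^+ 2)))).

(** 128 = 4 * 32 comes from the requirement 4 b < T eta eps^2; the successor makes the inequality
    strict. *)
Definition horizon : nat := (ceiln (128 * b * (q * eps ^- 2))).+1.

Let Lg0 : 0 < Lg. Proof. exact: lt_le_trans mu0 muLg. Qed.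
Let l0 : 0 < ell. Proof. exact: lt_le_trans Lg0 Lgl. Qed.
Let k1 : 1 <= kappa. Proof. exact: kappa_ge1 mu0 Lgl muLg. Qed.
Let k0 : 0 < kappa. Proof. exact: lt_le_trans ltr01 k1. Qed.
Let q0 : 0 < q. Proof. by rewrite mulr_gt0// exprn_gt0. Qed.
Let b0 : 0 < b. Proof. by case/andP: rad0; exact: lt_le_trans. Qed.
Let s0 : 0 < sigma. Proof. by rewrite sigmaE divr_gt0// mulr_gt0. Qed.

Lemma batch_size_gt0 : (0 < batch_size)%N.
Proof. by rewrite leq_max. Qed.

Lemma batch_size_large : (sigma ^+ 2 * Mf ^+ 2 + Mg ^+ 2) / batch_size%:R <=
  mu ^+ 2 * sigma ^+ 2 * eps ^+ 2 / (64 ^+ 2 * Lg ^+ 2).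
Proof.
have B0 : 0 < batch_size%:R :> R by rewrite ltr0n batch_size_gt0.
rewrite ler_pdivrMr// [leRHS]mulrAC ler_pdivlMr; last by rewrite mulr_gt0// exprn_gt0.
have d0 : 0 < mu ^+ 2 * sigma ^+ 2 * eps ^+ 2 by rewrite !mulr_gt0// exprn_gt0.
rewrite -ler_pdivrMl//.
have : 64 ^+ 2 * (Lg ^+ 2 * (sigma ^+ 2 * Mf ^+ 2 + Mg ^+ 2) / (mu ^+ 2 * sigma ^+ 2 * eps ^+ 2))
    <= batch_size%:R.
  by apply: (le_trans (ceiln_ge _)); rewrite ler_nat leq_max leqnn orbT.
apply: le_trans; rewrite le_eqVlt; apply/orP; left; apply/eqP.
by move: (_^-1) (64 ^+ 2) => i c; ring.
Qed.

Lemma batch_size1 : Mf = 0 -> Mg = 0 -> batch_size = 1%N.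
Proof.
rewrite /batch_size => -> ->; rewrite expr0n/= mulr0 addr0 mulr0 mul0r mulr0.
by apply/maxn_idPl; rewrite ceiln_le_nat.
Qed.

(** Inserting sigma = eps / (128 q) cancels sigma in the Mf term and turns the Mg term into order
    eps^-4. The summand 2 pays for the maximum with 1 and for the rounding. *)
Let batch_size_le : batch_size%:R <= 2 + 64 ^+ 2 * ((Lg / mu) ^+ 2 *
  (Mf ^+ 2 * eps ^- 2 + Mg ^+ 2 * (128 ^+ 2 * (q ^+ 2 * eps ^- 4)))).
Proof.
rewrite /batch_size; set r := 64 ^+ 2 * _.
have -> : 64 ^+ 2 * ((Lg / mu) ^+ 2 *
    (Mf ^+ 2 * eps ^- 2 + Mg ^+ 2 * (128 ^+ 2 * (q ^+ 2 * eps ^- 4)))) = r.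
  rewrite /r sigmaE; move: q q0 => Q Q0; congr (_ * _).
  by field; rewrite !gt_eqF.
have r0 : 0 <= r.
  apply: mulr_ge0; first exact: exprn_ge0.
  apply: divr_ge0; last by rewrite -!exprMn sqr_ge0.
  apply: mulr_ge0; first exact: sqr_ge0.
  by apply: addr_ge0; rewrite -?exprMn sqr_ge0.
apply: (@le_trans _ _ (1 + (ceiln r)%:R)).
  have -> : 1 + (ceiln r)%:R = (ceiln r).+1%:R :> R by rewrite -nat1r.
  by rewrite ler_nat geq_max leqnSn.
by have := ceiln_lt r0; lra.
Qed.

Let ratio_le : (Lg / mu) ^+ 2 <= kappa ^+ 2.
Proof.
by rewrite ler_sqr ?nnegrE ?divr_ge0 ?ler_wpM2r ?invr_ge0// ltW.
Qed.

Let sqr_le_b m : 0 <= m <= b -> m ^+ 2 <= b ^+ 2.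
Proof. by move=> /andP[m0 mb]; rewrite ler_sqr ?nnegrE ?(ltW b0). Qed.

Lemma batch_size_le2 : Mg = 0 ->
  batch_size%:R <= (2 + 64 ^+ 2 * b ^+ 2) * (kappa ^+ 2 * eps ^- 2).
Proof.
move=> Mg_0; apply: (le_trans batch_size_le); rewrite Mg_0 [0 ^+ 2]expr0n/= mul0r addr0.
have e2 : 1 <= eps ^- 2 by rewrite invf_ge1 ?exprn_gt0// expr_le1// ltW.
have ke : 1 <= kappa ^+ 2 * eps ^- 2 by rewrite mulr_ege1// expr_ge1// ltW.
rewrite mulrDl; apply: lerD; first by rewrite ler_peMr.
rewrite -[leRHS]mulrA ler_wpM2l ?exprn_ge0//.
have -> : b ^+ 2 * (kappa ^+ 2 * eps ^- 2) = kappa ^+ 2 * (b ^+ 2 * eps ^- 2) by ring.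
have e20 : 0 <= eps ^- 2 by rewrite invr_ge0 exprn_ge0// ltW.
apply: ler_pM ratio_le _; first exact: sqr_ge0.
  by apply: mulr_ge0 => //; exact: sqr_ge0.
by apply: ler_wpM2r => //; exact: sqr_le_b.
Qed.

Lemma batch_size_le4 : batch_size%:R <=
  (2 + 64 ^+ 2 * (b ^+ 2 * (1 + 128 ^+ 2))) * (kappa ^+ 2 * (q ^+ 2 * eps ^- 4)).
Proof.
apply: (le_trans batch_size_le).
have e2 : 1 <= eps ^- 2 by rewrite invf_ge1 ?exprn_gt0// expr_le1// ltW.
have qe : eps ^- 2 <= q ^+ 2 * eps ^- 4.
  have -> : eps ^- 4 = eps ^- 2 * eps ^- 2 by rewrite -invfM -exprD.
  rewrite mulrA ler_peMl ?invr_ge0 ?exprn_ge0 ?(ltW eps0)// -exprVn -exprMn expr_ge1//.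
    by rewrite ler_pdivlMr// mul1r.
  by rewrite divr_ge0// ltW.
have k2 : 1 <= kappa ^+ 2 by rewrite expr_ge1// ltW.
have ke : 1 <= kappa ^+ 2 * (q ^+ 2 * eps ^- 4) by rewrite mulr_ege1// (le_trans e2).
rewrite mulrDl; apply: lerD; first by rewrite ler_peMr.
rewrite -[leRHS]mulrA ler_wpM2l ?exprn_ge0//.
set Q := q ^+ 2 * eps ^- 4 in qe ke *.
have Q0 : 0 <= Q by apply: le_trans qe; rewrite (le_trans _ e2).
have -> : b ^+ 2 * (1 + 128 ^+ 2) * (kappa ^+ 2 * Q) =
  kappa ^+ 2 * (b ^+ 2 * Q + b ^+ 2 * (128 ^+ 2 * Q)) by ring.
have c0 : 0 <= 128 ^+ 2 * Q by rewrite mulr_ge0 ?exprn_ge0.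
have e20 := le_trans ler01 e2.
apply: ler_pM ratio_le _; first exact: sqr_ge0.
  by apply: addr_ge0; apply: mulr_ge0 => //; exact: sqr_ge0.
apply: lerD; last by apply: ler_wpM2r => //; exact: sqr_le_b.
by apply: ler_pM => //; [exact: sqr_ge0|exact: sqr_le_b].
Qed.

Lemma horizon_le : horizon%:R <= (128 * b + 2) * (q * eps ^- 2).
Proof.
rewrite /horizon; set X := q * eps ^- 2.
have X1 : 1 <= X.
  rewrite ler_pdivlMr ?exprn_gt0// mul1r; apply: le_trans epsq.
  by rewrite expr2 ler_piMr// ltW.
have X0 := le_trans ler01 X1.
have bX : 0 <= 128 * b * X by rewrite mulr_ge0// mulr_ge0// ltW.
by rewrite -natr1; have := ceiln_lt bX; move: (128 * b * X) (mulrDl (128 * b) 2 X) => u ->; lra.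
Qed.

Lemma horizon_gt : 4 * b < horizon%:R * ((32 * q)^-1 * eps ^+ 2).
Proof.
have X0 : 0 < q * eps ^- 2 by rewrite mulr_gt0// invr_gt0 exprn_gt0.
have -> : (32 * q)^-1 * eps ^+ 2 = (32 * (q * eps ^- 2))^-1.
  by move: q q0 => Q Q0; field; rewrite !gt_eqF.
rewrite ltr_pdivlMr; last by rewrite pmulr_rgt0.
apply: (@le_lt_trans _ _ (128 * b * (q * eps ^- 2))).
  by move: (q * _) => X; rewrite le_eqVlt; apply/orP; left; apply/eqP; ring.
apply: (le_lt_trans (ceiln_ge _)); rewrite ltr_nat /horizon; exact: ltnSn.
Qed.

Lemma horizon_drop : horizon%:R * ((32 * q)^-1 * eps ^+ 2 / 4) <= b + 1.
Proof.
have X0 : 0 < q * eps ^- 2 by rewrite mulr_gt0// invr_gt0 exprn_gt0.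
have h : 0 <= (32 * q)^-1 * eps ^+ 2 / 4.
  by rewrite divr_ge0// mulr_ge0 ?exprn_ge0 ?(ltW eps0)// invr_ge0 mulr_ge0// ltW.
apply: (le_trans (ler_wpM2r h horizon_le)).
have -> : (128 * b + 2) * (q * eps ^- 2) * ((32 * q)^-1 * eps ^+ 2 / 4) = b + 64^-1.
  by move: q q0 => Q Q0; field; rewrite !gt_eqF.
by rewrite lerD2l invf_le1// ler1n.
Qed.

End ParameterChoice.

(** 52 = 40 + 4 + 8, one summand per term; every term without a logarithm is absorbed through 1 <=
    la <= 2 loge. *)
Lemma count_budget (R : realType) (kappa l la loge D : R) :
  0 <= l <= kappa -> 1 <= kappa -> 1 <= la -> la <= 2 * loge -> 0 <= D <= 1 ->
  4 * l * (5 * la) + 2 + 4 * l * D <= 52 * (kappa * loge).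
Proof.
move=> /andP[l0 lk] k1 la1 lal /andP[D0 D1].
have h1 : l * la <= kappa * (2 * loge) by apply: ler_pM => //; lra.
have h2 : l * D <= kappa * 1 by apply: ler_pM.
have h3 : 1 * 1 <= kappa * (2 * loge) by apply: ler_pM => //; lra.
have h4 : kappa * 1 <= kappa * (2 * loge) by apply: ler_wpM2l; lra.
by move: h1 h2 h3 h4; lra.
Qed.

Section Complexity.
Context (R : realType) (dx dy : nat) (dX dZ dO : measure_display).
Context (X : measurableType dX) (Z : measurableType dZ) (Om : measurableType dO).
Context (DX : probability X R) (DZ : probability Z R) (P : probability Om R).
Context (F : 'rV[R]_(dx + dy) -> X -> R) (G : 'rV[R]_(dx + dy) -> Z -> R).
Context (f g : 'rV[R]_(dx + dy) -> R) (xi : fidx -> Om -> X) (zeta : gidx -> Om -> Z).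
Context (mu Cf Lf Lg rhof rhog sbar ell Mf Mg b rad : R).
Hypotheses (mu0 : 0 < mu) (Cf0 : 0 < Cf) (Lf0 : 0 < Lf) (Lg0 : 0 < Lg).
Hypotheses (rhog0 : 0 < rhog) (sbar0 : 0 < sbar).
Hypotheses (Mf0 : 0 <= Mf <= b) (Mg0 : 0 <= Mg <= b) (rad0 : 0 < rad <= b).
Hypothesis BA : bilevel_assumption mu Cf Lf Lg rhof rhog sbar f g.
Hypotheses (Cfl : Cf <= ell) (Lfl : Lf <= ell) (Lgl : Lg <= ell) (rhogl : rhog <= ell).
Hypothesis muLg : mu <= Lg.
Hypotheses (orcF : stochastic_oracle DX Mf f F) (orcG : stochastic_oracle DZ Mg g G).
Hypothesis fresh : fresh_samples P DX DZ xi zeta.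
Context (x0 : 'rV[R]_dx) (y0 : 'rV[R]_dy).
Hypothesis phi_bounded : has_lbound (range (phi f g)).
Hypothesis phi_gap : phi f g x0 - inf (range (phi f g)) <= b.
Hypothesis drad : dist y0 (Ystar g x0) ^+ 2 = rad.

Local Notation kappa := (ell / mu).
Local Notation q := (ell * kappa ^+ 3).

Context (eps sigma eta loge : R) (K : R -> nat) (next : R -> R -> R).
Let N := mu * sigma ^+ 2 * eps ^+ 2 / Lg ^+ 2.
Hypotheses (eps0 : 0 < eps) (sigmaE : sigma = eps / (128 * q)) (epsq : eps <= q) (eps1 : eps <= 1).
Hypothesis etaE : eta = (32 * q)^-1.
Hypothesis KE : K = fun delta => ceiln (4 * (Lg / mu * ln (Lg * delta / N))).
Hypothesis nextE : next = fun delta r =>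
  2^-1 * delta + 8 * Lg ^+ 2 / mu ^+ 2 * r ^+ 2 + 128 ^+ 2 * N / mu.
Hypotheses (sigmab : sigma <= sbar) (sigmaLf : sigma * Lf <= Lg).
Hypothesis sigma_rad : 2 * kappa * sigma <= Num.sqrt rad.
Hypothesis N_rad : 128 ^+ 2 * N / mu <= 4 * rad.
Hypotheses (eps_log : 1 <= ln eps^-1) (log_le : ln eps^-1 <= 2 * loge).
Hypothesis budget : eps * (Lg ^+ 3 * (128 * q) ^+ 2 / mu *
  (12 * rad + 32 * Lg ^+ 2 * (32 * q)^-1 / mu ^+ 2 * (2 * b + 1))) <= 1.

Local Notation B := (batch_size mu Lg Mf Mg eps sigma).
Local Notation T := (horizon b mu ell eps).
Local Notation run := (F2BSA F G eta (sigma * Lf + Lg)^-1 sigma B K next).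
Local Notation calls := (fun w : Om => (F2BSA_calls F G eta (sigma * Lf + Lg)^-1 sigma B K next
  (xi^~ w) (zeta^~ w) x0 y0 (4 * rad) T)%:R : R).

Let l0 : 0 < ell. Proof. exact: lt_le_trans Lg0 Lgl. Qed.
Let k1 : 1 <= kappa. Proof. exact: kappa_ge1 mu0 Lgl muLg. Qed.
Let k0 : 0 < kappa. Proof. exact: lt_le_trans ltr01 k1. Qed.
Let q0 : 0 < q. Proof. by rewrite mulr_gt0// exprn_gt0. Qed.
Let b0 : 0 < b. Proof. by case/andP: rad0; exact: lt_le_trans. Qed.
Let s0 : 0 < sigma. Proof. by rewrite sigmaE divr_gt0// pmulr_rgt0. Qed.
Let r0 : 0 < rad. Proof. by case/andP: rad0. Qed.
Let N0 : 0 < N.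
Proof. by rewrite divr_gt0 ?exprn_gt0// mulr_gt0 ?exprn_gt0// mulr_gt0 ?exprn_gt0. Qed.
Let LgL : Lg <= Lpen Lf Lg sigma.
Proof. by rewrite /Lpen lerDr mulr_ge0// ltW. Qed.

Let sigma_small : 128 * q * sigma <= eps.
Proof. by rewrite sigmaE mulrC divfK// gt_eqF// pmulr_rgt0. Qed.

Let mK k : measurable [set r | K r = k].
Proof.
rewrite KE; apply: measurable_ceiln; apply: measurable_funM => //; apply: measurable_funM => //.
apply: (measurableT_comp (@measurable_ln R)); exact: measurable_funM.
Qed.

Let contract x : 128 ^+ 2 * N / mu <= x ->
  (1 - mu / Lpen Lf Lg sigma) ^+ (K x) * (Lpen Lf Lg sigma * x) <= 2 / 128 ^+ 2 * N.
Proof.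
move=> xN; apply: (inner_contraction mu0 muLg LgL) => //; last by rewrite KE ceiln_ge.
by rewrite /Lpen mulr2n mulrDl mul1r lerD2r.
Qed.

Let start_gap s : 0 <= s <= sigma ->
  pen f g s (row_mx x0 y0) - pen_min f g s x0 <= 3 * (Lpen Lf Lg sigma * (4 * rad)).
Proof.
move=> /andP[sg ss].
have sb : 0 <= s <= sbar by rewrite sg (le_trans ss).
apply: (le_trans (start_gap_le mu0 Cf0 Lf0 Lg0 sbar0 BA sb r0 drad _)).
  apply: le_trans sigma_rad; rewrite -!mulrA ler_wpM2l//.
  have c0 : 0 <= mu^-1 by rewrite invr_ge0 ltW.
  apply: ler_pM; rewrite ?(ltW Cf0)//; first exact: mulr_ge0.
  by rewrite ler_wpM2l.
rewrite ler_wpM2l// ler_wpM2r ?mulr_ge0 ?(ltW r0)// lerD2r ler_wpM2r//.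
exact: ltW.
Qed.

Let gap_y0 := start_gap (introT andP (conj (ltW s0) (lexx sigma))).
Let gap_z0 := start_gap (introT andP (conj (lexx 0) (ltW s0))).
Let B0 : (0 < B)%N. Proof. exact: batch_size_gt0. Qed.
Let batch_large := batch_size_large Mf Mg mu0 muLg Lgl eps0 sigmaE.

Lemma stationary_within : exists t : nat, (t < T)%N /\
  ('E_P[fun w => enorm (grad (phi f g) (st_x (run (xi^~ w) (zeta^~ w) x0 y0 (4 * rad) t)))]
     <= eps%:E)%E.
Proof.
have hT := horizon_gt b mu0 muLg Lgl eps0.
have [t [tT h]] := stationary mu0 Cf0 Lf0 Lg0 rhog0 sbar0 BA Cfl Lfl Lgl rhogl muLg orcF orcG
  fresh B0 s0 eps0 sigmab sigmaLf sigma_small batch_large mK contract N_rad gap_y0 gap_z0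
  phi_bounded phi_gap hT.
by exists t; split => //; rewrite unlock etaE nextE.
Qed.

Lemma calls_le : ('E_P[calls] <= (156 * (kappa * T%:R * B%:R * loge))%:E)%E.
Proof.
(* Since N is of order eps^4, this scale leaves one factor eps in Lg / N / a; [budget] spends it to
   keep the linear term in E[delta] below 1, while ln a is only 5 ln(1/eps). *)
pose a := eps ^- 5.
have a0 : 0 < a by rewrite invr_gt0 exprn_gt0.
have l1 : 0 <= Lg / mu <= kappa.
  by rewrite divr_ge0 ?(ltW Lg0) ?(ltW mu0)//= ler_wpM2r// invr_ge0 ltW.
have [l1' _] := andP l1.
have Lga : 0 <= Lg / N / a by do 2?apply: divr_ge0; exact: ltW.
have lna : ln a = 5 * ln eps^-1 by rewrite /a -exprVn lnXn ?invr_gt0// mulr_natl.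
have la0 : 0 <= ln eps^-1 := le_trans ler01 eps_log.
have c0 : 0 <= 4 * (Lg / mu) * ln a + 2.
  have l4 : 0 <= 4 * (Lg / mu) by exact: mulr_ge0.
  by rewrite lna; apply: addr_ge0 => //; apply: mulr_ge0 => //; exact: mulr_ge0.
have d0 : 0 <= 4 * (Lg / mu) * (Lg / N / a) by apply: mulr_ge0 => //; exact: mulr_ge0.
have Kx x : 128 ^+ 2 * N / mu <= x ->
    (K x).+1%:R <= 4 * (Lg / mu) * ln a + 2 + 4 * (Lg / mu) * (Lg / N / a) * x.
  by move=> xN; rewrite KE; exact: inner_count_le.
have h := Ex_calls mu0 Cf0 Lf0 Lg0 rhog0 sbar0 BA Cfl Lfl Lgl rhogl muLg orcF orcG
  fresh B0 s0 eps0 sigmab sigmaLf sigma_small batch_large mK contract N_rad gap_y0 gap_z0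
  phi_bounded phi_gap T c0 d0 Kx.
rewrite unlock etaE nextE; apply: (le_trans h); rewrite lee_fin.
set D := 4 * rad + _ + _.
have TD := horizon_drop mu0 muLg Lgl eps0 rad0 epsq eps1.
have cD : 0 <= 32 * Lg ^+ 2 * (32 * q)^-1 / mu ^+ 2.
  apply: divr_ge0; last exact: sqr_ge0.
  apply: mulr_ge0; first by apply: mulr_ge0 => //; exact: sqr_ge0.
  by rewrite invr_ge0 ltW// pmulr_rgt0.
have D0 : D <= 12 * rad + 32 * Lg ^+ 2 * (32 * q)^-1 / mu ^+ 2 * (2 * b + 1).
  have : 32 * Lg ^+ 2 * (32 * q)^-1 / mu ^+ 2 * (b + T%:R * ((32 * q)^-1 * eps ^+ 2 / 4)) <=
      32 * Lg ^+ 2 * (32 * q)^-1 / mu ^+ 2 * (2 * b + 1).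
    by apply: ler_wpM2l => //; move: TD; lra.
  move: N_rad; rewrite /D -/N.
  by move: (_ * (b + _)) (_ * (2 * b + 1)) (128 ^+ 2 * N / mu) => u v w; lra.
have D1 : Lg / N / a * D <= 1.
  apply: le_trans budget.
  have -> : Lg / N / a = eps * (Lg ^+ 3 * (128 * q) ^+ 2 / mu).
    rewrite /N /a sigmaE; move: q q0 => Q Q0.
    by field; rewrite !gt_eqF.
  rewrite -mulrA; apply: ler_wpM2l; first exact: ltW.
  apply: ler_wpM2l => //; apply: divr_ge0; last exact: ltW.
  apply: mulr_ge0; last exact: sqr_ge0.
  by rewrite exprn_ge0// ltW.
have D00 : 0 <= Lg / N / a * D.
  apply: mulr_ge0 => //; apply: addr_ge0; last first.
    by rewrite mulr_ge0// divr_ge0 ?(ltW mu0)// mulr_ge0 ?(ltW N0)// exprn_ge0.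
  apply: addr_ge0; first by rewrite mulr_ge0// ltW.
  apply: mulr_ge0 => //; apply: addr_ge0; first exact: ltW.
  apply: mulr_ge0 => //; apply: divr_ge0 => //; apply: mulr_ge0; last exact: sqr_ge0.
  by rewrite invr_ge0 ltW// pmulr_rgt0.
have D01 : 0 <= Lg / N / a * D <= 1 by rewrite D00.
have := count_budget l1 k1 eps_log log_le D01.
rewrite lna; set A := 4 * _ * _ + 2 + _ => hA.
rewrite -(mulrA (4 * (Lg / mu))).
have BT : 0 <= 3 * B%:R * T%:R :> R by rewrite mulr_ge0// mulr_ge0.
apply: (le_trans (ler_wpM2l BT hA)).
by rewrite le_eqVlt; apply/orP; left; apply/eqP; ring.
Qed.

Lemma calls_le_of_batch (Bb : R) : B%:R <= Bb ->
  ('E_P[calls] <= (156 * (128 * b + 2) * (ell * kappa ^+ 4 * eps ^- 2 * Bb * loge))%:E)%E.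
Proof.
move=> hB; apply: (le_trans calls_le); rewrite lee_fin -[leRHS]mulrA ler_wpM2l//.
have lg0 : 0 <= loge by move: (le_trans eps_log log_le); lra.
have -> : (128 * b + 2) * (ell * kappa ^+ 4 * eps ^- 2 * Bb * loge) =
    kappa * ((128 * b + 2) * (q * eps ^- 2)) * Bb * loge by ring.
apply: ler_wpM2r => //; apply: ler_pM => //; first by rewrite mulr_ge0// ltW.
by apply: ler_wpM2l; [exact: ltW|exact: (horizon_le eps0 rad0 epsq eps1)].
Qed.

End Complexity.

(* The constants hidden in the parameter choices are numerical; those hidden in
   the bounds depend only on a bound b on Delta, dist^2(y0, Ystar(x0)), Mf, Mg;
   the threshold eps0 of the small-eps regime and T do not depend on f, g, the
   dimensions, the oracles or the initial points. *)
Theorem theorem4p2 (R : realType) :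
  exists c_eta c_sigma c_B c_K c_delta c_rec : R,
  [/\ 0 < c_eta, 0 < c_sigma & 0 < c_B] /\
  [/\ 0 < c_K, 0 < c_delta & 0 < c_rec] /\
  forall b : R,
  exists C_T C_tot C_1 C_2 C_3 : R,
  forall mu Cf Lf Lg rhof rhog sbar Mf Mg rad : R,
  [/\ 0 < mu, 0 < Cf, 0 < Lf & 0 < Lg] ->
  [/\ 0 < rhof, 0 < rhog & 0 < sbar] ->
  0 <= Mf <= b -> 0 <= Mg <= b -> 0 < rad <= b ->
  mu <= Lg ->
  let ell := Num.max (Num.max Cf Lf) (Num.max Lg rhog) in
  let kappa := ell / mu in
  exists eps0 : R, 0 < eps0 /\
  forall eps : R, 0 < eps <= eps0 ->
  let eta := c_eta * (ell^-1 * kappa ^- 3) in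
  let sigma := c_sigma *
    Num.min (rad / kappa) (Num.min (eps / (ell * kappa ^+ 3))
      (Num.min (Lg / Lf) (Num.min (rhog / rhof) sbar))) in
  let tau := (sigma * Lf + Lg)^-1 in
  let B := maxn 1 (ceiln (c_B *
    (Lg ^+ 2 * (sigma ^+ 2 * Mf ^+ 2 + Mg ^+ 2)
      / (mu ^+ 2 * sigma ^+ 2 * eps ^+ 2)))) in
  let K := fun delta : R => ceiln (c_K *
    (Lg / mu * ln (Lg ^+ 3 * delta / (mu * sigma ^+ 2 * eps ^+ 2)))) in
  let delta0 := c_delta * rad in
  let next := fun delta r : R =>
    2^-1 * delta + 8 * Lg ^+ 2 / mu ^+ 2 * r ^+ 2
      + c_rec * (sigma ^+ 2 * eps ^+ 2 / Lg ^+ 2) in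
  exists T : nat, T%:R <= C_T * (ell * kappa ^+ 3 * eps ^- 2) /\
  forall (dx dy : nat) (f g : 'rV[R]_(dx + dy) -> R)
    (dX dZ dO : measure_display)
    (X : measurableType dX) (Z : measurableType dZ) (Om : measurableType dO)
    (DX : probability X R) (DZ : probability Z R) (P : probability Om R)
    (F : 'rV[R]_(dx + dy) -> X -> R) (G : 'rV[R]_(dx + dy) -> Z -> R)
    (xi : fidx -> Om -> X) (zeta : gidx -> Om -> Z)
    (x0 : 'rV[R]_dx) (y0 : 'rV[R]_dy),
  bilevel_assumption mu Cf Lf Lg rhof rhog sbar f g ->
  stochastic_oracle DX Mf f F ->
  stochastic_oracle DZ Mg g G ->
  fresh_samples P DX DZ xi zeta ->
  has_lbound (range (phi f g)) ->
  phi f g x0 - inf (range (phi f g)) <= b ->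
  dist y0 (Ystar g x0) ^+ 2 = rad ->
  let x_ := fun (t : nat) (w : Om) => st_x (F2BSA F G eta tau sigma B K next
    (xi^~ w) (zeta^~ w) x0 y0 delta0 t) in
  let calls := fun w : Om => (F2BSA_calls F G eta tau sigma B K next
    (xi^~ w) (zeta^~ w) x0 y0 delta0 T)%:R : R in
  let loge := ln (rhof * ell * kappa / eps) in
  [/\ exists t : nat, (t < T)%N /\
        ('E_P[fun w => enorm (grad (phi f g) (x_ t w))] <= eps%:E)%E,
      ('E_P[calls] <= (C_tot * (kappa * T%:R * B%:R * loge))%:E)%E,
      Mf = 0 -> Mg = 0 ->
        ('E_P[calls] <= (C_1 * (ell * kappa ^+ 4 * eps ^- 2 * loge))%:E)%E,
      0 < Mf -> Mg = 0 ->
        ('E_P[calls] <= (C_2 * (ell * kappa ^+ 6 * eps ^- 4 * loge))%:E)%E &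
      0 < Mf -> 0 < Mg ->
        ('E_P[calls] <=
          (C_3 * (ell ^+ 3 * kappa ^+ 12 * eps ^- 6 * loge))%:E)%E].
Proof.
(* 1/32 matches the constant 8 of [phi_expand], 1/128 keeps the bias below 12/128 eps, 64^2 and
   128^2 are the noise level and the floor of delta for which the invariant closes at 3. The first 4
   comes from [inner_contraction], the second from [start_gap_le]. *)
exists 32^-1, 128^-1, (64 ^+ 2), 4, 4, (128 ^+ 2).
split; first by rewrite !invr_gt0 exprn_gt0//; split; rewrite ltr0n.
split; first by rewrite exprn_gt0//; split; rewrite ltr0n.
move=> b; set A : R := 156 * (128 * b + 2).
(* 156 = 3 * 52: three batches per inner step times the constant of [count_budget]. The factor 128 b
   + 2 bounds the horizon, and the remaining ones bound the batch size. *)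
exists (128 * b + 2), 156, A, (A * (2 + 64 ^+ 2 * b ^+ 2)),
  (A * (2 + 64 ^+ 2 * (b ^+ 2 * (1 + 128 ^+ 2)))).
move=> mu Cf Lf Lg rhof rhog sbar Mf Mg rad [mu0 Cf0 Lf0 Lg0] [rhof0 rhog0 sbar0].
move=> Mf0 Mg0 rad0 muLg ell kappa.
have Cfl : Cf <= ell by rewrite !le_max lexx.
have Lfl : Lf <= ell by rewrite !le_max lexx orbT.
have Lgl : Lg <= ell by rewrite !le_max lexx !orbT.
have rhogl : rhog <= ell by rewrite !le_max lexx !orbT.
clearbody ell; pose q := ell * kappa ^+ 3.
have l0 : 0 < ell := lt_le_trans Lg0 Lgl.
have k0 : 0 < kappa by rewrite divr_gt0.
have q0 : 0 < q by rewrite mulr_gt0// exprn_gt0.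
have r0 : 0 < rad by case/andP: rad0.
have b0 : 0 < b by case/andP: rad0; exact: lt_le_trans.
have sr0 : 0 < Num.sqrt rad by rewrite sqrtr_gt0.
pose M := Lg ^+ 3 * (128 * q) ^+ 2 / mu *
  (12 * rad + 32 * Lg ^+ 2 * (32 * q)^-1 / mu ^+ 2 * (2 * b + 1)).
have M0 : 0 < M.
  apply: mulr_gt0.
    by rewrite divr_gt0// mulr_gt0 ?exprn_gt0// pmulr_rgt0.
  apply: addr_gt0; first by rewrite pmulr_rgt0.
  apply: mulr_gt0; last by rewrite addr_gt0// pmulr_rgt0.
  apply: divr_gt0; last exact: exprn_gt0.
  apply: mulr_gt0; last by rewrite invr_gt0 pmulr_rgt0.
  by rewrite pmulr_rgt0// exprn_gt0.
(* expR (-1) gives ln(1/eps) >= 1; the entries with rad / kappa, Lg / Lf, rhog / rhof and sbar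
   reduce sigma to eps / (128 q); the one with sqrt(rad) serves the start; the square compares the
   two logarithms; the last two bound the floor of delta and provide [budget]. *)
have [|e0 e00 he0] := @common_threshold R [:: 1; expR (-1); q; q * (rad / kappa); q * (Lg / Lf);
    q * (rhog / rhof); q * sbar; q * Num.sqrt rad / kappa; (rhof * ell * kappa) ^+ 2;
    q ^+ 2 * Lg ^+ 2 * rad; M^-1].
  have qm c : 0 < c -> 0 < q * c by exact: mulr_gt0.
  have p6 : 0 < (rhof * ell * kappa) ^+ 2 by rewrite exprn_gt0// mulr_gt0// mulr_gt0.
  have p7 : 0 < q ^+ 2 * Lg ^+ 2 * rad by rewrite mulr_gt0// mulr_gt0// exprn_gt0.
  rewrite /= ltr01 expR_gt0 q0 invr_gt0 M0 p6 p7 !qm ?divr_gt0//.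
  exact: qm.
exists e0; split=> // eps /andP[eps0 /he0 small]; rewrite /= in small.
move: small => /and5P[eps1 epsE epsq h1 /and5P[h2 h3 h4 h5 /and4P[h6 h7 h8 _]]].
move=> eta sigma tau B K delta0 next.
have sigmaE : sigma = eps / (128 * q) by exact: penalty_scale.
have etaE : eta = (32 * q)^-1 by rewrite /eta /q -!invfM.
have q128 : 0 < 128 * q by rewrite pmulr_rgt0.
have s0 : 0 < sigma by rewrite sigmaE divr_gt0.
have sigma_le : sigma <= eps / q.
  rewrite sigmaE; apply: ler_wpM2l; first exact: ltW.
  rewrite lef_pV2 ?posrE//; apply: ler_peMl; [exact: ltW|by rewrite ler1n].
have le_q c : eps <= q * c -> sigma <= c.
  move=> h; apply: le_trans sigma_le _.
  by rewrite ler_pdivrMr// mulrC.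
have sigmab : sigma <= sbar by exact: le_q.
have sigmaLf : sigma * Lf <= Lg by rewrite -ler_pdivlMr//; exact: le_q.
have sigma_rad : 2 * kappa * sigma <= Num.sqrt rad.
  rewrite sigmaE; apply: (@le_trans _ _ (kappa * (eps / q))).
    have -> : 2 * kappa * (eps / (128 * q)) = 64^-1 * (kappa * (eps / q)).
      by field; rewrite gt_eqF.
    rewrite ler_piMl//; last by rewrite invf_le1// ler1n.
    by rewrite mulr_ge0 ?divr_ge0// ltW.
  rewrite -ler_pdivlMl// ler_pdivrMr//; apply: (le_trans h5).
  by rewrite le_eqVlt; apply/orP; left; apply/eqP; ring.
pose N := mu * sigma ^+ 2 * eps ^+ 2 / Lg ^+ 2.
have NE : 128 ^+ 2 * N / mu = 128 ^+ 2 * (sigma ^+ 2 * eps ^+ 2 / Lg ^+ 2).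
  by rewrite /N; move: (128 ^+ 2) => c; field; rewrite !gt_eqF.
have N_rad : 128 ^+ 2 * N / mu <= 4 * rad.
  have -> : 128 ^+ 2 * N / mu = eps ^+ 4 / (q ^+ 2 * Lg ^+ 2).
    by rewrite NE sigmaE; field; rewrite !gt_eqF.
  apply: (@le_trans _ _ rad); last by rewrite ler_peMl ?(ltW r0)// ler1n.
  have d0 : 0 < q ^+ 2 * Lg ^+ 2 by apply: mulr_gt0; exact: exprn_gt0.
  rewrite ler_pdivrMr// [leRHS]mulrC; apply: le_trans h7.
  by rewrite exprS ler_piMr ?(ltW eps0)// exprn_ile1// ltW.
have eps_log : 1 <= ln eps^-1.
  by rewrite lnV ?posrE// lerNr -[- 1]expRK ler_ln ?posrE// expR_gt0.
pose loge := ln (rhof * ell * kappa / eps).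
(* The stated logarithm may carry a small rhof; for eps <= (rhof ell kappa)^2 its double still
   dominates ln(1/eps). *)
have log_le : ln eps^-1 <= 2 * loge.
  have p0 : 0 < rhof * ell * kappa by rewrite mulr_gt0// mulr_gt0.
  have -> : 2 * loge = ln ((rhof * ell * kappa / eps) ^+ 2) by rewrite lnXn ?divr_gt0// mulr_natl.
  rewrite ler_ln ?posrE ?invr_gt0 ?exprn_gt0 ?divr_gt0//.
  rewrite expr_div_n ler_pdivlMr ?exprn_gt0// expr2 mulrA mulVf ?gt_eqF// mul1r.
  exact: h6.
have budget : eps * M <= 1.
  by rewrite -ler_pdivlMr// mul1r.
have KE : K = fun delta => ceiln (4 * (Lg / mu * ln (Lg * delta / N))).
  apply/funext => delta; rewrite /K /N; congr (ceiln (4 * (Lg / mu * ln _))).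
  by field; rewrite !gt_eqF.
have nextE : next = fun delta r =>
    2^-1 * delta + 8 * Lg ^+ 2 / mu ^+ 2 * r ^+ 2 + 128 ^+ 2 * N / mu.
  by apply/funext => delta; apply/funext => r; rewrite NE.
exists (horizon b mu ell eps); split; first exact: (horizon_le eps0 rad0 epsq eps1).
move=> dx dy f g dX dZ dO X Z Om DX DZ P F G xi zeta x0 y0 BA orcF orcG fresh phib phig drad.
move=> x_ calls loge'.
have bound Bb := calls_le_of_batch mu0 Cf0 Lf0 Lg0 rhog0 sbar0 rad0 BA Cfl Lfl Lgl rhogl muLg
  orcF orcG fresh phib phig drad eps0 sigmaE epsq eps1 etaE KE nextE sigmab sigmaLf sigma_rad
  N_rad eps_log log_le budget (Bb := Bb).
split.
- exact: (stationary_within mu0 Cf0 Lf0 Lg0 rhog0 sbar0 rad0 BA Cfl Lfl Lgl rhogl muLg orcF orcG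
    fresh phib phig drad eps0 sigmaE etaE KE nextE sigmab sigmaLf sigma_rad N_rad).
- exact: (calls_le mu0 Cf0 Lf0 Lg0 rhog0 sbar0 rad0 BA Cfl Lfl Lgl rhogl muLg orcF orcG
    fresh phib phig drad eps0 sigmaE epsq eps1 etaE KE nextE sigmab sigmaLf sigma_rad N_rad
    eps_log log_le budget).
- move=> Mf_0 Mg_0; have B1 : (batch_size mu Lg Mf Mg eps sigma)%:R <= 1 :> R.
    by rewrite batch_size1.
  by have := bound _ B1; rewrite mulr1.
- move=> _ Mg_0; have B2 := batch_size_le2 mu0 muLg Lgl eps0 Mf0 rad0 sigmaE eps1 Mg_0.
  apply: (le_trans (bound _ B2)); rewrite lee_fin le_eqVlt; apply/orP; left; apply/eqP.
  by rewrite /A /loge /loge' -!exprVn -/kappa; ring.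
- move=> _ _; have B4 := batch_size_le4 mu0 muLg Lgl eps0 Mf0 Mg0 rad0 sigmaE epsq eps1.
  apply: (le_trans (bound _ B4)); rewrite lee_fin le_eqVlt; apply/orP; left; apply/eqP.
  by rewrite /A /loge /loge' -!exprVn -/kappa; ring.
Qed.
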